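(* Let $\gamma>-1$ and $\alpha>0$. For $n\in\mathbb{N}$ let $$x_n=\log\Big(\sum_{k=0}^{n-1}P_k(0)^2\Big),\qquad \omega_n=-\frac{\sum_{k=0}^{n-1}P_k(0)^2}{b_{n-1}P_{n-1}(0)P_n(0)},$$ where $$P_n(z)=\frac{(-1)^n}{h_n}L_n^{(\gamma)}(z-\alpha),\qquad h_n=\binom{n+\gamma}{n}^{1/2},\qquad b_n=\sqrt{(n+1)(n+\gamma+1)},\qquad n\in\mathbb{N}\cup\{0\}.$$ Then $$x_n=4\sqrt{\alpha n}+\log\Big(\frac{\Gamma(\gamma+1)}{8\pi\alpha^{\gamma+1}e^\alpha}\Big)+O(n^{-1/2}),\qquad \omega_n=\frac{1}{2\sqrt{\alpha n}}+O(n^{-1}),$$ as $n\to\infty$.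
   Context: $L_n^{(\gamma)}(z)=\sum_{k=0}^n\binom{n+\gamma}{n-k}\frac{(-z)^k}{k!}$ are the Laguerre--Sonin polynomials, with generalized binomial coefficients defined via the gamma function, e.g. $\binom{n+\gamma}{n}=\frac{\Gamma(n+\gamma+1)}{\Gamma(\gamma+1)\Gamma(n+1)}$. The $P_n$ are the orthonormal polynomials of the probability measure $\frac{1}{\Gamma(\gamma+1)}\mathbf{1}_{(\alpha,\infty)}(\lambda)(\lambda-\alpha)^\gamma e^{-(\lambda-\alpha)}d\lambda$, and the $b_n$ are the off-diagonal Jacobi parameters, that is, $zP_k(z)=b_kP_{k+1}(z)+a_kP_k(z)+b_{k-1}P_{k-1}(z)$ with $a_k=2k+1+\gamma+\alpha$. *)

(* Defs.v *)
From HB Require Import structures.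
From mathcomp Require Import all_boot all_order all_algebra.
From mathcomp Require Import all_classical all_reals all_analysis.

Set Implicit Arguments.
Unset Strict Implicit.
Unset Printing Implicit Defensive.

Import Order.TTheory GRing.Theory Num.Theory.
Import numFieldNormedType.Exports.

Local Open Scope classical_set_scope.
Local Open Scope ring_scope.

(* Euler's integral: this is the Gamma function for x > 0 only. *)
Definition Gamma {R : realType} (x : R) : R :=
  \int[lebesgue_measure]_(t in `]0, +oo[) (t `^ (x - 1) * expR (- t)).

(* Only meaningful when x + 1, y + 1 and x - y + 1 are all positive; for
   gamma > -1 this holds at every use below. *)
Definition gbinom {R : realType} (x y : R) : R :=
  Gamma (x + 1) / (Gamma (x - y + 1) * Gamma (y + 1)).

Definition laguerre {R : realType} (gamma : R) (n : nat) : {poly R} :=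
  \sum_(0 <= k < n.+1)
    (gbinom (n%:R + gamma) (n - k)%:R / k`!%:R) *: (- 'X) ^+ k.

Definition hn {R : realType} (gamma : R) (n : nat) : R :=
  Num.sqrt (gbinom (n%:R + gamma) n%:R).

Definition Pn {R : realType} (gamma alpha : R) (n : nat) : {poly R} :=
  ((-1) ^+ n / hn gamma n) *: (laguerre gamma n \Po ('X - alpha%:P)).

Definition bn {R : realType} (gamma : R) (n : nat) : R :=
  Num.sqrt ((n%:R + 1) * (n%:R + gamma + 1)).

(* xn and omegan take junk values at n = 0; only n >= 1 matters. *)
Definition xn {R : realType} (gamma alpha : R) (n : nat) : R :=
  ln (\sum_(0 <= k < n) (Pn gamma alpha k).[0] ^+ 2).

Definition omegan {R : realType} (gamma alpha : R) (n : nat) : R :=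
  - ((\sum_(0 <= k < n) (Pn gamma alpha k).[0] ^+ 2) /
     (bn gamma n.-1 * (Pn gamma alpha n.-1).[0] * (Pn gamma alpha n).[0])).

(* Main.v *)
(** Put s = sqrt alpha, a_n = L_n^(gamma)(-alpha) and
    T_n = L_n^(gamma+1)(-alpha) / a_n.  The contiguous relations give
    (n+1) a_(n+1) = (n+1 + gamma + s^2 T_n) a_n and the Riccati recursion
    T_(n+1) = 1 + (n+1) T_n / (n+1 + gamma + s^2 T_n), whose steps contract by
    a factor 1 - c / sqrt n; hence T_n = sqrt n / s + const + O(n^(-1/2)).
    Taking logarithms of the first relation,
    log P_n(0)^2 = 4 s sqrt n - (log n) / 2 + D + O(n^(-1/2)) for some D.
    The quotient (sum_(k<n) P_k(0)^2) / P_n(0)^2 obeys an affine recursion with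
    the same kind of contraction, so it is sqrt n / (2 s) + O(1); this gives
    both expansions up to the value of D.

    The constant D comes from an Abelian argument.  The generating function of
    a_n is (1-t)^(-gamma-1) exp(alpha t / (1-t)); by the above, a_n is
    asymptotic to kappa n^q exp(2 s sqrt n) for a kappa depending on D, and
    Laplace's method evaluates the corresponding sum at t = exp(-s^2 / lam) as
    lam tends to infinity.  Comparing the two yields kappa.  The norm h_n^2
    enters only through Gamma(n+gamma+1) ~ n! n^gamma, a consequence of
    Wendel's inequality. *)

Require Import Defs.
From HB Require Import structures.
From mathcomp Require Import all_boot all_order all_algebra.
From mathcomp Require Import all_classical all_reals all_analysis.
From mathcomp Require Import measurable_realfun ring lra.

Import Order.TTheory GRing.Theory Num.Theory.
Import numFieldNormedType.Exports.
Local Open Scope classical_set_scope.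
Local Open Scope ring_scope.

(** The recursions fix the growth of a_n only up to a factor that depends on the initial values, so
    D needs global information, and the generating function supplies it. The existence of the limit
    kappa is known by then, so only the easy Abelian direction is used and no Tauberian theorem.

    The orders fit together as follows. A residual of order 1/n against a contraction of rate c /
    sqrt n leaves an error of order n^(-1/2) in T_n. T_n enters the increment of log P_n(0)^2
    divided by n, so the error there is n^(-3/2), which is summable with tails O(n^(-1/2)). The same
    balance, with a source and a contraction both of order n^(-1/2), gives the O(1) error of the sum
    quotient.

    Evaluation at 0 puts the Laguerre argument at -alpha < 0, where all terms are positive; hence
    logarithms and quotients of a_n can be taken freely. Estimates are written in x = sqrt (n+1) and
    y = sqrt n subject to x^2 = y^2 + 1, which makes them statements about polynomials and
    fractions. *)

Section real_derivatives.
Context {R : realType}.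
Implicit Types (f g : R -> R) (x a b c : R).

(** This and the following rules are in pointwise form with explicit derivative values, so that they
    compose by mere application. *)
Lemma is_derive1_cst c x : is_derive x 1 (fun _ : R => c) 0.
Proof. exact: is_derive_cst. Qed.

Lemma is_derive1_id x : is_derive x 1 (fun t : R => t) 1.
Proof. exact: is_derive_id. Qed.

Lemma is_derive1_add f g x a b : is_derive x 1 f a -> is_derive x 1 g b ->
  is_derive x 1 (fun t => f t + g t) (a + b).
Proof. by move=> ? ?; exact: is_deriveD. Qed.

Lemma is_derive1_opp f x a : is_derive x 1 f a -> is_derive x 1 (fun t => - f t) (- a).
Proof. by move=> ?; exact: is_deriveN. Qed.

Lemma is_derive1_mul f g x a b : is_derive x 1 f a -> is_derive x 1 g b ->
  is_derive x 1 (fun t => f t * g t) (a * g x + f x * b).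
Proof.
move=> fa gb; apply: is_derive_eq (is_deriveM fa gb) _.
by rewrite addrC /GRing.scale/= mulrC.
Qed.

Lemma is_derive1_scale c f x a : is_derive x 1 f a ->
  is_derive x 1 (fun t => c * f t) (c * a).
Proof.
move=> fa; apply: is_derive_eq (is_derive1_mul _ _ _ _ _ (is_derive1_cst c x) fa) _.
by rewrite mul0r add0r.
Qed.

Lemma is_derive1_exprn f n x a : is_derive x 1 f a ->
  is_derive x 1 (fun t => f t ^+ n) (n%:R * f x ^+ n.-1 * a).
Proof.
move=> fa; rewrite (_ : (fun t => f t ^+ n) = f ^+ n).
  by apply: is_derive_eq (is_deriveX n fa) _.
by apply/funext => t; rewrite exprfctE.
Qed.

Lemma is_derive1_expR f x a : is_derive x 1 f a ->
  is_derive x 1 (fun t => expR (f t)) (expR (f x) * a).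
Proof. by move=> fa; exact: (@is_derive1_comp _ expR f). Qed.

Lemma is_derive1_lncomp f x a : 0 < f x -> is_derive x 1 f a ->
  is_derive x 1 (fun t => ln (f t)) ((f x)^-1 * a).
Proof.
move=> f0 fa; have := is_derive1_ln f0 => d.
exact: (@is_derive1_comp _ (@ln R) f).
Qed.

Lemma is_derive1_inv f x a : f x != 0 -> is_derive x 1 f a ->
  is_derive x 1 (fun t => (f t)^-1) (- (f x) ^- 2 * a).
Proof. by move=> f0 fa; exact: is_deriveV. Qed.

Lemma is_derive1_sqrtcomp f x a : 0 < f x -> is_derive x 1 f a ->
  is_derive x 1 (fun t => Num.sqrt (f t)) ((2 * Num.sqrt (f x))^-1 * a).
Proof.
move=> f0 fa; have := is_derive1_sqrt f0 => d.
exact: (@is_derive1_comp _ Num.sqrt f).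
Qed.

Lemma MVT_is_derive f (df : R -> R) a b : a < b ->
  (forall t, a <= t <= b -> is_derive t 1 f (df t)) ->
  exists2 t, a < t < b & f b - f a = df t * (b - a).
Proof.
move=> ab fdf; have [||t] := @MVT R f df a b ab.
- by move=> t; rewrite in_itv/= => /andP[h1 h2]; apply: fdf; rewrite !ltW.
- apply: derivable_within_continuous => t; rewrite in_itv/= => h.
  by have [] := fdf t h.
- by rewrite in_itv/= => tab e; exists t.
Qed.

Lemma ln_le_sub1 (z : R) : 0 < z -> ln z <= z - 1.
Proof.
move=> z0; have := @le_ln1Dx _ (z - 1); rewrite [1 + _]addrC subrK; apply; lra.
Qed.

End real_derivatives.

(** * The Gamma function *)

Section gamma_function.
Context {R : realType}.
Implicit Types x y t a b : R.
Local Notation mu := (@lebesgue_measure R).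

(** Half of the exponential is spent on the power: ln z <= z at z = t / (2y), where 2y is the peak
    of t^y exp(-t/2). The other half gives domination by an exponential density and decay at
    infinity. *)
Lemma powR_expRN_le y t : 0 < y -> 0 < t ->
  t `^ y * expR (- t) <= (2 * y) `^ y * expR (- (t / 2)).
Proof.
move=> y0 t0; have y20 : 0 < 2 * y by rewrite mulr_gt0.
rewrite /powR !gt_eqF// -!expRD ler_expR.
have z0 : 0 < t / (2 * y) by rewrite divr_gt0.
have -> : ln t = ln (2 * y) + ln (t / (2 * y)).
  by rewrite -lnM ?posrE// mulrC divfK// gt_eqF.
have : y * ln (t / (2 * y)) <= t / 2.
  apply: (@le_trans _ _ (y * (t / (2 * y)))).
    by rewrite ler_pM2l// ltW// ln_sublinear.
  by rewrite le_eqVlt; apply/orP; left; apply/eqP; field; rewrite gt_eqF.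
by rewrite mulrDr; lra.
Qed.

Lemma measurable_powR_expRN y (D : set R) :
  measurable_fun D (fun t => t `^ y * expR (- t)).
Proof.
apply: measurable_funTS; apply: measurable_funM => //.
exact: measurableT_comp.
Qed.

Lemma integrable_powR_expRN y : 0 < y ->
  mu.-integrable `]0, +oo[ (EFin \o (fun t => t `^ y * expR (- t))).
Proof.
move=> y0.
have h : (0 : R) < 2^-1 by [].
have ie : mu.-integrable `]0, +oo[ (EFin \o exponential_pdf (2^-1 : R)).
  by apply: integrableS (integrable_exponential_pdf h).
have := @integrableZl _ _ _ mu _ _ (2 * (2 * y) `^ y) _ ie.
move=> /(_ (measurable_itv _)); apply: le_integrable => //.
  by apply/measurable_EFinP; exact: measurable_powR_expRN.
move=> t; rewrite /= in_itv/= andbT => t0.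
rewrite lee_fin.
rewrite exponential_pdfE ?(ltW t0)//.
rewrite !ger0_norm ?mulr_ge0 ?powR_ge0 ?expR_ge0//.
rewrite mulrACA divff ?pnatr_eq0// mul1r mulNr [2^-1 * t]mulrC.
exact: powR_expRN_le.
Qed.

Let continuous_powR z t : 0 < t -> {for t, continuous (fun t : R => t `^ z)}.
Proof.
move=> t0; apply: differentiable_continuous; apply/derivable1_diffP.
by apply: derivable_powR; rewrite in_itv/= t0.
Qed.

Let continuous_expRN : continuous (fun t : R => expR (- t)).
Proof.
move=> t; apply: continuous_comp; last exact: continuous_expR.
exact: continuousN.
Qed.

Let continuous_itv_powR_expRN y a b : 0 < a ->
  {within `[a, b], continuous (fun t => t `^ y * expR (- t))}.
Proof.
move=> a0; apply: continuous_in_subspaceT => t /set_mem/=.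
rewrite in_itv/= => /andP[at_ _].
apply: cvgM; last exact: continuous_expRN.
by apply: continuous_powR; exact: lt_le_trans at_.
Qed.

Let integrable_itv_powR_expRN y a b : 0 < a ->
  mu.-integrable `[a, b] (EFin \o (fun t => t `^ y * expR (- t))).
Proof.
move=> a0; apply: continuous_compact_integrable; first exact: segment_compact.
exact: continuous_itv_powR_expRN.
Qed.

Lemma Rintegral_powR_expRN_parts x a b : 0 < a -> a < b ->
  \int[mu]_(t in `[a, b]) (t `^ x * expR (- t)) =
   a `^ x * expR (- a) - b `^ x * expR (- b) +
   x * \int[mu]_(t in `[a, b]) (t `^ (x - 1) * expR (- t)).
Proof.
move=> a0 ab.
have b0 : 0 < b by exact: lt_trans ab.
have inab t : t \in `[a, b]%classic -> 0 < t.
  by move/set_mem; rewrite /= in_itv/= => /andP[at_ _]; exact: lt_le_trans at_.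
have inab' t : t \in `]a, b[ -> 0 < t.
  by rewrite in_itv/= => /andP[at_ _]; exact: lt_trans at_.
rewrite (@Rintegration_by_parts _ (fun t => t `^ x) (fun t => - expR (- t))
  (fun t => x * t `^ (x - 1)) (fun t => expR (- t))) //.
- have -> : \int[mu]_(t in `[a, b]) (x * t `^ (x - 1) * - expR (- t)) =
     - (x * \int[mu]_(t in `[a, b]) (t `^ (x - 1) * expR (- t))).
    rewrite -mulNr -RintegralZl//; last exact: integrable_itv_powR_expRN.
    by apply: eq_Rintegral => t _; rewrite mulrN mulNr mulrA.
  by ring.
- apply: continuous_in_subspaceT => t /inab t0.
  by apply: cvgM; [exact: cvg_cst|exact: continuous_powR].
- split => [t /inab' t0||].
  + by apply: derivable_powR; rewrite in_itv/= t0.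
  + by apply: cvg_at_right_filter; exact: continuous_powR.
  + by apply: cvg_at_left_filter; exact: continuous_powR.
- by move=> t /inab' t0; rewrite powR_derive1// in_itv/= t0.
- by apply: continuous_subspaceT; exact: continuous_expRN.
- split => [t _||].
  + exact: ex_derive.
  + by apply: cvg_at_right_filter; apply: cvgN; exact: continuous_expRN.
  + by apply: cvg_at_left_filter; apply: cvgN; exact: continuous_expRN.
- move=> t _; rewrite derive1E.
  have /is_deriveN : is_derive t 1 (fun t : R => expR (- t)) (expR (- t) * -1).
    by apply: is_derive1_expR; exact: is_deriveN.
  rewrite mulrN mulr1 opprK => d; exact: (@derive_val _ _ _ _ _ _ _ d).
Qed.

(** With [k.+2] the interval is nondegenerate already at k = 0, as integration by parts asks for a <
    b. *)
Let I_ k : set R := `[k.+2%:R^-1, k.+2%:R].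

Let cvg_integral_I y :
  (\int[mu]_(t in I_ k) (t `^ y * expR (- t))%:E)%E @[k --> \oo] -->
  (\int[mu]_(t in `]0%R, +oo[) (t `^ y * expR (- t))%:E)%E.
Proof.
have -> : `]0%R, +oo[%classic = \bigcup_k I_ k.
  apply/seteqP; split => t /=; rewrite in_itv/= ?andbT.
    move=> t0.
    exists (Num.truncn (Num.max t t^-1)) => //.
    have := truncnS_gt (Num.max t t^-1).
    set k := Num.truncn _; rewrite gt_max => /andP[t1 t2].
    rewrite /I_ /= in_itv/=; apply/andP; split.
      rewrite -[leRHS]invrK lef_pV2 ?posrE ?invr_gt0//.
      by rewrite (le_trans (ltW t2))// ler_nat.
    by rewrite (le_trans (ltW t1))// ler_nat.
  move=> [k _]; rewrite /I_ /= in_itv/= => /andP[+ _].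
  by apply: lt_le_trans; rewrite invr_gt0.
apply: ge0_nondecreasing_set_cvg_integral => //.
- apply/nondecreasing_seqP => k; apply/subsetPset => t.
  rewrite /I_ /= !in_itv/= => /andP[h1 h2]; apply/andP; split.
    by rewrite (le_trans _ h1)// lef_pV2 ?posrE// ler_nat.
  by rewrite (le_trans h2)// ler_nat.
- by move=> k; exact: measurable_itv.
- by move=> k; apply: measurableT_comp => //; exact: measurable_powR_expRN.
- by move=> k t _; rewrite lee_fin mulr_ge0 ?powR_ge0 ?expR_ge0.
Qed.

Let bd x (k : nat) : R := k.+2%:R^-1 `^ x * expR (- k.+2%:R^-1) -
    k.+2%:R `^ x * expR (- k.+2%:R).

Let cvg_natS2 : (fun k => k.+2%:R : R) @ \oo --> +oo.
Proof.
have := @cvgr_idn R; rewrite -(cvg_shiftn 2).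
by rewrite (_ : (fun n : nat => _) = fun k => k.+2%:R)//; apply/funext => k; rewrite addn2.
Qed.

Let cvg_bd x : 0 < x -> bd x @ \oo --> 0.
Proof.
move=> x0; rewrite -(subr0 0); apply: cvgB.
- apply: (@squeeze_cvgr _ _ _ _ (cst 0) (fun k => k.+2%:R^-1 `^ x)).
  + apply: nearW => k; rewrite mulr_ge0 ?powR_ge0 ?expR_ge0//=.
    by rewrite ler_piMr ?powR_ge0// expR_le1 oppr_le0.
  + exact: cvg_cst.
  + have h0 : (fun k => k.+2%:R^-1 : R) @ \oo --> 0^'+.
      have c0 : (fun k => k.+2%:R^-1 : R) @ \oo --> 0.
        by apply/gtr0_cvgV0; [exact: nearW|exact: cvg_natS2].
      move=> A hA.
      have hA' : \forall k \near \oo, 0 < k.+2%:R^-1 :> R -> A k.+2%:R^-1.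
        exact: c0 _ hA.
      apply: (@filterS _ \oo _ _ (fun k : nat => A k.+2%:R^-1)) hA' => k; apply.
      by rewrite invr_gt0.
    exact: cvg_comp h0 (powR_cvg0 x0).
- apply: (@squeeze_cvgr _ _ _ _ (cst 0)
    (fun k => (2 * x) `^ x * expR (- (k.+2%:R / 2)))).
  + apply: nearW => k; rewrite mulr_ge0 ?powR_ge0 ?expR_ge0//=.
    exact: powR_expRN_le.
  + exact: cvg_cst.
  + rewrite -(mulr0 ((2 * x) `^ x)); apply: cvgMr.
    have h2 : (fun t : R => t / 2) @ +oo --> +oo by apply: gt0_cvgMly.
    exact: cvg_comp cvg_natS2 (cvg_comp _ _ h2 (@cvgr_expR R)).
Qed.

(** Stated in the extended reals because t^(x-1) exp(-t) is not yet known to be integrable near 0.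
    Monotone convergence over the intervals [I_ k] and integration by parts give finiteness and the
    functional equation at once. *)
Lemma gamma_integral x : 0 < x ->
  (\int[mu]_(t in `]0%R, +oo[) (t `^ (x - 1) * expR (- t))%:E =
   (Gamma (x + 1) / x)%:E)%E.
Proof.
move=> x0.
have fin1 : (\int[mu]_(t in `]0%R, +oo[) (t `^ x * expR (- t))%:E)%E \is a fin_num.
  by apply: integrable_fin_num => //; exact: integrable_powR_expRN.
have A := @cvg_integral_I x.
have B := @cvg_integral_I (x - 1).
have finI k y : (\int[mu]_(t in I_ k) (t `^ y * expR (- t))%:E)%E \is a fin_num.
  apply: integrable_fin_num; first exact: measurable_itv.
  have := @integrable_itv_powR_expRN y k.+2%:R^-1 k.+2%:R.
  by apply; rewrite invr_gt0.
have A' : \int[mu]_(t in I_ k) (t `^ x * expR (- t)) @[k --> \oo] --> Gamma (x + 1).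
  rewrite /Gamma addrK.
  by apply: fine_cvg; rewrite fineK.
have B' : \int[mu]_(t in I_ k) (t `^ (x - 1) * expR (- t)) @[k --> \oo]
    --> (Gamma (x + 1) - 0) / x.
  rewrite [X in X @ _ --> _](_ : _ = fun k =>
    (\int[mu]_(t in I_ k) (t `^ x * expR (- t)) - bd x k) / x).
    by apply: cvgMl; apply: cvgB => //; exact: cvg_bd.
  apply/funext => k; rewrite (@Rintegral_powR_expRN_parts x).
  - by rewrite -/(bd x k); field; rewrite gt_eqF.
  - by rewrite invr_gt0.
  - by rewrite (@lt_trans _ _ 1)// ?invf_lt1// ltr1n.
rewrite subr0 in B'.
apply: cvg_unique B _ => //.
apply: cvg_EFin; last exact: B'.
by apply: nearW => k; exact: finI.
Qed.

Lemma GammaD1 x : 0 < x -> Gamma (x + 1) = x * Gamma x.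
Proof.
move=> x0; rewrite {2}/Gamma /Rintegral gamma_integral//= mulrC divfK//.
by rewrite gt_eqF.
Qed.

Lemma integrable_Gamma x : 0 < x ->
  mu.-integrable `]0, +oo[ (EFin \o (fun t => t `^ (x - 1) * expR (- t))).
Proof.
move=> x0; apply/integrableP; split.
  by apply: measurableT_comp => //; exact: measurable_powR_expRN.
under eq_integral do rewrite /= ger0_norm ?mulr_ge0 ?powR_ge0 ?expR_ge0//.
by rewrite gamma_integral// ltry.
Qed.

Lemma Gamma1 : Gamma 1 = 1 :> R.
Proof.
rewrite /Gamma subrr /Rintegral -[RHS]/(fine 1%E).
rewrite -(@integral_exponential_pdf R 1 ltr01); congr fine.
rewrite integral_itv_obnd_cbnd; last first.
  by apply: measurableT_comp => //; exact: measurable_powR_expRN.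
rewrite integral_mkcond; apply: eq_integral => t _.
rewrite /exponential_pdf !patchE; case: ifP => // _.
by rewrite powRr0 !mul1r mulN1r.
Qed.

Lemma Gamma_natS (n : nat) : Gamma n.+1%:R = n`!%:R :> R.
Proof.
elim: n => [|n IH]; first by rewrite Gamma1.
by rewrite -natr1 GammaD1 ?ltr0n// IH factS natrM.
Qed.

(** Weighted AM-GM for y and 1. With m the weighted mean, ln z <= z - 1 is applied at y/m and 1/m;
    the weighted sum of the right-hand sides is zero. *)
Lemma powR_le_line (y theta : R) : 0 < y -> 0 <= theta <= 1 ->
  y `^ theta <= 1 - theta + theta * y.
Proof.
move=> y0 /andP[t0 t1].
have m0 : 0 < 1 - theta + theta * y.
  have [->|tn0] := eqVneq theta 0; first by rewrite subr0 mul0r addr0.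
  rewrite addrC ltr_pwDl// ?subr_ge0// mulr_gt0// lt_neqAle eq_sym tn0//.
set m := _ + _ in m0 *.
rewrite /powR gt_eqF// -[leRHS](@lnK _ m)// ler_expR.
have h1 := ln_le_sub1 _ (divr_gt0 y0 m0).
have h2 := ln_le_sub1 _ (divr_gt0 ltr01 m0).
rewrite ln_div ?posrE// in h1; rewrite ln_div ?posrE// ln1 sub0r in h2.
have e : theta * (y / m - 1) + (1 - theta) * (1 / m - 1) = 0.
  have -> : theta * (y / m - 1) + (1 - theta) * (1 / m - 1) =
    (1 - theta + theta * y) / m - 1 by ring.
  by rewrite -/m divff ?subrr// gt_eqF.
have : theta * (ln y - ln m) + (1 - theta) * (- ln m) <= 0.
  rewrite -e lerD// ler_wpM2l// subr_ge0//.
rewrite mulrBr mulrBl; lra.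
Qed.

(** Instead of Hoelder's inequality, [powR_le_line] at t/s is integrated against t^(s-1) exp(-t).
    The centre s is the mean of that density, so by Gamma(s+1) = s Gamma(s) the linear bound
    integrates to exactly Gamma(s). *)
Lemma Gamma_wendel (s theta : R) : 0 < s -> 0 <= theta <= 1 ->
  Gamma (s + theta) <= s `^ theta * Gamma s.
Proof.
move=> s0 t01; have /andP[t0 t1] := t01.
have is1 := @integrable_Gamma s s0.
have is2 := @integrable_Gamma (s + 1) (addr_gt0 s0 ltr01).
have J1 : mu.-integrable `]0, +oo[ (EFin \o (fun t =>
    s `^ theta * (1 - theta) * (t `^ (s - 1) * expR (- t)))).
  have := @integrableZl _ _ _ mu _ _ (s `^ theta * (1 - theta)) _ is1.
  by apply; exact: measurable_itv.
have J2 : mu.-integrable `]0, +oo[ (EFin \o (fun t =>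
    s `^ theta * theta / s * (t `^ (s + 1 - 1) * expR (- t)))).
  have := @integrableZl _ _ _ mu _ _ (s `^ theta * theta / s) _ is2.
  by apply; exact: measurable_itv.
have := @integrableD _ _ _ mu _ _ _ _ J1 J2; move=> /(_ (measurable_itv _)) J.
apply: (@le_trans _ _ (\int[mu]_(t in `]0, +oo[) (
    s `^ theta * (1 - theta) * (t `^ (s - 1) * expR (- t)) +
    s `^ theta * theta / s * (t `^ (s + 1 - 1) * expR (- t))))).
  apply: le_Rintegral => //.
    by apply: integrable_Gamma; rewrite ltr_wpDr.
  move=> t; rewrite /= in_itv/= andbT => tt0.
  rewrite addrK [X in _ <= _ + _ * (X * _)](_ : _ = t `^ (s - 1) * t); last first.
    by rewrite mulrC mulr_powRB1// ltW.
  have -> : t `^ (s + theta - 1) = t `^ (s - 1) * (s `^ theta * (t / s) `^ theta).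
    rewrite -powRM ?divr_ge0 ?(ltW s0) ?(ltW tt0)//.
    rewrite [s * (t / s)]mulrC divfK ?gt_eqF//.
    rewrite -powRD; first by congr powR; ring.
    by rewrite (gt_eqF tt0) implybT.
  have := powR_le_line _ _ (divr_gt0 tt0 s0) t01.
  rewrite -(ler_pM2l (_ : 0 < t `^ (s - 1) * expR (- t) * s `^ theta)); last first.
    by rewrite !mulr_gt0 ?powR_gt0 ?expR_gt0.
  by congr (_ <= _); field; rewrite ?gt_eqF.
rewrite (@RintegralD _ _ _ mu _ _ _ _ J1 J2)//=.
rewrite !RintegralZl// -/(Gamma s) -/(Gamma (s + 1)) GammaD1//.
rewrite le_eqVlt; apply/orP; left; apply/eqP; field.
by rewrite gt_eqF.
Qed.

(** Wendel's inequality with theta the distance from x to the next integer bounds a factorial by a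
    multiple of Gamma(x). *)
Lemma Gamma_gt0 x : 0 < x -> 0 < Gamma x.
Proof.
move=> x0.
have x0' := ltW x0.
pose n := Num.truncn x.
have /andP[n1 n2] := truncn_itv x0'.
have t01 : 0 <= n.+1%:R - x <= 1.
  by rewrite subr_ge0 (ltW n2) lerBlDr -natr1 addrC lerD2l.
have := Gamma_wendel _ _ x0 t01; rewrite addrC subrK Gamma_natS => h.
have : 0 < x `^ (n.+1%:R - x) * Gamma x.
  by apply: lt_le_trans h; rewrite ltr0n fact_gt0.
by rewrite pmulr_rgt0// powR_gt0.
Qed.

End gamma_function.

(** * Gamma(n+gamma+1) compared with n! n^gamma *)

Section gamma_ratio.
Context {R : realType}.
Implicit Types gamma : R.

Lemma cvg_shift_ratio (c : R) : (n%:R + c) / n%:R @[n --> \oo] --> (1 : R).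
Proof.
have h : 1 + c * n%:R^-1 @[n --> \oo] --> (1 + c * 0 : R).
  apply: cvgD; first exact: cvg_cst.
  apply: cvgM; first exact: cvg_cst.
  by apply/gtr0_cvgV0; [near=> n; rewrite ltr0n; near: n; exact: nbhs_infty_gt
    | exact: cvgr_idn].
rewrite mulr0 addr0 in h; apply: cvg_trans h; apply: near_eq_cvg.
near=> n; rewrite mulrDl divff// pnatr_eq0 -lt0n.
by near: n; exact: nbhs_infty_gt.
Unshelve. all: by end_near. Qed.

(** In this range gamma + 1 and -gamma both lie in [0, 1]. Wendel from n with theta = gamma + 1
    bounds the ratio by 1; Wendel from n + gamma + 1 with theta = -gamma reaches n + 1 and gives
    ((n+gamma+1)/n)^gamma from below, where gamma is then relaxed to -1. *)
Lemma Gamma_ratio_cvg_le0 gamma : -1 < gamma -> gamma <= 0 ->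
  Gamma (n%:R + gamma + 1) / (n`!%:R * n%:R `^ gamma) @[n --> \oo] --> (1 : R).
Proof.
move=> g1 g0.
have h := cvgV (oner_neq0 R) (cvg_shift_ratio (gamma + 1)).
rewrite invr1 in h.
apply: (@squeeze_cvgr _ _ _ _ (fun n : nat => ((n%:R + (gamma + 1)) / n%:R)^-1)
  (cst 1)); [|exact: h|exact: cvg_cst]; near=> n.
have n0 : 0 < n%:R :> R by rewrite ltr0n; near: n; exact: nbhs_infty_gt.
have s0 : 0 < n%:R + (gamma + 1) :> R by rewrite ltr_wpDr//; lra.
have f0 : 0 < n`!%:R :> R by rewrite ltr0n fact_gt0.
have nf : (n`!%:R = n%:R * Gamma n%:R :> R).
  by rewrite -Gamma_natS -natr1 GammaD1.
have p0 : 0 < n%:R `^ gamma :> R by exact: powR_gt0.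
have e z : 0 < z -> z `^ (gamma + 1) = z * z `^ gamma :> R.
  move=> z0; rewrite powRD; last by rewrite (gt_eqF z0) implybT.
  by rewrite powRr1 ?(ltW z0)// mulrC.
apply/andP; split.
- rewrite ler_pdivlMr ?mulr_gt0//.
  have t01 : 0 <= - gamma <= 1 by apply/andP; split; lra.
  have := Gamma_wendel _ _ s0 t01.
  have -> : n%:R + (gamma + 1) + - gamma = n%:R + 1 :> R by ring.
  rewrite natr1 Gamma_natS powRN mulrC.
  rewrite ler_pdivlMr; last exact: powR_gt0.
  move=> h1.
  rewrite -(addrA n%:R gamma 1); apply: le_trans h1; rewrite mulrCA ler_pM2l//.
  rewrite [leLHS](_ : _ = n%:R * n%:R `^ gamma / (n%:R + (gamma + 1))); last first.
    by rewrite invf_div; ring.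
  rewrite ler_pdivrMr//.
  rewrite -e// [leRHS]mulrC -e//; apply: ge0_ler_powR; rewrite ?nnegrE ?ltW//.
    by lra.
  by rewrite ltrDl; lra.
- rewrite ler_pdivrMr ?mulr_gt0// mul1r -addrA nf mulrAC.
  have t01 : 0 <= gamma + 1 <= 1 by apply/andP; split; lra.
  have := Gamma_wendel _ _ n0 t01.
  by rewrite e// mulrAC.
Unshelve. all: by end_near. Qed.

(** Induction on an integer above gamma: the functional equation moves gamma - 1 to gamma at the
    cost of (n+gamma)/n, which tends to 1. *)
Lemma Gamma_ratio_cvg gamma : -1 < gamma ->
  Gamma (n%:R + gamma + 1) / (n`!%:R * n%:R `^ gamma) @[n --> \oo] --> (1 : R).
Proof.
have [m gm] : exists m : nat, gamma <= m%:R.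
  by exists (Num.truncn gamma).+1; rewrite ltW// truncnS_gt.
elim: m gamma gm => [|m IH] gamma gm g1; first exact: Gamma_ratio_cvg_le0.
have [gm'|gm'] := leP gamma m%:R; first exact: IH.
have g0 : 0 < gamma by rewrite (le_lt_trans _ gm').
have h1 : Gamma (n%:R + (gamma - 1) + 1) / (n`!%:R * n%:R `^ (gamma - 1))
    @[n --> \oo] --> (1 : R).
  by apply: IH; [rewrite lerBlDr natr1|lra].
have h : Gamma (n%:R + (gamma - 1) + 1) / (n`!%:R * n%:R `^ (gamma - 1)) *
    ((n%:R + gamma) / n%:R) @[n --> \oo] --> (1 : R).
  by rewrite -[X in _ --> X]mulr1; apply: cvgM h1 (cvg_shift_ratio gamma).
apply: cvg_trans h; apply: near_eq_cvg; exists 1%N => // n /= n0'.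
have n0 : 0 < n%:R :> R by rewrite ltr0n.
have -> : n%:R + (gamma - 1) + 1 = n%:R + gamma by ring.
rewrite GammaD1 ?addr_gt0// -(@mulr_powRB1 _ n%:R gamma)// ?(ltW n0)//.
have f0 : n`!%:R != 0 :> R by rewrite pnatr_eq0 -lt0n fact_gt0.
have p0 : n%:R `^ (gamma - 1) != 0 :> R by rewrite gt_eqF ?powR_gt0.
by field; rewrite f0 p0 gt_eqF.
Qed.

End gamma_ratio.

(** * Laguerre polynomials on the negative axis *)

Section laguerre_recurrence.
Context {R : realType}.
Implicit Types gamma alpha : R.

Definition laguerre_coef gamma (n k : nat) : R :=
  Gamma (n%:R + gamma + 1) / (Gamma (k%:R + gamma + 1) * (n - k)`!%:R).

Definition laguerre_val gamma alpha n : R := (laguerre gamma n).[- alpha].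

Lemma gbinom_laguerre_coef gamma (n k : nat) : (k <= n)%N ->
  gbinom (n%:R + gamma) (n - k)%:R = laguerre_coef gamma n k.
Proof.
move=> kn; rewrite /gbinom /laguerre_coef (natr1 (n - k)) (Gamma_natS (n - k)).
rewrite (_ : n%:R + gamma - (n - k)%:R + 1 = k%:R + gamma + 1)//.
by rewrite natrB//; ring.
Qed.

Lemma laguerre_valE gamma alpha n :
  laguerre_val gamma alpha n =
  \sum_(0 <= k < n.+1) laguerre_coef gamma n k * (alpha ^+ k / k`!%:R).
Proof.
rewrite /laguerre_val /laguerre horner_sum; apply: eq_big_nat => k /andP[_ kn].
rewrite gbinom_laguerre_coef// hornerZ horner_exp hornerN hornerX opprK.
by rewrite mulrAC mulrA.
Qed.

Lemma natS_gamma_gt0 gamma n : -1 < gamma -> 0 < n%:R + gamma + 1.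
Proof. by move=> g; rewrite -addrA ltr_wpDl//; lra. Qed.

Lemma laguerre_coef_gt0 gamma n k : -1 < gamma -> 0 < laguerre_coef gamma n k.
Proof.
move=> g; rewrite divr_gt0 ?mulr_gt0 ?Gamma_gt0 ?natS_gamma_gt0//.
Qed.

Lemma laguerre_coefnn gamma n : -1 < gamma -> laguerre_coef gamma n n = 1.
Proof.
move=> g; rewrite /laguerre_coef subnn fact0 mulr1 divff// gt_eqF//.
by rewrite Gamma_gt0// natS_gamma_gt0.
Qed.

Lemma GammaS gamma n : -1 < gamma ->
  Gamma (n.+1%:R + gamma + 1) = (n%:R + gamma + 1) * Gamma (n%:R + gamma + 1) :> R.
Proof.
move=> g; rewrite (_ : n.+1%:R + gamma + 1 = n%:R + gamma + 1 + 1).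
  by rewrite (GammaD1 (n%:R + gamma + 1))// natS_gamma_gt0.
by rewrite -natr1; ring.
Qed.

Lemma GammaS1 gamma n : -1 < gamma ->
  Gamma (n%:R + (gamma + 1) + 1) = (n%:R + gamma + 1) * Gamma (n%:R + gamma + 1) :> R.
Proof. by move=> g; rewrite addrA (GammaD1 (n%:R + gamma + 1))// natS_gamma_gt0. Qed.

Lemma laguerre_coef_pascal gamma n k : -1 < gamma -> (k <= n)%N ->
  laguerre_coef (gamma + 1) n.+1 k =
  laguerre_coef (gamma + 1) n k + laguerre_coef gamma n.+1 k.
Proof.
move=> g kn; rewrite /laguerre_coef subSn// factS natrM.
have g1 : -1 < gamma + 1 by lra.
rewrite (GammaS _ n g1) (GammaS1 _ n g) (GammaS1 _ k g) (GammaS _ n g).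
rewrite -!natr1 natrB//.
have h1 := Gamma_gt0 _ (natS_gamma_gt0 _ n g).
have h2 := Gamma_gt0 _ (natS_gamma_gt0 _ k g).
have h3 := natS_gamma_gt0 _ n g.
have h4 := natS_gamma_gt0 _ k g.
have f0 : (n - k)`!%:R != 0 :> R by rewrite pnatr_eq0 -lt0n fact_gt0.
have nk : 0 < n%:R - k%:R + 1 :> R by rewrite ltr_wpDl// subr_ge0 ler_nat.
move: (Gamma _) (Gamma _) h1 h2 => G1 G2 h1 h2.
by field; rewrite f0 !gt_eqF.
Qed.

Lemma laguerre_coef_step gamma n k : -1 < gamma -> (k <= n)%N ->
  n.+1%:R * laguerre_coef gamma n.+1 k =
  (n.+1%:R + gamma) * laguerre_coef gamma n k +
  k%:R * laguerre_coef gamma n.+1 k.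
Proof.
move=> g kn; rewrite /laguerre_coef subSn// factS natrM (GammaS _ n g).
rewrite -!natr1 natrB//.
have h1 := Gamma_gt0 _ (natS_gamma_gt0 _ n g).
have h2 := Gamma_gt0 _ (natS_gamma_gt0 _ k g).
have f0 : (n - k)`!%:R != 0 :> R by rewrite pnatr_eq0 -lt0n fact_gt0.
have nk : 0 < n%:R - k%:R + 1 :> R by rewrite ltr_wpDl// subr_ge0 ler_nat.
move: (Gamma _) (Gamma _) h1 h2 => G1 G2 h1 h2.
by field; rewrite f0 !gt_eqF.
Qed.

Lemma laguerre_coef_shift gamma n k : -1 < gamma ->
  laguerre_coef gamma n.+1 k.+1 = laguerre_coef (gamma + 1) n k.
Proof. move=> g; rewrite /laguerre_coef subSS (GammaS _ n g) (GammaS _ k g).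
by rewrite (GammaS1 _ n g) (GammaS1 _ k g). Qed.

Lemma laguerre_val0 gamma alpha : -1 < gamma -> laguerre_val gamma alpha 0 = 1.
Proof.
by move=> g; rewrite laguerre_valE big_nat1 laguerre_coefnn// fact0 expr0 divr1 mulr1.
Qed.

Lemma laguerre_val_cumul gamma alpha n : -1 < gamma ->
  laguerre_val (gamma + 1) alpha n.+1 =
  laguerre_val (gamma + 1) alpha n + laguerre_val gamma alpha n.+1.
Proof.
move=> g; have g1 : -1 < gamma + 1 by lra.
rewrite !laguerre_valE [LHS]big_nat_recr//= [X in _ = _ + X]big_nat_recr//=.
rewrite (laguerre_coefnn _ _ g) (laguerre_coefnn _ _ g1) addrA -big_split/=; congr (_ + _).
apply: eq_big_nat => k /andP[_ kn].
by rewrite laguerre_coef_pascal// mulrDl.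
Qed.

(** The relation (n+1) L_(n+1) = (n+1+gamma) L_n - z L_n^(gamma+1) at z = -alpha. The factor k of
    [laguerre_coef_step] cancels against k!, and the resulting index shift raises gamma by one. *)
Lemma laguerre_val_step gamma alpha n : -1 < gamma ->
  n.+1%:R * laguerre_val gamma alpha n.+1 =
  (n.+1%:R + gamma) * laguerre_val gamma alpha n +
  alpha * laguerre_val (gamma + 1) alpha n.
Proof.
move=> g.
have -> : alpha * laguerre_val (gamma + 1) alpha n =
    \sum_(0 <= k < n.+2) k%:R * laguerre_coef gamma n.+1 k * (alpha ^+ k / k`!%:R).
  rewrite big_nat_recl//= !mul0r add0r laguerre_valE big_distrr/=.
  apply: eq_big_nat => k _; rewrite laguerre_coef_shift// factS natrM exprS.
  have f0 : k`!%:R != 0 :> R by rewrite pnatr_eq0 -lt0n fact_gt0.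
  have k0 : k.+1%:R != 0 :> R by rewrite pnatr_eq0.
  by move: k.+1%:R k`!%:R (laguerre_coef _ _ _) k0 f0 => x y c k0 f0; field; rewrite f0 k0.
rewrite !laguerre_valE !big_distrr/= [LHS]big_nat_recr//= [X in _ = _ + X]big_nat_recr//=.
rewrite addrA -big_split/=; congr (_ + _); last by rewrite mulrA.
apply: eq_big_nat => k /andP[_ kn].
by rewrite [LHS]mulrA (laguerre_coef_step _ n k g kn) mulrDl !mulrA.
Qed.

Lemma laguerre_val_gt0 gamma alpha n : -1 < gamma -> 0 < alpha ->
  0 < laguerre_val gamma alpha n.
Proof.
move=> g a0; rewrite laguerre_valE big_nat_recr//=; apply: ltr_wpDl.
  apply: sumr_ge0 => k _; rewrite mulr_ge0 ?(ltW (laguerre_coef_gt0 _ _ _ g))//.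
  by rewrite divr_ge0 ?exprn_ge0// ltW.
by rewrite mulr_gt0 ?laguerre_coef_gt0// divr_gt0 ?exprn_gt0// ltr0n fact_gt0.
Qed.

Definition laguerre_norm2 gamma n := gbinom (n%:R + gamma) n%:R : R.

Lemma laguerre_norm2E gamma n : laguerre_norm2 gamma n = laguerre_coef gamma n 0.
Proof. by have := gbinom_laguerre_coef gamma n 0 (leq0n n); rewrite subn0. Qed.

Lemma laguerre_norm2_gt0 gamma n : -1 < gamma -> 0 < laguerre_norm2 gamma n.
Proof. by move=> g; rewrite laguerre_norm2E laguerre_coef_gt0. Qed.

Lemma laguerre_norm2S gamma n : -1 < gamma ->
  laguerre_norm2 gamma n.+1 = (n.+1%:R + gamma) / n.+1%:R * laguerre_norm2 gamma n.
Proof.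
move=> g; rewrite !laguerre_norm2E.
have := laguerre_coef_step _ _ _ g (leq0n n); rewrite mul0r addr0 => h.
by rewrite mulrAC -h mulrC mulKf// pnatr_eq0.
Qed.

Lemma Pn0 gamma alpha n :
  (Pn gamma alpha n).[0] =
  (-1) ^+ n * (laguerre_val gamma alpha n / Num.sqrt (laguerre_norm2 gamma n)).
Proof.
rewrite /Pn hornerZ horner_comp hornerD hornerX hornerN hornerC add0r.
by rewrite -/(laguerre_val _ _ _) /hn -/(laguerre_norm2 _ _) -mulrA [_^-1 * _]mulrC.
Qed.

Lemma Pn0_sqr gamma alpha n : -1 < gamma ->
  (Pn gamma alpha n).[0] ^+ 2 =
  laguerre_val gamma alpha n ^+ 2 / laguerre_norm2 gamma n.
Proof.
move=> g; rewrite Pn0 exprMn sqrr_sign mul1r expr_div_n sqr_sqrtr//.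
by rewrite ltW// laguerre_norm2_gt0.
Qed.

Lemma laguerre_norm2_cvg gamma : -1 < gamma ->
  laguerre_norm2 gamma n / n%:R `^ gamma @[n --> \oo] --> (Gamma (gamma + 1))^-1.
Proof.
move=> g.
rewrite (_ : (fun n : nat => _) = (fun n : nat => (Gamma (gamma + 1))^-1 *
    (Gamma (n%:R + gamma + 1) / (n`!%:R * n%:R `^ gamma)))).
  rewrite -[X in _ --> X]mulr1; apply: cvgM; first exact: cvg_cst.
  exact: Gamma_ratio_cvg.
apply/funext => n; rewrite laguerre_norm2E /laguerre_coef subn0 add0r.
move: (Gamma _) (Gamma _) => G1 G2; rewrite !invfM; ring.
Qed.

End laguerre_recurrence.

(** * The Riccati recursion *)

Section ratio_recurrence.
Context {R : realType}.

Lemma sqrt_nat_ge (X : R) : exists N : nat, forall n, (N <= n)%N -> X <= Num.sqrt n%:R.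
Proof.
exists (Num.truncn (X ^+ 2)).+1 => n nN.
apply: (le_trans (ler_norm X)); rewrite -sqrtr_sqr ler_sqrt ?ler0n//.
by rewrite (le_trans (ltW (truncnS_gt _)))// ler_nat.
Qed.

(** The level max(f N, M/c) is never exceeded: at M/c the loss c u_n f n already balances the source
    M u_n. Loss and source carry the same u_n, so u_n may tend to zero. *)
Lemma contraction_bounded (f u : nat -> R) (c M : R) (N : nat) :
  0 < c ->
  (forall n, (N <= n)%N -> 0 <= u n /\ c * u n <= 1) ->
  (forall n, (N <= n)%N -> f n.+1 <= (1 - c * u n) * f n + M * u n) ->
  exists K, forall n, (N <= n)%N -> f n <= K.
Proof.
move=> c0 hu hf; exists (Num.max (f N) (M / c)) => n /subnKC <-.
elim: (n - N)%N => [|k IH]; first by rewrite addn0 le_max lexx.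
rewrite addnS; have Nk : (N <= N + k)%N by rewrite leq_addr.
apply: (le_trans (hf _ Nk)); have [u0 u1] := hu _ Nk.
set K := Num.max _ _ in IH *.
have MK : M <= c * K by rewrite mulrC -ler_pdivrMr// le_max lexx orbT.
have : (1 - c * u (N + k)%N) * f (N + k)%N <= (1 - c * u (N + k)%N) * K.
  by rewrite ler_wpM2l// subr_ge0.
have : M * u (N + k)%N <= c * K * u (N + k)%N by rewrite ler_wpM2r.
lra.
Qed.

(** All from (x - y)(x + y) = 1. The last identity is the exact form of x - y = 1/(2x) +
    O(x^(-3)). *)
Lemma sqr_succ_gap (x y : R) : 1 <= x -> 0 <= y -> x ^+ 2 = y ^+ 2 + 1 ->
  [/\ 0 <= x - y, (x - y) * x <= 1, x - y <= 1 & 2 * (x * (x - y)) = 1 + (x - y) ^+ 2].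
Proof.
move=> x1 y0 xy.
have xy0 : 0 <= x - y.
  by rewrite subr_ge0 -ler_sqr ?nnegrE ?(le_trans ler01 x1)// xy lerDl.
have e : (x - y) * (x + y) = 1 by rewrite -subr_sqr xy addrC addKr.
have d1 : (x - y) * x <= 1.
  by rewrite -e ler_wpM2l// lerDl.
split=> //; last by rewrite -[X in _ = X + _]e; ring.
by apply: le_trans d1; rewrite ler_peMr.
Qed.

(* With x = sqrt (n+1) and y = sqrt n, [c] is the constant for which y / s + c
   solves the Riccati recursion up to O(1/n). *)
Lemma ratio_residual (s g c : R) : 0 < s ->
  c = (2 * s ^+ 2 - 2 * g - 1) / (4 * s ^+ 2) ->
  exists K : R, 0 <= K /\ forall x y : R, 1 <= x -> 0 <= y -> x ^+ 2 = y ^+ 2 + 1 ->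
    2 * `|g + s ^+ 2 * c| <= x ^+ 2 ->
    `|1 + x ^+ 2 * (y / s + c) / (x ^+ 2 + g + s ^+ 2 * (y / s + c)) - (x / s + c)|
      * x ^+ 2 <= K.
Proof.
move=> s0 cE; set b := g + s ^+ 2 * c.
have sn0 : s != 0 by rewrite gt_eqF.
have gE : g = s ^+ 2 * (1 - 2 * c) - 2^-1.
  by rewrite cE; field.
pose K0 := (2 * s)^-1 + `|b| * `|1 - c| + s * `|1 - c| + 1.
have K00 : 0 <= K0 by rewrite !addr_ge0// ?mulr_ge0// ?invr_ge0 ?mulr_ge0// ltW.
exists (2 * K0); split; first by rewrite mulr_ge0.
move=> x y x1 y0 xy bx.
have [d0 dx d1 xd] := sqr_succ_gap _ _ x1 y0 xy.
have x0 : 0 < x by rewrite (lt_le_trans ltr01).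
have DE : x ^+ 2 + g + s ^+ 2 * (y / s + c) = x ^+ 2 + s * y + b.
  by rewrite /b; field.
have D0 : x ^+ 2 / 2 <= x ^+ 2 + s * y + b.
  have : - `|b| <= b by rewrite lerNl -normrN ler_norm.
  have : 0 <= s * y by rewrite mulr_ge0// ltW.
  lra.
rewrite DE; set D := x ^+ 2 + s * y + b in D0 *.
have x20 : 0 < x ^+ 2 by rewrite exprn_gt0.
have Dp : 0 < D by rewrite (lt_le_trans _ D0)// divr_gt0.
set r := 1 + _ - _.
(* Multiplication by D clears the denominator. The terms of order x^3 and x^2 cancel by the leading
   term y/s, those of order x by the relation [gE] between g and c, and each remaining term is
   bounded. As D >= x^2/2, the final constant is twice [K0]. *)
have rD : r * D = - (x * (x - y) ^+ 2 / (2 * s)) + b * (1 - c)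
    - s * (x - y) * (1 - c) + (x - y) * x.
  (* The subtracted multiple of the identity [xd] vanishes; it turns the goal into a polynomial
     identity in x and y. *)
  transitivity (- (x * (x - y) ^+ 2 / (2 * s)) + b * (1 - c)
    - s * (x - y) * (1 - c) + (x - y) * x -
     x / (2 * s) * (2 * (x * (x - y)) - (1 + (x - y) ^+ 2))); last first.
    by rewrite xd subrr mulr0 subr0.
  have -> : r * D = D + x ^+ 2 * (y / s + c) - (x / s + c) * D.
    by rewrite /r; field; rewrite ?gt_eqF.
  by rewrite /D /b gE; field.
have rDle : `|r * D| <= K0.
  rewrite rD /K0; apply: (le_trans (ler_normD _ _)); apply: lerD; last first.
    by rewrite ger0_norm// mulr_ge0// ltW.
  apply: (le_trans (ler_normB _ _)); apply: lerD; last first.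
    by rewrite normrM ler_wpM2r// normrM (gtr0_norm s0) (ger0_norm d0) ler_piMr// ltW.
  apply: (le_trans (ler_normD _ _)); apply: lerD; last by rewrite normrM.
  rewrite normrN ger0_norm ?mulr_ge0 ?invr_ge0 ?mulr_ge0 ?sqr_ge0//; try exact: ltW.
  rewrite ler_piMl ?invr_ge0 ?mulr_ge0 ?(ltW s0)// expr2 mulrA.
  by rewrite mulr_ile1// ?mulr_ge0// ?(ltW x0)// mulrC.
have : `|r| * (x ^+ 2 / 2) <= `|r| * D by rewrite ler_wpM2l.
rewrite -[in X in _ <= X -> _](gtr0_norm Dp) -normrM; lra.
Qed.

(* The factor x / y turns a bound on the error of T_n into one on its product
   with sqrt n. *)
Lemma ratio_factor (s b : R) : 0 < s -> exists X : R, forall x y : R, X <= x ->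
  0 <= y -> x ^+ 2 = y ^+ 2 + 1 ->
  [/\ 0 < y, 0 < x ^+ 2 + s * y + b & x / y * (x ^+ 2 / (x ^+ 2 + s * y + b)) <= 1 - s / 8 / x].
Proof.
move=> s0; pose B := 4 / s * (`|b| + s ^+ 2 / 4 + s * `|b| / 4).
have B0 : 0 <= B.
  by rewrite mulr_ge0 ?divr_ge0 ?(ltW s0)// !addr_ge0// ?divr_ge0 ?sqr_ge0// mulr_ge0// ltW.
exists (2 + 16 / s + B) => x y xX y0 xy.
have s160 : 0 <= 16 / s by rewrite divr_ge0// ltW.
have x2 : 2 <= x by lra.
have x1 : 1 <= x by lra.
have x0 : 0 < x by lra.
have [d0 dx d1 xd] := sqr_succ_gap _ _ x1 y0 xy.
have yx : y <= x by lra.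
have yx2 : x / 2 <= y.
  rewrite -ler_sqr ?nnegrE// ?divr_ge0// ?(ltW x0)//.
  have : 4 <= x ^+ 2 by rewrite (_ : 4 = 2 ^+ 2) ?ler_sqr ?nnegrE// ?(ltW x0)//; ring.
  by rewrite expr_div_n; lra.
have yp : 0 < y by lra.
have b1 : - `|b| <= b by rewrite lerNl -normrN ler_norm.
have b2 : b <= `|b| by rewrite ler_norm.
have sB : `|b| + s ^+ 2 / 4 + s * `|b| / 4 <= s * x / 4.
  have : B <= x by lra.
  rewrite -(ler_pM2l (_ : 0 < s / 4)) ?divr_gt0// => h.
  rewrite [leRHS](_ : _ = s / 4 * x); last by ring.
  apply: le_trans h; rewrite /B le_eqVlt; apply/orP; left; apply/eqP.
  by field; rewrite gt_eqF.
have sy : s * x / 2 <= s * y by rewrite -mulrA ler_pM2l.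
have D0 : 0 < x ^+ 2 + s * y + b.
  have : 0 < x ^+ 2 by rewrite exprn_gt0.
  have : 0 < s * x by rewrite mulr_gt0.
  have : 0 <= s * `|b| by rewrite mulr_ge0// ltW.
  have : 0 <= s ^+ 2 by rewrite sqr_ge0.
  lra.
split=> //; set D := _ + b in D0 *.
have s40 : 0 < s / 4 by rewrite divr_gt0.
(* To leading order the quotient is 1 - s/x. A quarter of that gain is kept here, and half of this
   quarter later pays for x/y, which exceeds 1 only by O(x^(-2)). *)
have th : x ^+ 2 / D <= 1 - s / 4 / x.
  rewrite ler_pdivrMr// -(ler_pM2r x0).
  rewrite [leRHS](_ : _ = (x - s / 4) * D); last by field; rewrite gt_eqF.
  have h1 : s / 4 * (s * y) <= s / 4 * (s * x) by rewrite ler_pM2l// ler_pM2l.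
  have h2 : s / 4 * b <= s / 4 * `|b| by rewrite ler_pM2l.
  have h3 : s / 4 * `|b| <= s / 4 * `|b| * x by rewrite ler_peMr// mulr_ge0// ltW.
  have h4 : x * (s * x / 2) <= x * (s * y) by rewrite ler_pM2l.
  have h5 : - (x * `|b|) <= x * b by rewrite -mulrN ler_pM2l.
  have h6 : x * (`|b| + s ^+ 2 / 4 + s * `|b| / 4) <= x * (s * x / 4) by rewrite ler_pM2l.
  rewrite /D; lra.
have xy2 : x / y <= 1 + 2 / x ^+ 2.
  have h : x / y <= 1 + 1 / y ^+ 2.
    rewrite ler_pdivrMr// (_ : _ * y = y + y^-1); last by field; rewrite gt_eqF.
    rewrite -ler_sqr ?nnegrE ?(ltW x0)// ?addr_ge0 ?invr_ge0//.
    rewrite xy sqrrD mulfV ?gt_eqF//; have : 0 <= y^-1 ^+ 2 by rewrite sqr_ge0.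
    lra.
  apply: (le_trans h); rewrite lerD2l ler_pdivrMr ?exprn_gt0// mulrAC.
  rewrite ler_pdivlMr ?exprn_gt0// mul1r.
  have : 4 <= x ^+ 2 by rewrite (_ : 4 = 2 ^+ 2) ?ler_sqr ?nnegrE// ?(ltW x0)//; ring.
  lra.
have th0 : 0 <= x ^+ 2 / D by rewrite divr_ge0 ?sqr_ge0// ltW.
have xi : 0 < x^-1 by rewrite invr_gt0.
have s16 : 2 / x ^+ 2 <= s / 8 / x.
  have : 16 / s <= x by lra.
  rewrite ler_pdivrMr// => hx.
  rewrite ler_pdivrMr ?exprn_gt0// (_ : _ * x ^+ 2 = s * x / 8); first lra.
  by field; rewrite gt_eqF.
have sx0 : 0 <= s / 4 / x by rewrite divr_ge0 ?(ltW x0)// ltW.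
have x20 : 0 <= 2 / x ^+ 2 by rewrite divr_ge0 ?sqr_ge0.
apply: (@le_trans _ _ ((1 + 2 / x ^+ 2) * (x ^+ 2 / D))); first by rewrite ler_wpM2r.
apply: (@le_trans _ _ ((1 + 2 / x ^+ 2) * (1 - s / 4 / x))).
  by rewrite ler_wpM2l// addr_ge0.
have : 0 <= 2 / x ^+ 2 * (s / 4 / x) by rewrite mulr_ge0.
lra.
Qed.

End ratio_recurrence.

(** * Convergence of the Riccati recursion *)

Section ratio_asymptotics.
Context {R : realType}.

(** The solution c of g = s^2 (1 - 2c) - 1/2. *)
Definition ratio_shift (s g : R) := (2 * s ^+ 2 - 2 * g - 1) / (4 * s ^+ 2).

Lemma sqrt_natS (n : nat) :
  Num.sqrt n.+1%:R ^+ 2 = Num.sqrt n%:R ^+ 2 + 1 :> R.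
Proof. by rewrite !sqr_sqrtr ?ler0n// natr1. Qed.

Lemma ratio_asymptotics (s g : R) (T : nat -> R) : 0 < s ->
  (forall n, 0 < T n) ->
  (forall n, T n.+1 = 1 + n.+1%:R * T n / (n.+1%:R + g + s ^+ 2 * T n)) ->
  exists K N, forall n, (N <= n)%N ->
    Num.sqrt n%:R * `|T n - (Num.sqrt n%:R / s + ratio_shift s g)| <= K.
Proof.
move=> s0 T0 TS; set c := ratio_shift s g.
pose b := g + s ^+ 2 * c.
have [M [M0 hM]] := ratio_residual s g c s0 erefl.
have [X hX] := ratio_factor s b s0.
have [N1 hN1] := sqrt_nat_ge (`|X| + 1 + 2 * `|b| + `|g| + s).
pose f n := Num.sqrt n%:R * `|T n - (Num.sqrt n%:R / s + c)|.
pose u n := (Num.sqrt n.+1%:R)^-1 : R.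
have [|||K hK] := @contraction_bounded R f u (s / 8) M N1.
- by rewrite divr_gt0.
- move=> n nN; have := hN1 n.+1 (leqW nN); rewrite /u; set x := Num.sqrt _ => xX.
  have : 0 <= `|X| by []. have : 0 <= `|b| by []. have : 0 <= `|g| by [].
  move=> h1 h2 h3; have x0 : 0 < x by lra.
  split; first by rewrite invr_ge0 ltW.
  by rewrite ler_pdivrMr//; lra.
- move=> n nN; have xX := hN1 n.+1 (leqW nN).
  have xy := sqrt_natS n; rewrite /f /u TS.
  have xn : n.+1%:R = Num.sqrt n.+1%:R ^+ 2 :> R by rewrite sqr_sqrtr// ler0n.
  rewrite {2 3}xn; move: xX xy (T0 n) (sqrtr_ge0 (n%:R : R)).
  move: (Num.sqrt n.+1%:R) (Num.sqrt n%:R) (T n) => x y t xX xy t0 y0.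
  have g1 : - `|g| <= g by rewrite lerNl -normrN ler_norm.
  have h1 : X <= `|X| by rewrite ler_norm.
  have : 0 <= `|X| by []. have : 0 <= `|b| by []. have : 0 <= `|g| by [].
  move=> h2 h3 h4; have x1 : 1 <= x by lra.
  have x0 : 0 < x by lra.
  have xx2 : x <= x ^+ 2 by rewrite expr2 ler_peMr// ltW.
  have bx : 2 * `|b| <= x ^+ 2 by lra.
  have gx : 0 < x ^+ 2 + g by lra.
  have Xx : X <= x by lra.
  have [yp Dp th] := hX x y Xx y0 xy.
  have sn0 : s != 0 by rewrite gt_eqF.
  set tau := y / s + c.
  have DE : x ^+ 2 + g + s ^+ 2 * tau = x ^+ 2 + s * y + b.
    by rewrite /b /tau; field.
  have := hM x y x1 y0 xy bx; rewrite -/tau DE; set D := x ^+ 2 + s * y + b in Dp th DE *.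
  set tau' := x / s + c => res.
  set E := x ^+ 2 + g + s ^+ 2 * t.
  have st : 0 < s ^+ 2 * t by rewrite mulr_gt0// exprn_gt0.
  have E0 : 0 < E by rewrite addr_gt0.
  (* The Riccati map is a Moebius map, so its values at t and tau differ by exactly x^2 (x^2 + g) /
     (D E) times t - tau. The factor (x^2 + g)/E is merely bounded by 1; the contraction comes from
     the term s y in D. *)
  have -> : 1 + x ^+ 2 * t / E - tau' =
     x ^+ 2 / D * ((x ^+ 2 + g) / E) * (t - tau) + (1 + x ^+ 2 * tau / D - tau').
    rewrite -DE /E; rewrite -DE in Dp; rewrite /E in E0.
    by field; rewrite !gt_eqF.
  have fE : (x ^+ 2 + g) / E <= 1 by rewrite ler_pdivrMr// mul1r lerDl ltW.
  have fE0 : 0 <= (x ^+ 2 + g) / E by rewrite divr_ge0// ltW.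
  have D20 : 0 <= x ^+ 2 / D by rewrite divr_ge0 ?sqr_ge0// ltW.
  apply: (@le_trans _ _ (x * (x ^+ 2 / D * `|t - tau|) +
    x * `|1 + x ^+ 2 * tau / D - tau'|)).
    rewrite -mulrDr ler_pM2l//; apply: (le_trans (ler_normD _ _)); rewrite lerD2r.
    rewrite normrM ler_wpM2r// ger0_norm ?(mulr_ge0 D20 fE0)//.
    by rewrite -[leRHS]mulr1 ler_wpM2l.
  apply: lerD.
    rewrite (_ : x * _ = x / y * (x ^+ 2 / D) * (y * `|t - tau|)); last first.
      by field; rewrite !gt_eqF.
    by rewrite ler_wpM2r ?mulr_ge0.
  by rewrite ler_pdivlMr// mulrAC -expr2 mulrC.
by exists K, N1.
Qed.

End ratio_asymptotics.

(** * Growth up to a constant factor *)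

Section log_asymptotics.
Context {R : realType}.

Lemma ln1p_order1 (z : R) : - 2^-1 <= z -> `|ln (1 + z) - z| <= 2 * z ^+ 2.
Proof.
move=> z2; have z1 : 0 < 1 + z by lra.
have h1 := ln_le_sub1 _ z1.
have := ln_le_sub1 (1 + z)^-1; rewrite invr_gt0 lnV ?posrE// => /(_ z1) h2.
have h3 : z - 2 * z ^+ 2 <= 1 - (1 + z)^-1.
  rewrite (_ : 1 - (1 + z)^-1 = z - z ^+ 2 / (1 + z)); last by field; rewrite gt_eqF.
  rewrite lerD2l lerN2 ler_pdivrMr// mulrAC ler_peMl ?sqr_ge0//; lra.
by rewrite ler_norml; apply/andP; split; lra.
Qed.

(** The left-hand side has derivative t^2 / (1 + t), at most z^2 on [0, z], so the mean value
    theorem suffices. *)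
Lemma ln1p_order2 (z : R) : 0 <= z -> `|ln (1 + z) - z + z ^+ 2 / 2| <= z ^+ 3.
Proof.
rewrite le_eqVlt => /orP[/eqP <-|z0].
  by rewrite addr0 ln1 subrr add0r !expr0n/= mul0r normr0.
pose f (t : R) : R := ln (1 + t) + (- t + 2^-1 * t ^+ 2).
have df t : 0 <= t <= z -> is_derive t 1 f (t ^+ 2 / (1 + t)).
  move=> /andP[t0 _]; have t1 : 0 < 1 + t by lra.
  have d1 := is_derive1_add _ _ _ _ _ (is_derive1_cst 1 t) (is_derive1_id t).
  have d2 := is_derive1_lncomp _ _ _ t1 d1.
  have d3 := is_derive1_scale 2^-1 _ _ _ (is_derive1_exprn _ 2 _ _ (is_derive1_id t)).
  have d4 := is_derive1_add _ _ _ _ _ (is_derive1_opp _ _ _ (is_derive1_id t)) d3.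
  apply: is_derive_eq (is_derive1_add _ _ _ _ _ d2 d4) _.
  by rewrite /= expr1; field; rewrite gt_eqF.
have [t /andP[t0 tz]] := MVT_is_derive _ _ _ _ z0 df.
rewrite {2}/f addr0 ln1 expr0n/= mulr0 oppr0 !addr0 !subr0 => e.
rewrite (_ : _ + _ = f z); last by rewrite /f; ring.
have t1 : 0 <= 1 + t by lra.
rewrite e (ger0_norm (mulr_ge0 (divr_ge0 (sqr_ge0 t) t1) (ltW z0))).
rewrite [z ^+ 3]exprSr ler_pM2r//.
apply: (@le_trans _ _ (t ^+ 2)).
  by rewrite ler_pdivrMr ?ler_peMr ?sqr_ge0//; lra.
by rewrite ler_sqr ?nnegrE ?(ltW t0) ?(ltW z0)// ltW.
Qed.

(** Here z is the relative increment a_(n+1)/a_n - 1, expanded in 1/x up to a bounded multiple of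
    x^(-3). Both the logarithmic growth and the sum quotient start from it. *)
Lemma step_expansion (s g K : R) : 0 < s -> 0 <= K ->
  exists B X : R, 0 <= B /\ forall x y t : R, X <= x -> 0 <= y ->
  x ^+ 2 = y ^+ 2 + 1 -> y * `|t - (y / s + ratio_shift s g)| <= K ->
  let z := (g + s ^+ 2 * t) / x ^+ 2 in
  0 <= z /\ exists2 kap, `|kap| <= B &
    z = s * x^-1 + ((g + s ^+ 2 * ratio_shift s g) * x^-1 ^+ 2 + kap * x^-1 ^+ 3).
Proof.
move=> s0 K0; set c := ratio_shift s g; pose b := g + s ^+ 2 * c.
pose K2 := s + 2 * K * s ^+ 2; pose B := `|b| + K2.
have sK : 0 <= K * s ^+ 2 by rewrite mulr_ge0 ?sqr_ge0.
have K20 : 0 <= K2 by rewrite /K2; lra.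
have B0 : 0 <= B by rewrite addr_ge0.
exists K2, (2 + B / s); split=> // x y t xX y0 xy htau.
have bs : 0 <= B / s by rewrite divr_ge0// ltW.
have x1 : 1 <= x by lra.
have x0 : 0 < x by lra.
have xn0 : x != 0 by rewrite gt_eqF.
have sn0 : s != 0 by rewrite gt_eqF.
have [d0 dx d1 xd] := sqr_succ_gap _ _ x1 y0 xy.
set d := x - y in d0 dx d1 xd *.
have x24 : 4 <= x ^+ 2.
  by rewrite (_ : 4 = 2 ^+ 2) ?ler_sqr ?nnegrE// ?(ltW x0)//; [lra|ring].
have yx2 : x / 2 <= y.
  rewrite -ler_sqr ?nnegrE// ?divr_ge0// ?(ltW x0)//.
  by rewrite expr_div_n; lra.
pose i := x^-1; rewrite -/i.
have i0 : 0 < i by rewrite invr_gt0.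
have i1 : i <= 1 by rewrite invf_le1.
set eta := t - (y / s + c) in htau.
have eta_le : x * `|eta| <= 2 * K.
  have : x / 2 * `|eta| <= y * `|eta| by rewrite ler_wpM2r.
  lra.
(* The first term replaces y by x in the leading part, the second is the error of T_n; both are
   O(1/x) before the factor x. *)
pose kap := x * (- s * d + s ^+ 2 * eta).
have kapK : `|kap| <= K2.
  rewrite /kap normrM (gtr0_norm x0) /K2.
  apply: (@le_trans _ _ (x * (s * d + s ^+ 2 * `|eta|))).
    rewrite ler_pM2l//; apply: (le_trans (ler_normD _ _)).
    by rewrite (normrM (- s)) (normrM (s ^+ 2)) normrN (gtr0_norm s0) (ger0_norm d0)
      (ger0_norm (sqr_ge0 s)).
  have : s * (d * x) <= s * 1 by rewrite ler_pM2l.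
  have : s ^+ 2 * (x * `|eta|) <= s ^+ 2 * (2 * K) by rewrite ler_pM2l ?exprn_gt0.
  lra.
move=> z.
have zE : z = s * i + (b * i ^+ 2 + kap * i ^+ 3).
  rewrite /z /kap /b /eta /d /i; field.
  by rewrite sn0 xn0.
split; last by exists kap.
have bk : `|b * i ^+ 2 + kap * i ^+ 3| <= B * i ^+ 2.
  apply: (le_trans (ler_normD _ _)); rewrite (normrM b) (normrM kap).
  rewrite !(ger0_norm (exprn_ge0 _ (ltW i0))) /B mulrDl lerD2l.
  apply: (@le_trans _ _ (K2 * i ^+ 3)); first by rewrite ler_wpM2r// exprn_ge0// ltW.
  by rewrite ler_wpM2l// exprSr ler_piMr// exprn_ge0// ltW.
move: bk; rewrite ler_norml => /andP[bkl bku].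
have : B <= s * x by rewrite mulrC -ler_pdivrMr//; lra.
rewrite -(ler_pM2r (_ : 0 < i ^+ 2)) ?exprn_gt0// => h.
have h2 : s * x * i ^+ 2 = s * i by rewrite /i; field.
by rewrite zE; lra.
Qed.

(** The increment of log P_n(0)^2 is compared with that of 4 s sqrt n - (log n)/2. With i = 1/x,
    both have the term 2 s i; at order i^2 the first has 2b - s^2 - g and the second -1/2, the
    increment of -(log n)/2. *)
Lemma log_increment (s g K : R) : 0 < s -> 0 <= K ->
  exists M X : R, forall x y t : R, X <= x -> 0 <= y -> x ^+ 2 = y ^+ 2 + 1 ->
  y * `|t - (y / s + ratio_shift s g)| <= K ->
  `|2 * ln (1 + (g + s ^+ 2 * t) / x ^+ 2) - ln (1 + g / x ^+ 2)
    - (4 * s * (x - y) - (ln (x ^+ 2) - ln (y ^+ 2)) / 2)| <= M / x ^+ 3.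
Proof.
move=> s0 K0; have [K2 [X [K20 hX]]] := step_expansion s g K s0 K0.
set c := ratio_shift s g in hX *; pose b := g + s ^+ 2 * c.
pose B := `|b| + K2.
have B0 : 0 <= B by rewrite addr_ge0.
exists (2 * K2 + B * (2 * s + B) + 2 * (s + B) ^+ 3 + 2 * g ^+ 2 + 2 * s + 1).
exists (2 + 2 * `|g| + `|X|) => x y t xX y0 xy htau.
have Xn : 0 <= `|X| by [].
have XX : X <= `|X| by rewrite ler_norm.
have g0 : 0 <= `|g| by [].
have x1 : 1 <= x by lra.
have x0 : 0 < x by lra.
have Xx : X <= x by lra.
have [z0 [kap kapK zE]] := hX x y t Xx y0 xy htau.
set z := (g + s ^+ 2 * t) / x ^+ 2 in z0 zE *.
have xn0 : x != 0 by rewrite gt_eqF.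
have sn0 : s != 0 by rewrite gt_eqF.
have [d0 dx d1 xd] := sqr_succ_gap _ _ x1 y0 xy.
set d := x - y in d0 dx d1 xd *.
have x24 : 4 <= x ^+ 2.
  by rewrite (_ : 4 = 2 ^+ 2) ?ler_sqr ?nnegrE// ?(ltW x0)//; [lra|ring].
have yp : 0 < y.
  rewrite lt_neqAle y0 andbT; apply/eqP => y00; rewrite -y00 in xy.
  by rewrite xy expr0n/= add0r in x24; lra.
pose i := x^-1; rewrite -/i -/b in zE.
have i0 : 0 < i by rewrite invr_gt0.
have i1 : i <= 1 by rewrite invf_le1.
have xi : x * i = 1 by rewrite mulfV.
have bk : `|b * i ^+ 2 + kap * i ^+ 3| <= B * i ^+ 2.
  apply: (le_trans (ler_normD _ _)); rewrite (normrM b) (normrM kap).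
  rewrite !(ger0_norm (exprn_ge0 _ (ltW i0))) /B mulrDl lerD2l.
  apply: (@le_trans _ _ (K2 * i ^+ 3)); first by rewrite ler_wpM2r// exprn_ge0// ltW.
  by rewrite ler_wpM2l// exprSr ler_piMr// exprn_ge0// ltW.
have i2i : i ^+ 2 <= i by rewrite expr2 ler_piMr// ltW.
have bk1 : B * i ^+ 2 <= B * i by rewrite ler_wpM2l.
move: (bk); rewrite ler_norml => /andP[bkl bku].
have zu : z <= (s + B) * i by rewrite zE; lra.
have z2 : `|z ^+ 2 - s ^+ 2 * i ^+ 2| <= B * (2 * s + B) * i ^+ 3.
  rewrite (_ : _ - _ = (b * i ^+ 2 + kap * i ^+ 3) * (s * i + z)); last by rewrite zE; ring.
  rewrite normrM (_ : B * _ * _ = (B * i ^+ 2) * ((2 * s + B) * i)); last by ring.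
  apply: ler_pM => //; rewrite ger0_norm; first by lra.
  by rewrite addr_ge0// mulr_ge0// ltW.
have e1 := ln1p_order2 _ z0.
have z3 : z ^+ 3 <= (s + B) ^+ 3 * i ^+ 3.
  by rewrite -exprMn ler_pXn2r ?nnegrE// (le_trans z0).
have i4 : i ^+ 4 <= i ^+ 3 by rewrite [leLHS]exprSr ler_piMr// exprn_ge0// ltW.
have gi : - 2^-1 <= g * i ^+ 2.
  have : - `|g| * i <= g * i ^+ 2.
    apply: (@le_trans _ _ (- `|g| * i ^+ 2)).
      by rewrite !mulNr lerN2 ler_wpM2l.
    by rewrite ler_wpM2r ?sqr_ge0// lerNl -normrN ler_norm.
  apply: le_trans; rewrite mulNr lerN2.
  by rewrite ler_pdivrMr//; lra.
have e2 := ln1p_order1 _ gi.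
have e2' : 2 * (g * i ^+ 2) ^+ 2 <= 2 * g ^+ 2 * i ^+ 3.
  by rewrite exprMn -exprM mulrA ler_wpM2l// mulr_ge0// sqr_ge0.
have hi2 : - 2^-1 <= - i ^+ 2.
  have h : i ^+ 2 <= 4^-1 by rewrite /i exprVn lef_pV2 ?posrE ?exprn_gt0.
  by rewrite lerN2 (le_trans h)// lef_pV2 ?posrE// ler_nat.
have e3 := ln1p_order1 _ hi2.
have e3' : 2 * (- i ^+ 2) ^+ 2 <= 2 * i ^+ 3.
  by rewrite sqrrN -exprM ler_pM2l.
have e3E : ln (1 - i ^+ 2) = ln (y ^+ 2) - ln (x ^+ 2).
  have x2p : 0 < x ^+ 2 by rewrite exprn_gt0.
  have y2p : 0 < y ^+ 2 by rewrite exprn_gt0.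
  rewrite -(ln_div (x := y ^+ 2) (y := x ^+ 2)) ?posrE//.
  have yE : y ^+ 2 = x ^+ 2 - 1 by rewrite xy addrK.
  by rewrite yE /i; congr ln; field.
rewrite (_ : g / x ^+ 2 = g * i ^+ 2); last by rewrite /i exprVn.
have d2 : d ^+ 2 * i <= i ^+ 3.
  have : (d * x) ^+ 2 <= 1 by rewrite exprn_ile1 ?mulr_ge0// ltW.
  move=> h; have : (d * x) ^+ 2 * i ^+ 3 <= 1 * i ^+ 3 by rewrite ler_wpM2r// exprn_ge0// ltW.
  by congr (_ <= _); rewrite ?mul1r// /i; field.
have sd : 4 * s * d = 2 * s * i + 2 * s * (d ^+ 2 * i).
  have -> : d = i * (x * d) by rewrite mulrA [i * x]mulrC xi mul1r.
  rewrite [in RHS](_ : i * (x * d) = d); last by rewrite mulrA [i * x]mulrC xi mul1r.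
  have -> : x * d = (1 + d ^+ 2) / 2 by rewrite -xd [RHS]mulrC mulKf// pnatr_eq0.
  by field.
(* The agreement at order i^2; it holds by the value of [ratio_shift] and is what forces the
   coefficient -1/2 of log n. *)
have b2 : 2 * b - s ^+ 2 - g + 2^-1 = 0.
  by rewrite /b /c /ratio_shift; field.
set L1 := ln (1 + z) in e1 *; set L2 := ln (1 + g * i ^+ 2) in e2 *.
have -> : 2 * L1 - L2 - (4 * s * d - (ln (x ^+ 2) - ln (y ^+ 2)) / 2) =
   2 * kap * i ^+ 3 - (z ^+ 2 - s ^+ 2 * i ^+ 2) + 2 * (L1 - z + z ^+ 2 / 2)
   - (L2 - g * i ^+ 2) - 2 * s * (d ^+ 2 * i) - (ln (1 - i ^+ 2) - (- i ^+ 2)) / 2.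
  rewrite e3E sd.
  by rewrite -[RHS]addr0 -(mul0r (i ^+ 2)) -b2 {2}zE; field.
have kk : `|kap * i ^+ 3| <= K2 * i ^+ 3.
  by rewrite (normrM kap) (ger0_norm (exprn_ge0 _ (ltW i0))) ler_wpM2r// exprn_ge0// ltW.
have d2' : s * (d ^+ 2 * i) <= s * i ^+ 3 by rewrite ler_pM2l.
have d2'' : 0 <= s * (d ^+ 2 * i) by rewrite !mulr_ge0 ?sqr_ge0// ltW.
rewrite -exprVn -/i.
clear zE zu bk bk1 bkl bku sd b2 e3E gi hi2 d0 dx d1 xd xy x24 xi i2i.
move: kk z2 e1 e2 e3; rewrite !ler_norml => /andP[? ?] /andP[? ?] /andP[? ?] /andP[? ?] /andP[? ?].
apply/andP; split; lra.
Qed.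

(** The increments are dominated by those of -2M / sqrt n, so D n - 2M / sqrt n increases and D n +
    2M / sqrt n decreases from N + 1 on. The supremum of the first lies between the two, which gives
    the limit together with its rate. *)
Lemma summable_increments (D : nat -> R) (M : R) (N : nat) : 0 <= M ->
  (forall n, (N <= n)%N -> `|D n.+1 - D n| <= M / Num.sqrt n.+1%:R ^+ 3) ->
  exists l K N', forall n, (N' <= n)%N -> Num.sqrt n%:R * `|D n - l| <= K.
Proof.
move=> M0 hD; pose N1 := N.+1.
have gap n : (N1 <= n)%N -> M / Num.sqrt n.+1%:R ^+ 3 <=
    2 * M / Num.sqrt n%:R - 2 * M / Num.sqrt n.+1%:R.
  move=> nN; have xy := sqrt_natS n (R := R).
  have y0 : 0 < Num.sqrt n%:R :> R by rewrite sqrtr_gt0 ltr0n (leq_trans _ nN).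
  have x1 : 1 <= Num.sqrt n.+1%:R :> R by rewrite -{1}sqrtr1 ler_sqrt ?ler0n// ler1n.
  move: (Num.sqrt n.+1%:R) (Num.sqrt n%:R) xy y0 x1 => x y xy y0 x1.
  have x0 : 0 < x by lra.
  have [d0 dx d1 xd] := sqr_succ_gap _ _ x1 (ltW y0) xy.
  rewrite (_ : _ - _ = M * (2 * (x * (x - y))) / (x ^+ 2 * y)); last first.
    by field; rewrite !gt_eqF.
  rewrite xd ler_pdivlMr ?mulr_gt0 ?exprn_gt0// mulrAC ler_pdivrMr ?exprn_gt0//.
  rewrite -(mulrA M) ler_wpM2l//.
  apply: (@le_trans _ _ (x ^+ 3)).
    by rewrite [leRHS]exprSr ler_wpM2l ?sqr_ge0//; lra.
  by rewrite ler_peMl ?exprn_ge0 ?(ltW x0)// lerDl sqr_ge0.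
pose v n := D n - 2 * M / Num.sqrt n%:R.
pose u n := D n + 2 * M / Num.sqrt n%:R.
have vS n : (N1 <= n)%N -> v n <= v n.+1.
  move=> nN; have := hD n (ltnW nN); rewrite ler_norml => /andP[h _].
  have := gap n nN; rewrite /v; lra.
have uS n : (N1 <= n)%N -> u n.+1 <= u n.
  move=> nN; have := hD n (ltnW nN); rewrite ler_norml => /andP[_ h].
  have := gap n nN; rewrite /u; lra.
have vM k n : (N1 <= n)%N -> v n <= v (n + k)%N.
  move=> nN; elim: k => [|k IH]; first by rewrite addn0.
  by rewrite addnS (le_trans IH)// vS// (leq_trans nN)// leq_addr.
have uM k n : (N1 <= n)%N -> u (n + k)%N <= u n.
  move=> nN; elim: k => [|k IH]; first by rewrite addn0.
  by rewrite addnS (le_trans _ IH)// uS// (leq_trans nN)// leq_addr.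
have vu n : v n <= u n.
  have : 0 <= 2 * M / Num.sqrt n%:R by rewrite divr_ge0 ?mulr_ge0 ?sqrtr_ge0.
  by rewrite /v /u; lra.
have vmun m n : (N1 <= m)%N -> (N1 <= n)%N -> v m <= u n.
  move=> mN nN; apply: (le_trans (vM n m mN)).
  by rewrite (le_trans (vu _))// addnC uM.
pose S : set R := [set v n | n in [set n | (N1 <= n)%N]].
have Sub n : (N1 <= n)%N -> ubound S (u n) by move=> nN _ [m mN <-]; exact: vmun.
have S0 : S !=set0 by exists (v N1), N1 => //=.
have hl n : (N1 <= n)%N -> v n <= sup S <= u n.
  move=> nN; apply/andP; split; last by apply: ge_sup => //; exact: Sub.
  by apply: ub_le_sup; [exists (u n); exact: Sub|exists n].
exists (sup S), (2 * M), N1 => n nN.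
have y0 : 0 < Num.sqrt n%:R :> R by rewrite sqrtr_gt0 ltr0n (leq_trans _ nN).
rewrite mulrC -ler_pdivlMr//; have := hl n nN; rewrite /v /u => /andP[h1 h2].
by rewrite ler_norml; apply/andP; split; lra.
Qed.

Lemma log_asymptotics (s g : R) (T l : nat -> R) : 0 < s ->
  (forall n, 0 < T n) ->
  (forall n, T n.+1 = 1 + n.+1%:R * T n / (n.+1%:R + g + s ^+ 2 * T n)) ->
  (forall n, l n.+1 = l n + 2 * ln (1 + (g + s ^+ 2 * T n) / n.+1%:R)
     - ln (1 + g / n.+1%:R)) ->
  exists D K N, forall n, (N <= n)%N ->
    Num.sqrt n%:R * `|l n - (4 * s * Num.sqrt n%:R - ln n%:R / 2) - D| <= K.
Proof.
move=> s0 T0 TS lS.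
have [K [N1 hK]] := ratio_asymptotics s g T s0 T0 TS.
have [M [X hM]] := log_increment s g (`|K|) s0 (normr_ge0 _).
have [N2 hX] := sqrt_nat_ge X.
pose D n := l n - (4 * s * Num.sqrt n%:R - ln n%:R / 2).
have [] := summable_increments D `|M| (N1 + N2 + 1) (normr_ge0 _); last first.
  by move=> l0 [K' [N']] h; exists l0, K', N'.
move=> n nN.
have n0 : (0 < n)%N by apply: leq_trans nN; rewrite addn1.
have nN1 : (N1 <= n)%N by apply: leq_trans nN; rewrite -addnA leq_addr.
have nN2 : (N2 <= n)%N by apply: leq_trans nN; rewrite addnAC leq_addl.
have := hM (Num.sqrt n.+1%:R) (Num.sqrt n%:R) (T n) (hX _ (leqW nN2))
  (sqrtr_ge0 _) (sqrt_natS n) (le_trans (hK n nN1) (ler_norm _)).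
rewrite !sqr_sqrtr ?ler0n// => h.
apply: (@le_trans _ _ (M / Num.sqrt n.+1%:R ^+ 3)); last first.
  by rewrite ler_wpM2r ?ler_norm// invr_ge0 exprn_ge0 ?sqrtr_ge0.
apply: le_trans h; rewrite le_eqVlt; apply/orP; left; apply/eqP; congr `|_|.
by rewrite /D lS; ring.
Qed.

End log_asymptotics.

(** * Partial sums relative to the next term *)

Section sum_asymptotics.
Context {R : realType}.

(** The quotient is P_n(0)^2 / P_(n+1)^2(0), the multiplier in the recursion of the sum quotient.
    Clearing the denominator leaves z - s/x as the only term of first order, and that difference is
    already O(x^(-2)). *)
Lemma decay_expansion (s g K : R) : 0 < s -> 0 <= K ->
  exists M X : R, 0 <= M /\ forall x y t : R, X <= x -> 0 <= y ->
  x ^+ 2 = y ^+ 2 + 1 -> y * `|t - (y / s + ratio_shift s g)| <= K ->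
  `|(1 + g / x ^+ 2) / (1 + (g + s ^+ 2 * t) / x ^+ 2) ^+ 2 - (1 - 2 * s / x)|
     <= M / x ^+ 2.
Proof.
move=> s0 K0; have [K2 [X [K20 hX]]] := step_expansion s g K s0 K0.
set c := ratio_shift s g in hX *; pose b := g + s ^+ 2 * c.
pose B := `|b| + K2.
have B0 : 0 <= B by rewrite addr_ge0.
pose C := s + B.
have C0 : 0 <= C by rewrite addr_ge0// ltW.
have sC : 0 <= s * C by rewrite mulr_ge0// ltW.
have sC2 : 0 <= s * C ^+ 2 by rewrite mulr_ge0 ?sqr_ge0// ltW.
have C20 : 0 <= C ^+ 2 by rewrite sqr_ge0.
exists (`|g| + 2 * B + C ^+ 2 + 4 * (s * C) + 2 * (s * C ^+ 2)), (1 + `|X|); split.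
  by have : 0 <= `|g| by []; lra.
move=> x y t xX y0 xy htau.
have Xn : 0 <= `|X| by [].
have XX : X <= `|X| by rewrite ler_norm.
have x1 : 1 <= x by lra.
have x0 : 0 < x by lra.
have Xx : X <= x by lra.
have [z0 [kap kapK zE]] := hX x y t Xx y0 xy htau.
set z := (g + s ^+ 2 * t) / x ^+ 2 in z0 zE *.
clearbody z; pose i := x^-1; rewrite -/i -/b in zE.
have i0 : 0 < i by rewrite invr_gt0.
have i1 : i <= 1 by rewrite invf_le1.
have bk : `|b * i ^+ 2 + kap * i ^+ 3| <= B * i ^+ 2.
  apply: (le_trans (ler_normD _ _)); rewrite (normrM b) (normrM kap).
  rewrite !(ger0_norm (exprn_ge0 _ (ltW i0))) /B mulrDl lerD2l.
  apply: (@le_trans _ _ (K2 * i ^+ 3)); first by rewrite ler_wpM2r// exprn_ge0// ltW.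
  by rewrite ler_wpM2l// exprSr ler_piMr// exprn_ge0// ltW.
have i2i : i ^+ 2 <= i by rewrite expr2 ler_piMr// ltW.
have bk1 : B * i ^+ 2 <= B * i by rewrite ler_wpM2l.
have zs : `|z - s * i| <= B * i ^+ 2 by rewrite zE addrAC subrr add0r.
have zu : z <= C * i.
  by move: zs; rewrite ler_norml /C => /andP[_]; lra.
have z2 : z ^+ 2 <= C ^+ 2 * i ^+ 2.
  by rewrite -exprMn ler_sqr ?nnegrE// (le_trans z0).
have siz : s * (i * z) <= s * C * i ^+ 2.
  by rewrite -(mulrA s) ler_pM2l// (_ : C * i ^+ 2 = i * (C * i)) ?ler_pM2l//; ring.
have siz2 : s * (i * z ^+ 2) <= s * C ^+ 2 * i ^+ 2.
  rewrite -(mulrA s) ler_pM2l//; apply: le_trans z2.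
  by rewrite ler_piMl ?sqr_ge0.
have siz0 : 0 <= s * (i * z) by rewrite !mulr_ge0// ltW.
have siz20 : 0 <= s * (i * z ^+ 2) by rewrite !mulr_ge0 ?sqr_ge0// ltW.
have z1 : 0 < 1 + z by lra.
rewrite (_ : 2 * s / x = 2 * s * i)// (_ : g / x ^+ 2 = g * i ^+ 2); last by rewrite /i exprVn.
rewrite (_ : _ / x ^+ 2 = (`|g| + 2 * B + C ^+ 2 + 4 * (s * C) + 2 * (s * C ^+ 2)) * i ^+ 2);
  last by rewrite /i exprVn.
have -> : (1 + g * i ^+ 2) / (1 + z) ^+ 2 - (1 - 2 * s * i) =
  (g * i ^+ 2 - 2 * (z - s * i) - z ^+ 2 + 4 * (s * (i * z)) + 2 * (s * (i * z ^+ 2)))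
   / (1 + z) ^+ 2 by field; rewrite gt_eqF.
rewrite normrM [X in _ * X]ger0_norm ?invr_ge0 ?sqr_ge0//.
apply: (@le_trans _ _ `|g * i ^+ 2 - 2 * (z - s * i) - z ^+ 2 + 4 * (s * (i * z)) +
  2 * (s * (i * z ^+ 2))|).
  by rewrite ler_piMr// invf_le1 ?exprn_gt0// exprn_ege1// lerDl.
have gi : `|g * i ^+ 2| <= `|g| * i ^+ 2.
  by rewrite normrM (ger0_norm (sqr_ge0 i)).
have z20 : 0 <= z ^+ 2 by rewrite sqr_ge0.
move: gi zs; rewrite !ler_norml => /andP[? ?] /andP[? ?].
by apply/andP; split; lra.
Qed.

Lemma sum_ratio_asymptotics (s g : R) (T V : nat -> R) : 0 < s -> -1 < g ->
  (forall n, 0 < T n) ->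
  (forall n, T n.+1 = 1 + n.+1%:R * T n / (n.+1%:R + g + s ^+ 2 * T n)) ->
  (forall n, V n.+1 = (V n + 1) * ((1 + g / n.+1%:R) /
     (1 + (g + s ^+ 2 * T n) / n.+1%:R) ^+ 2)) ->
  exists K N, forall n, (N <= n)%N -> `|V n - Num.sqrt n%:R / (2 * s)| <= K.
Proof.
move=> s0 g1 T0 TS VS.
have [K [N1 hK]] := ratio_asymptotics s g T s0 T0 TS.
have [M [X [M0 hM]]] := decay_expansion s g (`|K|) s0 (normr_ge0 _).
have [N2 hX] := sqrt_nat_ge (`|X| + 1 + M / s + s).
pose f n := `|V n - Num.sqrt n%:R / (2 * s)|.
pose u n := (Num.sqrt n.+1%:R)^-1 : R.
have Ms : 0 <= M / s by rewrite divr_ge0// ltW.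
have Xn : 0 <= `|X| by [].
have XX : X <= `|X| by rewrite ler_norm.
pose M' := 1 + 2 * s + (2 * s)^-1 + M * (1 + (2 * s)^-1).
have [||C hC] := @contraction_bounded R f u s M' (N1 + N2) s0.
- move=> n nN; have := hX n.+1 (leqW (leq_trans (leq_addl _ _) nN)).
  rewrite /u; set x := Num.sqrt _ => xX; have x0 : 0 < x by lra.
  split; first by rewrite invr_ge0 ltW.
  by rewrite ler_pdivrMr//; lra.
- move=> n nN; have nN1 := leq_trans (leq_addr _ _) nN.
  have xX := hX n.+1 (leqW (leq_trans (leq_addl _ _) nN)).
  have Xx : X <= Num.sqrt n.+1%:R by lra.
  have qE := hM (Num.sqrt n.+1%:R) (Num.sqrt n%:R) (T n) Xx
    (sqrtr_ge0 _) (sqrt_natS n) (le_trans (hK n nN1) (ler_norm _)).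
  rewrite /f /u VS.
  have N0 : 0 < n.+1%:R :> R by rewrite ltr0n.
  set q := (1 + g / n.+1%:R) / _.
  have qq : (1 + g / Num.sqrt n.+1%:R ^+ 2) /
      (1 + (g + s ^+ 2 * T n) / Num.sqrt n.+1%:R ^+ 2) ^+ 2 = q.
    by rewrite /q sqr_sqrtr ?ler0n.
  rewrite qq in qE.
  have q0 : 0 <= q.
    rewrite /q divr_ge0 ?sqr_ge0//.
    rewrite (_ : 1 + g / n.+1%:R = (n.+1%:R + g) / n.+1%:R); last first.
      by rewrite mulrDl divff// gt_eqF.
    by rewrite divr_ge0 ?ler0n// -natr1; have : 0 <= n%:R :> R by []; lra.
  clear qq; clearbody q.
  move: xX (sqrt_natS n (R := R)) (sqrtr_ge0 (n%:R : R)) qE.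
  move: (Num.sqrt n.+1%:R) (Num.sqrt n%:R) (V n) => x y v xX xy y0 qE.
  set rho := q - _ in qE.
  have x1 : 1 <= x by lra.
  have x0 : 0 < x by lra.
  have [d0 dx d1 xd] := sqr_succ_gap _ _ x1 y0 xy.
  pose i := x^-1; rewrite -/i.
  have i0 : 0 < i by rewrite invr_gt0.
  have i1 : i <= 1 by rewrite invf_le1.
  have xi : x * i = 1 by rewrite mulfV// gt_eqF.
  have sn0 : s != 0 by rewrite gt_eqF.
  pose h := (2 * s)^-1.
  have h0 : 0 < h by rewrite invr_gt0 mulr_gt0.
  (* The next bounds sacrifice half of the rate: q is 1 - 2 s i up to [rho], and [rho] is absorbed
     by s i once x is large. *)
  have sh : s * h = 2^-1 by rewrite /h; field.
  have dxi : x - y <= i.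
    by rewrite -[leLHS]mulr1 -xi mulrA ler_piMl// ltW.
  have rhoM : `|rho| <= M * i ^+ 2 by rewrite /i exprVn.
  have Msi : M * i ^+ 2 <= s * i.
    have : M <= s * x by rewrite mulrC -ler_pdivrMr//; lra.
    rewrite -(ler_pM2r (_ : 0 < i ^+ 2)) ?exprn_gt0// => hm.
    by rewrite (le_trans hm)// expr2 -mulrA (mulrA x) xi mul1r.
  have qle : q <= 1 - s * i.
    have e : q = 1 - 2 * s * i + rho by rewrite /rho -/i; ring.
    by move: rhoM; rewrite ler_norml e => /andP[_]; lra.
  (* The added 1 meets -2 s i * y h = -y/x, which leaves (x - y) i. Hence the source has order i,
     like the contraction, and the deviation stays bounded. *)
  have -> : (v + 1) * q - x / (2 * s) = q * (v - y / (2 * s)) +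
      (((x - y) * i - 2 * s * i - (x - y) * h) + rho * (1 + y * h)).
    have e : q = 1 - 2 * s * i + rho by rewrite /rho -/i; ring.
    rewrite e /h /i; field; rewrite sn0 gt_eqF//.
  apply: (le_trans (ler_normD _ _)); apply: lerD.
    by rewrite normrM (ger0_norm q0) ler_wpM2r.
  apply: (le_trans (ler_normD _ _)); rewrite /M' [leRHS]mulrDl; apply: lerD.
    have h1 : (x - y) * i <= i by rewrite ler_piMl// ?(ltW i0)//; lra.
    have h2 : (x - y) * h <= i * h by rewrite ler_pM2r.
    have h3 : 0 <= (x - y) * h by rewrite mulr_ge0// ltW.
    have h4 : 0 <= (x - y) * i by rewrite mulr_ge0// ltW.
    have h5 : 0 <= s * i by rewrite mulr_ge0// ltW.
    have h6 : 0 <= i * h by rewrite mulr_ge0// ltW.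
    by rewrite -/h ler_norml; apply/andP; clear -h1 h2 h3 h4 h5 h6; split; lra.
  have yh : 0 <= 1 + y * h by rewrite addr_ge0// mulr_ge0// ltW.
  rewrite normrM (ger0_norm yh) -/h.
  apply: (@le_trans _ _ (M * i ^+ 2 * (1 + y * h))); first by rewrite ler_wpM2r.
  rewrite expr2 [leLHS](_ : _ = M * i * (i * (1 + y * h))); last by ring.
  rewrite [leRHS](_ : _ = M * i * (1 + h)); last by ring.
  rewrite ler_wpM2l ?mulr_ge0 ?(ltW i0)// mulrDr mulr1 lerD//.
  rewrite mulrA ler_piMl ?(ltW h0)// -xi mulrC ler_wpM2r ?(ltW i0)//; lra.
by exists C, (N1 + N2)%N.
Qed.

End sum_asymptotics.

(** * Generating function and Laplace's method *)

Section gauss_primitive.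
Context {R : realType}.
Local Notation mu := (@lebesgue_measure R).
Import gauss_integral_proof.

(** Sums are compared with increments of F by the mean value theorem, so a primitive with known
    total increment replaces integrals and changes of variables. *)
Lemma gauss_primitive : exists F : R -> R,
  (forall x : R, is_derive x 1 F (gauss_fun x)) /\
  (F y - F (- y) @[y --> +oo] --> Num.sqrt pi).
Proof.
pose F (x : R) := \int[mu]_(t in `]-oo, x]) gauss_fun t.
have iT := @integrableT_gauss R.
have iS (D : set R) : measurable D -> mu.-integrable D (EFin \o @gauss_fun R).
  by move=> mD; apply: integrableS iT.
have dF (x : R) : is_derive x 1 F (gauss_fun x).
  have [||||dx e] := @continuous_FTC1 R gauss_fun -oo%O x (x + 1).
  - by rewrite ltrDl.
  - by apply: iS; exact: measurable_itv.
  - by rewrite ltNyr.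
  - exact: continuous_gauss_fun.
  by rewrite -e derive1E; exact/derivableP.
exists F; split => //.
(* The sum has derivative zero because the Gaussian is even. This reduces the limit to the half-line
   integral, whose square is known to tend to pi/4. *)
have sym (y : R) : 0 < y -> F y + F (- y) = 2 * F 0.
  move=> y0.
  have dFN (t : R) : is_derive t 1 (fun t => F t + F (- t)) 0.
    have d := dF (- t).
    have dN := is_derive1_opp _ _ _ (is_derive1_id t).
    have dc := @is_derive1_comp _ F (fun t => - t) t _ _ d dN.
    apply: is_derive_eq (is_derive1_add _ _ _ _ _ (dF t) dc) _.
    by rewrite /gauss_fun sqrrN mulrN1 subrr.
  have [t _] := MVT_is_derive _ (fun=> 0) _ _ y0 (fun t _ => dFN t).
  by rewrite mul0r oppr0 => /eqP; rewrite subr_eq0 => /eqP ->; ring.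
have FI (y : R) : 0 < y -> F y - F 0 = integral0_gauss y.
  move=> y0; rewrite /F Rintegral_itvB//; last 2 first.
    by apply: iS; exact: measurable_itv.
    by rewrite bnd_simp ltW.
  rewrite Rintegral_itv_obnd_cbnd//.
  by apply: iS; exact: measurable_itv.
have c : (2 * integral0_gauss y : R) @[y --> +oo] --> Num.sqrt pi.
  have -> : Num.sqrt pi = 2 * Num.sqrt (pi / 4) :> R.
    rewrite sqrtrM ?pi_ge0// sqrtrV// (_ : 4 = 2 ^+ 2) ?sqrtr_sqr; last by ring.
    by rewrite ger0_norm//; field.
  apply: cvgMr.
  have : Num.sqrt (@integral0_gauss R x ^+ 2) @[x --> +oo] --> Num.sqrt (pi / 4).
    by apply: continuous_cvg; [exact: sqrt_continuous|exact: cvg_integral0_gauss_sqr].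
  rewrite (_ : (fun _ => Num.sqrt _) = integral0_gauss)//.
  by apply/funext => r; rewrite sqrtr_sqr ger0_norm// integral0_gauss_ge0.
apply: cvg_trans c; apply: near_eq_cvg; near=> y.
have y0 : 0 < y by near: y; exact: nbhs_pinfty_gt.
by rewrite -FI//; have := sym y y0; lra.
Unshelve. all: by end_near. Qed.

End gauss_primitive.

(** * The generating function from its differential equation *)

Section generating_function.
Context {R : realType}.

(** With t = exp(-eta), y = sqrt (n+1) and y^2 <= exp(2y), the exponent is at most B y - eta y^2.
    Half of eta y^2 absorbs B y by completing the square, and the other half is geometric decay. *)
Lemma subexp_geometric (A t : R) : 0 < t < 1 ->
  n.+1%:R * expR (A * Num.sqrt n.+1%:R) * t ^+ n @[n --> \oo] --> (0 : R).
Proof.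
move=> /andP[t0 t1].
pose eta := - ln t.
have eta0 : 0 < eta by rewrite oppr_gt0 ln_lt0// t0.
have tE : t = expR (- eta) by rewrite opprK lnK ?posrE.
pose r := expR (- (eta / 2)).
have r0 : 0 < r by exact: expR_gt0.
have r1 : r < 1 by rewrite expR_lt1 oppr_lt0 divr_gt0.
pose B := `|A| + 2.
pose C := expR (B ^+ 2 / (2 * eta)) / t.
have h : C * r * r ^+ n @[n --> \oo] --> (C * r * 0 : R).
  by apply: cvgMr; apply: cvg_expr; rewrite gtr0_norm.
rewrite mulr0 in h.
apply: (@squeeze_cvgr _ _ _ _ (cst 0) (fun n : nat => C * r * r ^+ n)) => //; last exact: cvg_cst.
apply: nearW => n; apply/andP; split.
  by rewrite !mulr_ge0 ?expR_ge0 ?exprn_ge0// ltW.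
rewrite -(ler_pM2r t0).
have -> : n.+1%:R * expR (A * Num.sqrt n.+1%:R) * t ^+ n * t =
    n.+1%:R * expR (A * Num.sqrt n.+1%:R) * t ^+ n.+1 by rewrite exprSr mulrA.
have -> : C * r * r ^+ n * t = expR (B ^+ 2 / (2 * eta)) * r ^+ n.+1.
  by rewrite /C [r ^+ n.+1]exprS; field; rewrite gt_eqF.
have N0 : 0 <= n.+1%:R :> R by [].
have nE : n.+1%:R = Num.sqrt n.+1%:R ^+ 2 :> R by rewrite sqr_sqrtr.
rewrite tE /r -!expRM_natl {1}nE.
have y0 := sqrtr_ge0 (n.+1%:R : R).
rewrite [in X in _ * X <= _]nE [in X in _ <= X]nE.
move: (Num.sqrt _) y0 => y y0.
have y2 : y ^+ 2 <= expR (2 * y).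
  rewrite expRM_natl ler_sqr ?nnegrE ?expR_ge0//.
  by apply: le_trans (expR_ge1Dx y); rewrite lerDr.
have Ay : expR (A * y) <= expR (`|A| * y).
  by rewrite ler_expR ler_wpM2r// ler_norm.
apply: (@le_trans _ _ (expR (2 * y) * expR (`|A| * y) * expR (y ^+ 2 * - eta))).
  by rewrite ler_wpM2r ?expR_ge0// ler_pM ?sqr_ge0 ?expR_ge0.
rewrite -!expRD ler_expR -subr_ge0.
rewrite [leRHS](_ : _ = (B - eta * y) ^+ 2 / (2 * eta)); last first.
  by rewrite /B; field; rewrite gt_eqF.
by rewrite divr_ge0 ?sqr_ge0// mulr_ge0// ltW.
Qed.

Let psum (a : nat -> R) n t := \sum_(0 <= k < n.+1) a k * t ^+ k.
Let dpsum (a : nat -> R) n t := \sum_(0 <= k < n.+1) a k * (k%:R * t ^+ k.-1).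

Let is_derive_psum a n (t : R) : is_derive t 1 (psum a n) (dpsum a n t).
Proof.
have dX k : is_derive t 1 (fun t : R => t ^+ k) (k%:R * t ^+ k.-1).
  by apply: is_derive_eq (is_derive1_exprn _ k _ _ (is_derive1_id t)) _; rewrite mulr1.
elim: n => [|n IH].
  rewrite /psum /dpsum big_nat1.
  rewrite (_ : (fun t => _) = fun t : R => a 0%N * t ^+ 0); last first.
    by apply/funext => u; rewrite big_nat1.
  exact: is_derive1_scale.
rewrite /dpsum big_nat_recr//=.
rewrite (_ : psum a n.+1 = fun t => psum a n t + a n.+1 * t ^+ n.+1); last first.
  by apply/funext => u; rewrite /psum [LHS]big_nat_recr.
apply: is_derive1_add => //; apply: is_derive1_scale.
Qed.

(* The generating function F solves (1-t)^2 F' = ((g+1)(1-t) + al) F; a partial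
   sum fails to do so by two boundary terms only. *)
Let psum_ode (a : nat -> R) (g al : R) n (t : R) :
  a 1%N = (1 + g + al) * a 0%N ->
  (forall n, n.+2%:R * a n.+2 = (2 * n%:R + 3 + g + al) * a n.+1
     - (n%:R + 1 + g) * a n) ->
  (1 - t) ^+ 2 * dpsum a n t - ((g + 1) * (1 - t) + al) * psum a n t =
  - (n.+1%:R * a n.+1 * t ^+ n) + (n.+1%:R + g) * a n * t ^+ n.+1.
Proof.
move=> a1 rec; elim: n => [|n IH].
  by rewrite /dpsum /psum !big_nat1 a1 /= !expr0; ring.
have -> : dpsum a n.+1 t = dpsum a n t + a n.+1 * (n.+1%:R * t ^+ n).
  by rewrite /dpsum [LHS]big_nat_recr.
have -> : psum a n.+1 t = psum a n t + a n.+1 * t ^+ n.+1.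
  by rewrite /psum [LHS]big_nat_recr.
transitivity ((1 - t) ^+ 2 * dpsum a n t - ((g + 1) * (1 - t) + al) * psum a n t
  + ((1 - t) ^+ 2 * (a n.+1 * (n.+1%:R * t ^+ n))
     - ((g + 1) * (1 - t) + al) * (a n.+1 * t ^+ n.+1))); first by ring.
by rewrite IH rec -!natr1 !exprS; ring.
Qed.

(** No series is differentiated term by term. E is the reciprocal of the claimed sum, so by
    [psum_ode] the derivative of E times a partial sum consists of boundary terms only, and the mean
    value theorem on [0, t] bounds the distance of the product from its value 1 at 0. *)
Lemma laguerre_generating_function (a : nat -> R) (g al A K t : R) :
  a 0%N = 1 -> a 1%N = 1 + g + al -> -1 < g -> 0 <= al -> 0 < t < 1 ->
  (forall n, n.+2%:R * a n.+2 = (2 * n%:R + 3 + g + al) * a n.+1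
     - (n%:R + 1 + g) * a n) ->
  (forall n, `|a n| <= K * expR (A * Num.sqrt n%:R)) ->
  \sum_(0 <= k < n.+1) a k * t ^+ k @[n --> \oo] -->
    expR (- ((g + 1) * ln (1 - t)) + al * t / (1 - t)).
Proof.
move=> a0 a1 g1 al0 /andP[t0 t1] rec gr.
(* The exponent al u / (1-u) is written as al / (1-u) - al, which is easy to differentiate and gives
   E 0 = 1. *)
pose E (u : R) := expR ((g + 1) * ln (1 - u) - (al * (1 - u)^-1 - al)).
have EV : expR (- ((g + 1) * ln (1 - t)) + al * t / (1 - t)) = (E t)^-1.
  rewrite -expRN; congr expR; field; lra.
have dE (u : R) : u < 1 -> is_derive u 1 E (E u * - (((g + 1) * (1 - u) + al) / (1 - u) ^+ 2)).
  move=> u1; have u10 : 0 < 1 - u by lra.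
  have d1 := is_derive1_add _ _ _ _ _ (is_derive1_cst 1 u)
    (is_derive1_opp _ _ _ (is_derive1_id u)).
  have d2 := is_derive1_scale (g + 1) _ _ _ (is_derive1_lncomp (fun t : R => 1 - t) _ _ u10 d1).
  have d3 := is_derive1_scale al _ _ _ (is_derive1_inv (fun t : R => 1 - t) _ _ (lt0r_neq0 u10) d1).
  have d4 := is_derive1_add _ _ _ _ _ d3 (is_derive1_cst (- al) u).
  have d5 := is_derive1_add _ _ _ _ _ d2 (is_derive1_opp _ _ _ d4).
  apply: is_derive_eq (is_derive1_expR _ _ _ d5) _; congr (_ * _).
  by field; rewrite gt_eqF.
have E1 (u : R) : 0 <= u < 1 -> E u <= 1.
  move=> /andP[u0 u1]; rewrite expR_le1.
  have u10 : 0 < 1 - u by lra.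
  have : (g + 1) * ln (1 - u) <= 0.
    by rewrite mulr_ge0_le0//; [lra|apply: ln_le0; lra].
  have : 0 <= al * (1 - u)^-1 - al.
    rewrite (_ : _ - al = al * u / (1 - u)); last by field; rewrite gt_eqF.
    by rewrite divr_ge0 ?mulr_ge0// ltW.
  lra.
pose bnd n := n.+1%:R * `|a n.+1| * t ^+ n + (n.+1%:R + `|g|) * `|a n| * t ^+ n.
have key n : `|E t * psum a n t - 1| <= bnd n / (1 - t) ^+ 2.
  pose B (u : R) := - (n.+1%:R * a n.+1 * u ^+ n) + (n.+1%:R + g) * a n * u ^+ n.+1.
  have dphi (u : R) : 0 <= u <= t ->
      is_derive u 1 (fun u => E u * psum a n u) (E u * (B u / (1 - u) ^+ 2)).
    move=> /andP[u0 ut]; have u1 : u < 1 by lra.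
    have u10 : 0 < 1 - u by lra.
    apply: is_derive_eq (is_derive1_mul _ _ _ _ _ (dE u u1) (is_derive_psum a n u)) _.
    rewrite /B -(@psum_ode a g al n u) ?a0 ?mulr1//.
    by field; rewrite gt_eqF.
  have [u /andP[u0 ut]] := MVT_is_derive _ _ _ _ t0 dphi.
  have -> : E 0 * psum a n 0 = 1.
    rewrite /E subr0 ln1 mulr0 invr1 mulr1 subrr subr0 expR0 mul1r.
    rewrite /psum big_nat_recl//= a0 expr0 mulr1 big1 ?addr0// => k _.
    by rewrite expr0n mulr0.
  rewrite subr0 => ->.
  have u1 : u < 1 by lra.
  have u10 : 0 < 1 - u by lra.
  have ut0 : 0 < 1 - t by lra.
  have Eu : E u <= 1 by apply: E1; rewrite (ltW u0).
  have Eu0 : 0 <= E u by exact: expR_ge0.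
  have Bb : `|B u| <= bnd n.
    rewrite /B /bnd; apply: (le_trans (ler_normD _ _)); apply: lerD.
      rewrite normrN !normrM normrX (gtr0_norm u0) normr_nat ler_wpM2l ?mulr_ge0//.
      by rewrite lerXn2r ?nnegrE ?(ltW u0) ?(ltW t0)// ltW.
    rewrite 2!normrM normrX (gtr0_norm u0).
    rewrite ler_pM ?mulr_ge0 ?exprn_ge0 ?(ltW u0)//.
      rewrite ler_wpM2r//; apply: (le_trans (ler_normD _ _)).
      by rewrite ger0_norm.
    apply: (@le_trans _ _ (u ^+ n)).
      by rewrite exprS ler_piMl ?exprn_ge0 ?(ltW u0)// ltW.
    by rewrite lerXn2r ?nnegrE ?(ltW u0) ?(ltW t0)// ltW.
  rewrite !normrM normfV (ger0_norm Eu0) (ger0_norm (sqr_ge0 (1 - u))) (gtr0_norm t0).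
  apply: (@le_trans _ _ (`|B u| / (1 - u) ^+ 2)).
    have X0 : 0 <= `|B u| / (1 - u) ^+ 2 by rewrite divr_ge0 ?sqr_ge0.
    rewrite [leLHS](_ : _ = `|B u| / (1 - u) ^+ 2 * (E u * t)); last by ring.
    rewrite -[leRHS]mulr1 ler_wpM2l//.
    by rewrite mulr_ile1// ltW.
  apply: ler_pM => //; first by rewrite invr_ge0 sqr_ge0.
  by rewrite lef_pV2 ?posrE ?exprn_gt0// ler_sqr ?nnegrE ?(ltW ut0) ?(ltW u10)//; lra.
have bnd0 : bnd n @[n --> \oo] --> (0 : R).
  have h : (2 + `|g|) * `|K| * (n.+1%:R * expR (`|A| * Num.sqrt n.+1%:R) * t ^+ n)
      @[n --> \oo] --> ((2 + `|g|) * `|K| * 0 : R).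
    by apply: cvgMr; apply: subexp_geometric; rewrite t0.
  rewrite mulr0 in h.
  apply: (@squeeze_cvgr _ _ _ _ (cst 0) (fun n : nat => (2 + `|g|) * `|K| *
    (n.+1%:R * expR (`|A| * Num.sqrt n.+1%:R) * t ^+ n))) => //; last exact: cvg_cst.
  apply: nearW => n; apply/andP; split.
    by rewrite addr_ge0// !mulr_ge0 ?exprn_ge0 ?addr_ge0// ltW.
  have aS m : (m <= n.+1)%N -> `|a m| <= `|K| * expR (`|A| * Num.sqrt n.+1%:R).
    move=> mn; apply: (le_trans (gr m)).
    apply: (@le_trans _ _ (`|K| * expR (A * Num.sqrt m%:R))).
      by rewrite ler_wpM2r ?expR_ge0// ler_norm.
    rewrite ler_wpM2l// ler_expR; apply: (@le_trans _ _ (`|A| * Num.sqrt m%:R)).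
      by rewrite ler_wpM2r ?sqrtr_ge0// ler_norm.
    by rewrite ler_wpM2l// ler_sqrt ?ler_nat.
  have N1 : 1 <= n.+1%:R :> R by rewrite ler1n.
  have X0 : 0 <= `|K| * expR (`|A| * Num.sqrt n.+1%:R) * t ^+ n.
    by rewrite !mulr_ge0 ?expR_ge0 ?exprn_ge0// ltW.
  rewrite /bnd -mulrDl [leRHS](_ : _ = (n.+1%:R + (n.+1%:R + `|g| * n.+1%:R)) *
    (`|K| * expR (`|A| * Num.sqrt n.+1%:R)) * t ^+ n); last by ring.
  rewrite ler_wpM2r ?exprn_ge0 ?(ltW t0)// [leRHS]mulrDl lerD//.
    by rewrite ler_wpM2l// aS.
  by rewrite ler_pM ?addr_ge0 ?aS// lerD2l ler_peMr.
have Epsum : E t * psum a n t @[n --> \oo] --> (1 : R).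
  have h c : 1 + c * (bnd n / (1 - t) ^+ 2) @[n --> \oo] --> (1 + c * (0 / (1 - t) ^+ 2) : R).
    apply: cvgD; first exact: cvg_cst.
    by apply: cvgMr; apply: cvgMl.
  apply: (@squeeze_cvgr _ _ _ _ (fun n : nat => 1 + -1 * (bnd n / (1 - t) ^+ 2))
    (fun n : nat => 1 + 1 * (bnd n / (1 - t) ^+ 2))).
  - apply: nearW => n; have := key n; rewrite ler_norml => /andP[? ?].
    by apply/andP; split; lra.
  - by have := h (-1); rewrite mul0r mulr0 addr0.
  - by have := h 1; rewrite mul0r mulr0 addr0.
rewrite EV; have Et0 : E t != 0 by rewrite gt_eqF ?expR_gt0.
have h : (E t)^-1 * (E t * psum a n t) @[n --> \oo] --> ((E t)^-1 * 1 : R).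
  by apply: cvgMr.
rewrite mulr1 in h; apply: cvg_trans h; apply: near_eq_cvg.
by apply: nearW => n; rewrite mulKf.
Qed.

End generating_function.

(** * Gaussian bounds for the summands *)

Section laplace_method.
Context {R : realType}.
Implicit Types (s p lam mu x : R).

Lemma gauss_primitive_bounds (F : R -> R) :
  (forall x : R, is_derive x 1 F (gauss_fun x)) ->
  (F y - F (- y) @[y --> +oo] --> Num.sqrt pi) ->
  (forall u w : R, w <= u -> F u - F w <= Num.sqrt pi) /\
  (forall eta : R, 0 < eta -> exists Y : R, forall u w : R, Y <= u -> w <= - Y ->
     Num.sqrt pi - eta <= F u - F w).
Proof.
move=> dF cF.
have mF (u w : R) : w <= u -> F w <= F u.
  rewrite le_eqVlt => /orP[/eqP ->//|wu].
  have [t _ e] := MVT_is_derive _ _ _ _ wu (fun t _ => dF t).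
  by rewrite -subr_ge0 e mulr_ge0 ?gauss_fun_ge0// subr_ge0 ltW.
have Fle (y : R) : 0 <= y -> F y - F (- y) <= Num.sqrt pi.
  move=> y0; rewrite leNgt; apply/negP => h.
  pose e := F y - F (- y) - Num.sqrt pi.
  have e0 : 0 < e by rewrite subr_gt0.
  have /cvgrPdist_lt /(_ e e0) := cF.
  case=> A [Areal hA].
  have := hA (Num.max (A + 1) y); rewrite lt_max ltrDl ltr01/= => /(_ isT).
  set z := Num.max _ _ => hz.
  have yz : y <= z by rewrite le_max lexx orbT.
  have h1 : F y <= F z by exact: mF.
  have h2 : F (- z) <= F (- y) by apply: mF; rewrite lerN2.
  by move: hz; rewrite ltr_norml /e => /andP[]; lra.
split.
  move=> u w wu.
  pose y := `|u| + `|w|.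
  have hu : F u <= F y.
    by apply: mF; rewrite (le_trans (ler_norm _))// lerDl.
  have hw : F (- y) <= F w.
    by apply: mF; rewrite lerNl (le_trans (ler_norm _))// normrN lerDr.
  have := Fle y (addr_ge0 (normr_ge0 _) (normr_ge0 _)); lra.
move=> eta eta0; have /cvgrPdist_lt /(_ eta eta0) := cF.
case=> A [Areal hA]; exists (A + 1) => u w hu hw.
have h1 : F (A + 1) <= F u by exact: mF.
have h2 : F w <= F (- (A + 1)) by exact: mF.
have := hA (A + 1); rewrite ltrDl => /(_ ltr01) h.
by move: h; rewrite ltr_norml => /andP[]; lra.
Qed.

(* The logarithm of x^((p-1)/2) exp(2 s sqrt x) t^x at t = exp(-s^2/lam).  Its
   peak is near sqrt x = lam / s; in the variable v = s sqrt x / lam - 1 the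
   exponent is p ln(1+v) - lam v^2 up to constants and the Jacobian, and
   |ln(1+v) - v| <= 2 v^2 squeezes it between Gaussian exponents
   p v - mu v^2 with mu = lam +- 2 |p|.  [laplace_arg] completes the square. *)
Definition laplace_exponent s p lam x :=
  (p - 1) / 2 * ln x + 2 * s * Num.sqrt x - s ^+ 2 / lam * x.

Definition laplace_arg s p lam mu x :=
  Num.sqrt mu * (s * Num.sqrt x / lam - 1 - p / (2 * mu)).

(** Scales the derivative of F at [laplace_arg] to the squeezing Gaussian term, as in
    [laplace_term]: p^2 / (4 mu) comes from completing the square, and 2 lam / (s sqrt mu) undoes
    the chain rule except for 1 / sqrt x. *)
Definition laplace_weight s p lam mu :=
  expR (p * ln (lam / s) + lam + p ^+ 2 / (4 * mu)) * (2 * lam / (s * Num.sqrt mu)).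

Lemma is_derive_laplace_arg (F : R -> R) s p lam mu x :
  (forall x : R, is_derive x 1 F (gauss_fun x)) -> 0 < lam -> 0 < x ->
  is_derive x 1 (fun x => F (laplace_arg s p lam mu x))
   (gauss_fun (laplace_arg s p lam mu x) * (Num.sqrt mu * (s / (2 * lam * Num.sqrt x)))).
Proof.
move=> dF lam0 x0.
have d1 := is_derive1_sqrtcomp (fun t => t) x _ x0 (is_derive1_id x).
have d2 := is_derive1_scale (s / lam) _ _ _ d1.
have d3 := is_derive1_add _ _ _ _ _ d2 (is_derive1_cst (- 1 - p / (2 * mu)) x).
have d4 := is_derive1_scale (Num.sqrt mu) _ _ _ d3.
have dF' := dF (laplace_arg s p lam mu x).
have e : laplace_arg s p lam mu = (fun t => Num.sqrt mu *
   (s / lam * Num.sqrt t + (- 1 - p / (2 * mu)))).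
  by apply/funext => t; rewrite /laplace_arg; congr (_ * _); ring.
rewrite e in dF' *.
apply: is_derive_eq (@is_derive1_comp _ F _ x _ _ dF' d4) _.
congr (_ * _); rewrite mulr1 addr0; congr (_ * _); field.
by rewrite gt_eqF ?sqrtr_gt0// gt_eqF.
Qed.

Lemma laplace_exponentE s p lam x : 0 < s -> 0 < lam -> 0 < x ->
  let v := s * Num.sqrt x / lam - 1 in
  expR (laplace_exponent s p lam x) =
  expR (p * ln (lam / s) + lam) * expR (p * ln (1 + v) - lam * v ^+ 2) / Num.sqrt x.
Proof.
move=> s0 lam0 x0 v.
have y0 : 0 < Num.sqrt x by rewrite sqrtr_gt0.
have xE : x = Num.sqrt x ^+ 2 by rewrite sqr_sqrtr// ltW.
rewrite -[X in _ / X]lnK ?posrE// -expRN -!expRD; congr expR.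
rewrite /laplace_exponent.
have -> : ln (1 + v) = ln (Num.sqrt x) - ln (lam / s).
  rewrite -ln_div ?posrE ?divr_gt0//; congr ln; rewrite /v; field.
  by rewrite !gt_eqF.
have -> : ln x = 2 * ln (Num.sqrt x) by rewrite {1}xE lnXn// mulr_natl.
rewrite {3}xE /v; field.
by rewrite gt_eqF.
Qed.

Lemma laplace_term s p lam mu x : 0 < s -> 0 < lam -> 0 < mu -> 0 < x ->
  let v := s * Num.sqrt x / lam - 1 in
  laplace_weight s p lam mu *
    (gauss_fun (laplace_arg s p lam mu x) * (Num.sqrt mu * (s / (2 * lam * Num.sqrt x)))) =
  expR (p * ln (lam / s) + lam) * expR (p * v - mu * v ^+ 2) / Num.sqrt x.
Proof.
move=> s0 lam0 mu0 x0 v.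
have y0 : 0 < Num.sqrt x by rewrite sqrtr_gt0.
have m0 : 0 < Num.sqrt mu by rewrite sqrtr_gt0.
rewrite /laplace_weight /gauss_fun.
have eA : - laplace_arg s p lam mu x ^+ 2 = p * v - mu * v ^+ 2 - p ^+ 2 / (4 * mu).
  rewrite /laplace_arg exprMn sqr_sqrtr ?(ltW mu0)// -/v.
  clearbody v; field.
  by rewrite gt_eqF.
rewrite eA; clearbody v.
rewrite (expRD (p * ln (lam / s) + lam)) (expRB (p * v - mu * v ^+ 2)).
have w0 := expR_gt0 (p ^+ 2 / (4 * mu)).
by field; rewrite !gt_eqF.
Qed.

(** The condition on x says v >= -1/2, the range of [ln1p_order1]. There p (ln(1+v) - v) lies within
    2 |p| v^2 of zero, which turns lam into lam -+ 2 |p|. *)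
Lemma laplace_term_bounds s p lam x : 0 < s -> 2 * `|p| < lam ->
  lam ^+ 2 / (4 * s ^+ 2) <= x ->
  expR (laplace_exponent s p lam x) <=
    laplace_weight s p lam (lam - 2 * `|p|) *
    (gauss_fun (laplace_arg s p lam (lam - 2 * `|p|) x) *
      (Num.sqrt (lam - 2 * `|p|) * (s / (2 * lam * Num.sqrt x)))) /\
  laplace_weight s p lam (lam + 2 * `|p|) *
    (gauss_fun (laplace_arg s p lam (lam + 2 * `|p|) x) *
      (Num.sqrt (lam + 2 * `|p|) * (s / (2 * lam * Num.sqrt x)))) <=
  expR (laplace_exponent s p lam x).
Proof.
move=> s0 plam xlam.
have p0 : 0 <= `|p| by [].
have lam0 : 0 < lam by lra.
have x0 : 0 < x by apply: lt_le_trans xlam; rewrite divr_gt0 ?mulr_gt0 ?exprn_gt0.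
have y0 : 0 < Num.sqrt x by rewrite sqrtr_gt0.
have m1 : 0 < lam - 2 * `|p| by lra.
have m2 : 0 < lam + 2 * `|p| by lra.
have e1 := laplace_term s p lam _ x s0 lam0 m1 x0.
have e2 := laplace_term s p lam _ x s0 lam0 m2 x0.
have e3 := laplace_exponentE s p lam x s0 lam0 x0.
move: e1 e2 e3 => /= -> -> ->.
set v := s * Num.sqrt x / lam - 1.
have v2 : - 2^-1 <= v.
  have : lam / (2 * s) <= Num.sqrt x.
    rewrite -ler_sqr ?nnegrE ?sqrtr_ge0 ?divr_ge0 ?mulr_ge0 ?(ltW s0) ?(ltW lam0)//.
    by rewrite sqr_sqrtr ?(ltW x0)// expr_div_n exprMn -natrX.
  rewrite ler_pdivrMr ?mulr_gt0// => h.
  have : 2^-1 <= s * Num.sqrt x / lam by rewrite ler_pdivlMr//; lra.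
  rewrite /v; lra.
have hv : `|p * (ln (1 + v) - v)| <= `|p| * (2 * v ^+ 2).
  by rewrite normrM ler_wpM2l// ln1p_order1.
move: hv; rewrite ler_norml => /andP[h1 h2].
split; rewrite ler_pM2r ?invr_gt0// ler_pM2l ?expR_gt0// ler_expR; lra.
Qed.

End laplace_method.

(** * Power series at t near 1 bounded by Gaussian increments *)

Section abelian_bounds.
Context {R : realType}.

Lemma cvg_inv_nat : (n%:R^-1 : R) @[n --> \oo] --> (0 : R).
Proof.
apply/gtr0_cvgV0; last exact: cvgr_idn.
by exists 1%N => // n /= n0; rewrite ltr0n.
Qed.

Lemma cvg_inv_sqrt_nat : ((Num.sqrt n%:R)^-1 : R) @[n --> \oo] --> (0 : R).
Proof.
have h : Num.sqrt (n%:R^-1 : R) @[n --> \oo] --> Num.sqrt (0 : R).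
  by apply: continuous_cvg; [exact: sqrt_continuous|exact: cvg_inv_nat].
rewrite sqrtr0 in h; apply: cvg_trans h; apply: near_eq_cvg.
by apply: nearW => n; rewrite sqrtrV.
Qed.

Definition stretched_exp (q s x : R) := expR (q * ln x + 2 * s * Num.sqrt x).

(** On a unit interval ln moves by at most 1/n and the square root by at most 1 / sqrt n. The sign
    of q is free, hence |q| on both sides; the square root only increases, so it enters only the
    lower bound. *)
Lemma stretched_exp_step (q s x : R) (n : nat) : 0 < s -> (0 < n)%N ->
  n%:R <= x <= n.+1%:R ->
  expR (- (`|q| * n%:R^-1 + 2 * s * (Num.sqrt n%:R)^-1)) * stretched_exp q s x
    <= stretched_exp q s n%:R <= expR (`|q| * n%:R^-1) * stretched_exp q s x.
Proof.
move=> s0 n0 /andP[nx xn].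
have N0 : 0 < n%:R :> R by rewrite ltr0n.
have x0 : 0 < x by exact: lt_le_trans nx.
have lnx0 : 0 <= ln x - ln n%:R by rewrite subr_ge0 ler_ln ?posrE.
have lnx1 : ln x - ln n%:R <= n%:R^-1.
  rewrite -ln_div ?posrE//; apply: (le_trans (ln_le_sub1 _ _)); first by rewrite divr_gt0.
  rewrite lerBlDr ler_pdivrMr// mulrDl mul1r mulVf ?gt_eqF//.
  by rewrite addrC natr1.
have y0 : 0 < Num.sqrt n%:R :> R by rewrite sqrtr_gt0.
have sx0 : 0 <= Num.sqrt x - Num.sqrt n%:R by rewrite subr_ge0 ler_sqrt ?(ltW x0).
have sx1 : Num.sqrt x - Num.sqrt n%:R <= (Num.sqrt n%:R)^-1.
  rewrite -[leRHS]div1r ler_pdivlMr//.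
  apply: (@le_trans _ _ ((Num.sqrt x - Num.sqrt n%:R) * (Num.sqrt x + Num.sqrt n%:R))).
    by rewrite ler_wpM2l// lerDr sqrtr_ge0.
  by rewrite -subr_sqr !sqr_sqrtr ?(ltW x0)// lerBlDl natr1.
have ql : `|q * (ln x - ln n%:R)| <= `|q| * n%:R^-1.
  by rewrite normrM ler_wpM2l// ger0_norm.
have sl : s * (Num.sqrt x - Num.sqrt n%:R) <= s * (Num.sqrt n%:R)^-1 by rewrite ler_pM2l.
have sl0 : 0 <= s * (Num.sqrt x - Num.sqrt n%:R) by rewrite mulr_ge0// ltW.
move: ql; rewrite ler_norml => /andP[h1 h2].
rewrite /stretched_exp -!expRD !ler_expR; apply/andP; split; lra.
Qed.

(** The bounds hold at every x of [n, n+1], since the mean value theorem will return an unspecified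
    point there. *)
Lemma stretched_exp_interpolation (a : nat -> R) (q s kap : R) : 0 < s ->
  (forall n, 0 <= a n) ->
  a n / stretched_exp q s n%:R @[n --> \oo] --> kap ->
  forall delta, 0 < delta -> exists N, forall n, (N <= n)%N ->
  forall x, n%:R <= x <= n.+1%:R ->
  (kap - delta) * stretched_exp q s x <= a n <= (kap + delta) * stretched_exp q s x.
Proof.
move=> s0 a0 ac delta d0.
have e0 (u : nat -> R) : u n @[n --> \oo] --> (0 : R) ->
    a n / stretched_exp q s n%:R * expR (u n) @[n --> \oo] --> kap.
  move=> u0; have h := cvg_comp _ _ u0 (@continuous_expR R 0).
  by rewrite expR0 in h; rewrite -(mulr1 kap); exact: cvgM ac h.
have hi := e0 (fun n => `|q| * n%:R^-1).
have lo := e0 (fun n => - (`|q| * n%:R^-1 + 2 * s * (Num.sqrt n%:R)^-1)).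
have hi0 : `|q| * n%:R^-1 @[n --> \oo] --> (0 : R).
  by rewrite -(mulr0 `|q|); apply: cvgMr; exact: cvg_inv_nat.
have lo0 : - (`|q| * n%:R^-1 + 2 * s * (Num.sqrt n%:R)^-1) @[n --> \oo] --> (0 : R).
  rewrite -oppr0; apply: cvgN; rewrite -(addr0 0); apply: cvgD => //.
  by rewrite -(mulr0 (2 * s)); apply: cvgMr; exact: cvg_inv_sqrt_nat.
have /cvgrPdist_le /(_ delta d0) [N1 _ h1] := hi hi0.
have /cvgrPdist_le /(_ delta d0) [N2 _ h2] := lo lo0.
exists (N1 + N2 + 1)%N => n nN x nx.
have n0 : (0 < n)%N by apply: leq_trans nN; rewrite addn1.
have nN1 : (N1 <= n)%N by apply: leq_trans nN; rewrite -addnA leq_addr.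
have nN2 : (N2 <= n)%N by apply: leq_trans nN; rewrite addnAC leq_addl.
have /andP[s1 s2] := stretched_exp_step q s x n s0 n0 nx.
have := h1 n nN1; have := h2 n nN2; rewrite /= !ler_norml => /andP[_ h3] /andP[h4 _].
have En : 0 < stretched_exp q s n%:R by exact: expR_gt0.
have Ex : 0 < stretched_exp q s x by exact: expR_gt0.
set r := a n / _ in h3 h4.
have r0 : 0 <= r by rewrite divr_ge0// ltW.
have -> : a n = r * stretched_exp q s n%:R by rewrite /r divfK// gt_eqF.
apply/andP; split.
  apply: (@le_trans _ _ (r * (expR (- (`|q| * n%:R^-1 + 2 * s * (Num.sqrt n%:R)^-1)) *
    stretched_exp q s x))); last by rewrite ler_wpM2l.
  by rewrite mulrA ler_pM2r//; lra.
apply: (@le_trans _ _ (r * (expR (`|q| * n%:R^-1) * stretched_exp q s x))).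
  by rewrite ler_wpM2l.
by rewrite mulrA ler_pM2r//; lra.
Qed.

Lemma laplace_exponent_stretched (p s lam x : R) :
  expR (laplace_exponent s p lam x) =
  stretched_exp ((p - 1) / 2) s x * expR (- (s ^+ 2 / lam) * x).
Proof. by rewrite -expRD /laplace_exponent; congr expR; ring. Qed.

Definition laplace_node (s lam : R) := expR (- (s ^+ 2 / lam)).

Section sums.
Variables (F : R -> R) (a : nat -> R) (p s kap delta : R) (N : nat).
Hypothesis dF : forall x : R, is_derive x 1 F (gauss_fun x).
Hypothesis s0 : 0 < s.
Hypothesis a0 : forall n, 0 <= a n.
Hypothesis kd : 0 <= kap - delta.
Hypothesis d0 : 0 <= delta.
Hypothesis aN : forall n, (N <= n)%N -> forall x, n%:R <= x <= n.+1%:R ->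
  (kap - delta) * stretched_exp ((p - 1) / 2) s x <= a n <=
  (kap + delta) * stretched_exp ((p - 1) / 2) s x.

(** The mean value theorem on [n, n+1] turns an increment of F into the Gaussian term at some x,
    where the bounds for a_n apply as well. Since t < 1, t^x <= t^n settles the lower bound, while
    t^n <= t^(x-1) costs the factor exp(s^2/lam), which tends to 1. *)
Lemma block_sum (lam : R) (n : nat) : 2 * `|p| < lam -> (N <= n)%N ->
  lam ^+ 2 / (4 * s ^+ 2) <= n%:R ->
  let t := laplace_node s lam in
  let mu1 := lam - 2 * `|p| in let mu2 := lam + 2 * `|p| in
  let P mu m := F (laplace_arg s p lam mu m%:R) in
  (kap - delta) * laplace_weight s p lam mu2 * (P mu2 n.+1 - P mu2 n) <= a n * t ^+ n /\
  a n * t ^+ n <= (kap + delta) * expR (s ^+ 2 / lam) * laplace_weight s p lam mu1 *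
     (P mu1 n.+1 - P mu1 n).
Proof.
move=> plam nN xlam t mu1 mu2 P.
have p0 : 0 <= `|p| by [].
have lam0 : 0 < lam by lra.
have n0 : 0 < n%:R :> R.
  by apply: lt_le_trans xlam; rewrite divr_gt0 ?mulr_gt0 ?exprn_gt0.
have nn1 : n%:R < n.+1%:R :> R by rewrite ltr_nat.
have tn : t ^+ n = expR (- (s ^+ 2 / lam) * n%:R) by rewrite /t /laplace_node expRM_natr.
have sl0 : 0 < s ^+ 2 / lam by rewrite divr_gt0// exprn_gt0.
have n10 : n.+1%:R - n%:R = 1 :> R by rewrite -natr1; ring.
split.
- have [x /andP[nx xn]] := MVT_is_derive _ _ _ _ nn1 (fun x hx =>
    is_derive_laplace_arg F s p lam mu2 x dF lam0 (lt_le_trans n0 (andP hx).1)).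
  rewrite n10 mulr1 -/(P mu2 n) -/(P mu2 n.+1) => ->.
  have xl : lam ^+ 2 / (4 * s ^+ 2) <= x by rewrite (le_trans xlam)// ltW.
  have [_] := laplace_term_bounds s p lam x s0 plam xl.
  rewrite -/mu2 => h.
  have nxx : n%:R <= x <= n.+1%:R by rewrite !ltW.
  have /andP[h1 _] := aN n nN x nxx.
  apply: (@le_trans _ _ ((kap - delta) * expR (laplace_exponent s p lam x))).
    by rewrite -(mulrA (kap - delta)) ler_wpM2l.
  rewrite laplace_exponent_stretched mulrA tn.
  apply: ler_pM; rewrite ?expR_ge0 ?mulr_ge0 ?expR_ge0//.
  by rewrite ler_expR !mulNr lerN2 ler_pM2l// ltW.
- have [x /andP[nx xn]] := MVT_is_derive _ _ _ _ nn1 (fun x hx =>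
    is_derive_laplace_arg F s p lam mu1 x dF lam0 (lt_le_trans n0 (andP hx).1)).
  rewrite n10 mulr1 -/(P mu1 n) -/(P mu1 n.+1) => ->.
  have xl : lam ^+ 2 / (4 * s ^+ 2) <= x by rewrite (le_trans xlam)// ltW.
  have [+ _] := laplace_term_bounds s p lam x s0 plam xl.
  rewrite -/mu1 => h.
  have nxx : n%:R <= x <= n.+1%:R by rewrite !ltW.
  have /andP[_ h1] := aN n nN x nxx.
  have kd1 : 0 <= kap + delta by move: kd d0; lra.
  apply: (@le_trans _ _ ((kap + delta) * (expR (s ^+ 2 / lam) *
    expR (laplace_exponent s p lam x)))); last first.
    rewrite -(mulrA ((kap + delta) * _)) -(mulrA (kap + delta)) ler_wpM2l//.
    by rewrite ler_wpM2l ?expR_ge0.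
  have -> : (kap + delta) * (expR (s ^+ 2 / lam) * expR (laplace_exponent s p lam x)) =
     (kap + delta) * stretched_exp ((p - 1) / 2) s x *
     expR (s ^+ 2 / lam + - (s ^+ 2 / lam) * x).
    by rewrite laplace_exponent_stretched (expRD (s ^+ 2 / lam)); ring.
  rewrite tn.
  apply: ler_pM; [exact: a0|exact: expR_ge0|exact: h1|].
  rewrite ler_expR.
  have : s ^+ 2 / lam * x <= s ^+ 2 / lam * (n%:R + 1) by rewrite ler_pM2l// natr1 ltW.
  by rewrite mulrDr mulr1; lra.
Qed.

Variable G : R -> R.
Hypothesis cG : forall t, 0 < t < 1 ->
  \sum_(0 <= k < n.+1) a k * t ^+ k @[n --> \oo] --> G t.

Lemma partial_sum_le (t : R) (n : nat) : 0 < t < 1 ->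
  \sum_(0 <= k < n) a k * t ^+ k <= G t.
Proof.
move=> t01; have /andP[t0 _] := t01.
have aks k : 0 <= a k * t ^+ k by rewrite mulr_ge0// exprn_ge0// ltW.
apply: (@le_trans _ _ (\sum_(0 <= k < n.+1) a k * t ^+ k)).
  by rewrite [leRHS]big_nat_recr//= lerDl.
have nd : nondecreasing_seq (fun n => \sum_(0 <= k < n.+1) a k * t ^+ k).
  by apply/nondecreasing_seqP => m; rewrite [leRHS]big_nat_recr//= lerDl.
have := cG t t01 => c; rewrite -(cvg_lim _ c)//.
by apply: nondecreasing_cvgn_le => //; apply: cvgP c.
Qed.

(* The terms with k < n0 are absorbed using t^k <= t^(2k) / t^n0. *)
Lemma abelian_upper (lam : R) (n0 : nat) :
  (forall u w : R, w <= u -> F u - F w <= Num.sqrt pi) ->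
  2 * `|p| < lam -> (N <= n0)%N -> lam ^+ 2 / (4 * s ^+ 2) <= n0%:R ->
  let t := laplace_node s lam in
  (G t <= G (t ^+ 2) / t ^+ n0 +
    (kap + delta) * expR (s ^+ 2 / lam) * laplace_weight s p lam (lam - 2 * `|p|)
      * Num.sqrt pi : Prop).
Proof.
move=> Fub plam nN xlam t.
have p0 : 0 <= `|p| by [].
have lam0 : 0 < lam by lra.
have t0 : 0 < t by exact: expR_gt0.
have t1 : t < 1 by rewrite expR_lt1 oppr_lt0 divr_gt0// exprn_gt0.
have t01 : 0 < t < 1 by rewrite t0.
have t201 : 0 < t ^+ 2 < 1 by rewrite exprn_gt0//= exprn_ilt1// ltW.
set C := (kap + delta) * expR (s ^+ 2 / lam) * _.
have C0 : 0 <= C.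
  rewrite !mulr_ge0 ?expR_ge0 ?invr_ge0 ?mulr_ge0 ?sqrtr_ge0 ?(ltW s0) ?(ltW lam0)//.
  by move: kd d0; lra.
rewrite -(cvg_lim _ (cG t t01))//; apply: limr_le.
  by apply: cvgP (cG t t01).
exists n0 => // n /= nn0; rewrite (@big_cat_nat _ _ _ n0)//=; last by rewrite leqW.
apply: lerD.
  apply: (@le_trans _ _ (\sum_(0 <= k < n0) a k * (t ^+ 2) ^+ k / t ^+ n0)); last first.
    rewrite -big_distrl/= ler_pM2r ?invr_gt0 ?exprn_gt0//.
    exact: partial_sum_le.
  rewrite [leLHS]big_nat_cond [leRHS]big_nat_cond; apply: ler_sum => k /andP[/andP[_ kn] _].
  rewrite ler_pdivlMr ?exprn_gt0// -mulrA ler_wpM2l// -exprM mul2n -addnn exprD.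
  rewrite ler_pM2l ?exprn_gt0//.
  by rewrite ler_wiXn2l ?(ltW t0) ?(ltW t1)// ltnW.
apply: (@le_trans _ _ (\sum_(n0 <= k < n.+1) C *
   (F (laplace_arg s p lam (lam - 2 * `|p|) k.+1%:R) -
    F (laplace_arg s p lam (lam - 2 * `|p|) k%:R)))).
  rewrite [leLHS]big_nat_cond [leRHS]big_nat_cond; apply: ler_sum => k /andP[/andP[kn _] _].
  have xk : lam ^+ 2 / (4 * s ^+ 2) <= k%:R by rewrite (le_trans xlam)// ler_nat.
  by have [_] := block_sum lam k plam (leq_trans nN kn) xk.
rewrite -big_distrr/= telescope_sumr ?leqW//; rewrite ler_wpM2l//; apply: Fub.
rewrite /laplace_arg ler_wpM2l ?sqrtr_ge0// !lerD2r ler_pM2r ?invr_gt0// ler_pM2l//.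
by rewrite ler_sqrt ?ler0n// ler_nat leqW.
Qed.

(** Terms are nonnegative, so it suffices to keep a finite block on which [laplace_arg] runs from
    below -Y to above Y. *)
Lemma abelian_lower (lam eta Y : R) (n0 : nat) :
  (forall u w : R, Y <= u -> w <= - Y -> Num.sqrt pi - eta <= F u - F w) ->
  2 * `|p| < lam -> (N <= n0)%N -> lam ^+ 2 / (4 * s ^+ 2) <= n0%:R ->
  laplace_arg s p lam (lam + 2 * `|p|) n0%:R <= - Y ->
  (kap - delta) * laplace_weight s p lam (lam + 2 * `|p|) * (Num.sqrt pi - eta) <=
  G (laplace_node s lam).
Proof.
move=> Flb plam nN xlam hY; set t := laplace_node s lam.
have p0 : 0 <= `|p| by [].
have lam0 : 0 < lam by lra.
have t0 : 0 < t by exact: expR_gt0.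
have t1 : t < 1 by rewrite expR_lt1 oppr_lt0 divr_gt0// exprn_gt0.
have t01 : 0 < t < 1 by rewrite t0.
set C := (kap - delta) * _.
have C0 : 0 <= C.
  by rewrite !mulr_ge0 ?expR_ge0 ?invr_ge0 ?mulr_ge0 ?sqrtr_ge0 ?(ltW s0) ?(ltW lam0).
pose mu := lam + 2 * `|p|.
have mu0 : 0 < Num.sqrt mu by rewrite sqrtr_gt0 /mu; lra.
(* The threshold is the inequality Y <= [laplace_arg] solved for the square root. *)
have [M hM] := sqrt_nat_ge ((Y / Num.sqrt mu + (1 + p / (2 * mu))) * lam / s).
pose m := (n0 + M)%N.
have Ym : Y <= laplace_arg s p lam mu m%:R.
  have := hM m (leq_addl _ _); rewrite ler_pdivrMr// -ler_pdivlMr// => h.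
  by rewrite /laplace_arg mulrC -ler_pdivrMr//; move: h; rewrite [s * _]mulrC; lra.
apply: (le_trans _ (partial_sum_le t m t01)).
rewrite (@big_cat_nat _ _ _ n0)//= ?leq_addr//.
apply: ler_wpDl.
  by apply: sumr_ge0 => k _; rewrite mulr_ge0// exprn_ge0// ltW.
apply: (@le_trans _ _ (\sum_(n0 <= k < m) C *
   (F (laplace_arg s p lam mu k.+1%:R) - F (laplace_arg s p lam mu k%:R)))).
  rewrite -big_distrr/= telescope_sumr ?leq_addr// ler_wpM2l//.
  exact: Flb.
rewrite [leLHS]big_nat_cond [leRHS]big_nat_cond; apply: ler_sum => k /andP[/andP[kn _] _].
have xk : lam ^+ 2 / (4 * s ^+ 2) <= k%:R by rewrite (le_trans xlam)// ler_nat.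
by have [] := block_sum lam k plam (leq_trans nN kn) xk.
Qed.

End sums.
End abelian_bounds.

(** * The generating function near its singularity *)

Section abelian_limits.
Context {R : realType}.

(** The two ingredients of the generating function at t = exp(-tau). With z = exp(tau) - 1, t /
    (1-t) is 1/z and 1 - t is z / (1+z), so bounds on tau = ln(1+z) suffice. *)
Lemma bose_expansion (tau : R) : 0 < tau <= 2^-1 ->
  - tau <= ln (1 - expR (- tau)) - ln tau <= 0 /\
  `|expR (- tau) / (1 - expR (- tau)) - tau^-1 + 2^-1| <= 8 * tau.
Proof.
move=> /andP[tau0 tau2].
pose z := expR tau - 1.
have z_ge : tau <= z by have := expR_ge1Dx tau; rewrite /z; lra.
have z0 : 0 < z by lra.
have eE : expR tau = 1 + z by rewrite /z; ring.
have eNE : expR (- tau) = (1 + z)^-1 by rewrite expRN eE.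
have eN_ge : 1 - tau <= expR (- tau) by have := expR_ge1Dx (- tau); lra.
have z2 : z <= 2 * tau.
  have h : (1 + z) * (1 - tau) <= 1.
    have := ler_wpM2l (ltW (expR_gt0 tau)) eN_ge.
    by rewrite expRxMexpNx_1 eE.
  have h2 : z * 2^-1 <= z * (1 - tau) by rewrite ler_pM2l//; lra.
  lra.
have e1 : 1 - expR (- tau) = z / (1 + z).
  by rewrite eNE; field; lra.
have lnz : ln (1 + z) = tau by rewrite -eE expRK.
have lnE : ln (1 - expR (- tau)) = ln z - tau.
  by rewrite e1 ln_div ?posrE ?lnz//; lra.
have lnz_tau : 0 <= ln z - ln tau by rewrite subr_ge0 ler_ln ?posrE.
have ztau : ln z - ln tau <= tau.
  have h : z <= tau * expR tau.
    have := ler_wpM2r (ltW (expR_gt0 tau)) (_ : 1 - expR (- tau) <= tau).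
    have -> : (1 - expR (- tau)) * expR tau = z.
      by rewrite mulrBl mul1r mulrC expRxMexpNx_1.
    apply; lra.
  rewrite -[leRHS]expRK -ln_div ?posrE// ler_ln ?posrE ?divr_gt0 ?expR_gt0//.
  by rewrite ler_pdivrMr// mulrC.
split; first by rewrite lnE; apply/andP; split; lra.
have -> : expR (- tau) / (1 - expR (- tau)) = z^-1.
  by rewrite eNE; field; rewrite !gt_eqF//; lra.
have hz : - 2^-1 <= z by lra.
have := ln1p_order1 _ hz; rewrite lnz ler_norml => /andP[w1 _].
have := ln1p_order2 _ (ltW z0); rewrite lnz ler_norml => /andP[w2 w3].
have zt2 : z ^+ 2 <= 4 * tau ^+ 2.
  have -> : 4 * tau ^+ 2 = (2 * tau) ^+ 2 by ring.
  by rewrite ler_sqr ?nnegrE ?mulr_ge0 ?(ltW z0) ?(ltW tau0).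
set eps := tau - z + z ^+ 2 / 2 in w2 w3.
(* Both quotients are O(tau): tau - z has order z^2 and [eps] has order z^3. *)
have -> : z^-1 - tau^-1 + 2^-1 = (tau - z) / (2 * tau) + eps / (z * tau).
  by rewrite /eps; field; rewrite !gt_eqF.
apply: (le_trans (ler_normD _ _)).
rewrite (_ : 8 * tau = 4 * tau + 4 * tau); last by ring.
apply: lerD.
  rewrite normrM normfV (gtr0_norm (_ : 0 < 2 * tau)) ?mulr_gt0//.
  rewrite ler_pdivrMr ?mulr_gt0// distrC ger0_norm; last lra.
  have : z - tau <= 2 * z ^+ 2 by lra.
  lra.
rewrite normrM normfV (gtr0_norm (_ : 0 < z * tau)) ?mulr_gt0//.
rewrite ler_pdivrMr ?mulr_gt0//.
apply: (@le_trans _ _ (z ^+ 3)); first by rewrite ler_norml; apply/andP; split; lra.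
rewrite (_ : 4 * tau * (z * tau) = (4 * tau ^+ 2) * z); last by ring.
by rewrite exprSr ler_pM2r.
Qed.

Definition laguerre_gf (g s t : R) :=
  expR (- ((g + 1) * ln (1 - t)) + s ^+ 2 * t / (1 - t)).

(** The divergent factor common to both sides: [laplace_weight] at mu = lam without exp(p^2 / (4
    mu)). *)
Definition laplace_scale (s p lam : R) :=
  expR (p * ln (lam / s) + lam) * (2 * Num.sqrt lam / s).

Definition laplace_limit (g s : R) := expR (- (s ^+ 2 / 2) - (g + 2^-1) * ln s) / 2.

(** The factor (1-t)^(-g-1) grows like lam^(g+1) = lam^p sqrt lam, which dictates p = g + 1/2. In
    [laplace_limit], exp(-s^2/2) stems from the term -1/2 of [bose_expansion], and the power of s
    from ln tau = 2 ln s - ln lam. *)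
Lemma laguerre_gf_expansion (g s lam : R) : 0 < s -> 0 < lam -> 2 * s ^+ 2 <= lam ->
  exists2 e : R, `|e| <= (`|g + 1| + 8 * s ^+ 2) * (s ^+ 2 / lam) &
  laguerre_gf g s (laplace_node s lam) =
    laplace_scale s (g + 2^-1) lam * laplace_limit g s * expR e.
Proof.
move=> s0 lam0 slam.
have s20 : 0 < s ^+ 2 by rewrite exprn_gt0.
pose tau := s ^+ 2 / lam.
have tau0 : 0 < tau by rewrite divr_gt0.
have tau2 : tau <= 2^-1 by rewrite ler_pdivrMr//; lra.
have [|/andP[A1 A2] B1] := bose_expansion tau; first by rewrite tau0.
set A := ln _ - ln tau in A1 A2; set B := _ + 2^-1 in B1.
exists (- ((g + 1) * A) + s ^+ 2 * B).
  apply: (le_trans (ler_normD _ _)); rewrite [leRHS]mulrDl normrN; apply: lerD.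
    rewrite normrM ler_wpM2l// -/tau ler_norml; apply/andP; split; lra.
  rewrite normrM (gtr0_norm s20) [leRHS](_ : _ = s ^+ 2 * (8 * tau)); last first.
    by rewrite /tau; ring.
  by rewrite ler_pM2l.
have sl0 : 0 < Num.sqrt lam by rewrite sqrtr_gt0.
have e1 : (2 * Num.sqrt lam / s : R) = expR (ln 2 + ln lam / 2 - ln s).
  rewrite expRB expRD !lnK ?posrE//; congr (_ * _ / _).
  have -> : ln lam = 2 * ln (Num.sqrt lam).
    by rewrite -{1}(sqr_sqrtr (ltW lam0)) lnXn// mulr_natl.
  by rewrite mulrC mulKf// lnK.
have e2 : laplace_limit g s = expR (- (s ^+ 2 / 2) - (g + 2^-1) * ln s - ln 2).
  by rewrite /laplace_limit [in RHS]expRB lnK ?posrE.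
rewrite /laguerre_gf /laplace_scale e1 e2 -!expRD; congr expR.
have lt : ln tau = 2 * ln s - ln lam.
  by rewrite /tau ln_div ?posrE// lnXn// mulr_natl.
have ls : ln (lam / s) = ln lam - ln s by rewrite ln_div ?posrE.
have eA : ln (1 - laplace_node s lam) = A + 2 * ln s - ln lam.
  by rewrite /A -addrA -lt subrK.
have eB : laplace_node s lam / (1 - laplace_node s lam) = B - 2^-1 + lam / s ^+ 2.
  by rewrite /B /laplace_node -/tau /tau; rewrite invf_div; ring.
rewrite -mulrA eB eA ls; field; lra.
Qed.

End abelian_limits.

(** * Comparison of the two limits *)

Section abelian_constant.
Context {R : realType}.

Lemma cvg_div_pinfty (c : R) : c / x @[x --> +oo] --> (0 : R).
Proof.
rewrite -(mulr0 c); apply: cvgMr.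
apply/gtr0_cvgV0; last exact: cvg_id.
exact: nbhs_pinfty_gt.
Qed.

Lemma cvg_expR_div_pinfty (c : R) : expR (c / x) @[x --> +oo] --> (1 : R).
Proof.
have h := cvg_comp _ _ (cvg_div_pinfty c) (@continuous_expR R 0).
by rewrite expR0 in h.
Qed.

Lemma laplace_scale_gt0 (s p lam : R) : 0 < s -> 0 < lam -> 0 < laplace_scale s p lam.
Proof. by move=> s0 l0; rewrite !mulr_gt0 ?expR_gt0 ?invr_gt0 ?sqrtr_gt0. Qed.

Lemma laguerre_gf_scale_cvg (g s : R) : 0 < s ->
  laguerre_gf g s (laplace_node s lam) / laplace_scale s (g + 2^-1) lam
   @[lam --> +oo] --> laplace_limit g s.
Proof.
move=> s0; pose C := (`|g + 1| + 8 * s ^+ 2) * s ^+ 2.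
have L0 : 0 < laplace_limit g s by rewrite divr_gt0 ?expR_gt0.
have h c : laplace_limit g s * expR (c / lam) @[lam --> +oo] --> laplace_limit g s.
  by rewrite -[X in _ --> X]mulr1; apply: cvgMr; exact: cvg_expR_div_pinfty.
apply: (@squeeze_cvgr _ _ _ _ (fun lam => laplace_limit g s * expR (- C / lam))
  (fun lam => laplace_limit g s * expR (C / lam))); [|exact: h|exact: h].
near=> lam.
have lam0 : 0 < lam by near: lam; exact: nbhs_pinfty_gt.
have slam : 2 * s ^+ 2 <= lam by near: lam; apply: nbhs_pinfty_ge; exact: num_real.
have [e he ->] := laguerre_gf_expansion g s lam s0 lam0 slam.
have sc := laplace_scale_gt0 s (g + 2^-1) lam s0 lam0.
have -> : laplace_scale s (g + 2^-1) lam * laplace_limit g s * expR e /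
    laplace_scale s (g + 2^-1) lam = laplace_limit g s * expR e.
  by field; rewrite gt_eqF.
rewrite !ler_pM2l// !ler_expR mulNr.
by rewrite -ler_norml (le_trans he)// mulrA.
Unshelve. all: by end_near. Qed.

Lemma laplace_weight_scale_cvg (s p k : R) : 0 < s ->
  laplace_weight s p lam (lam + k) / laplace_scale s p lam @[lam --> +oo] --> (1 : R).
Proof.
move=> s0.
have h1 : 1 + k / lam @[lam --> +oo] --> (1 : R).
  rewrite -[X in _ --> X]addr0; apply: cvgD; first exact: cvg_cst.
  exact: cvg_div_pinfty.
have h2 : (Num.sqrt (1 + k / lam))^-1 @[lam --> +oo] --> (1 : R).
  have := cvg_comp _ _ h1 (@sqrt_continuous R 1); rewrite sqrtr1 => h.
  by rewrite -[X in _ --> X]invr1; apply: cvgV.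
have h3 : expR (p ^+ 2 / 4 / lam / (1 + k / lam)) @[lam --> +oo] --> (1 : R).
  have h : p ^+ 2 / 4 / lam / (1 + k / lam) @[lam --> +oo] --> (0 : R).
    rewrite -(mul0r 1^-1); apply: cvgM; first exact: cvg_div_pinfty.
    by apply: cvgV.
  by have := cvg_comp _ _ h (@continuous_expR R 0); rewrite expR0.
have h : expR (p ^+ 2 / 4 / lam / (1 + k / lam)) * (Num.sqrt (1 + k / lam))^-1
    @[lam --> +oo] --> (1 : R).
  by rewrite -[X in _ --> X]mulr1; exact: cvgM h3 h2.
apply: cvg_trans h; apply: near_eq_cvg.
near=> lam.
have lam0 : 0 < lam by near: lam; exact: nbhs_pinfty_gt.
have lamk : 0 < lam + k.
  have : - k < lam by near: lam; apply: nbhs_pinfty_gt; exact: num_real.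
  lra.
have e1 : 1 + k / lam = (lam + k) / lam by field; rewrite gt_eqF.
have sl : 0 < Num.sqrt lam by rewrite sqrtr_gt0.
have sk : 0 < Num.sqrt (lam + k) by rewrite sqrtr_gt0.
rewrite /laplace_weight /laplace_scale e1 sqrtrM ?(ltW lamk)// sqrtrV ?(ltW lam0)//.
rewrite (expRD (p * ln (lam / s) + lam)).
have -> : p ^+ 2 / 4 / lam / ((lam + k) / lam) = p ^+ 2 / (4 * (lam + k)).
  by field; rewrite !gt_eqF.
have w0 := expR_gt0 (p * ln (lam / s) + lam).
have -> : 2 * lam = 2 * (Num.sqrt lam * Num.sqrt lam).
  by rewrite -expr2 sqr_sqrtr// ltW.
by field; rewrite !gt_eqF.
Unshelve. all: by end_near. Qed.

(* Just above a quarter of the peak lam^2 / s^2 of [laplace_exponent]. *)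
Definition laplace_cut (s lam : R) := (Num.truncn (lam ^+ 2 / (4 * s ^+ 2))).+1.

(** Squaring the node halves lam, so the generating function there has size exp(lam/2) up to powers
    of lam. The power of t in the denominator, cut at lam^2 / (4 s^2), costs exp(lam/4 + 1). Against
    exp(lam) in the scale this leaves exp(-lam/4). *)
Lemma laplace_tail_cvg (g s : R) : 0 < s ->
  laguerre_gf g s (laplace_node s lam ^+ 2) / laplace_node s lam ^+ (laplace_cut s lam)
   / laplace_scale s (g + 2^-1) lam @[lam --> +oo] --> (0 : R).
Proof.
move=> s0; set p := g + 2^-1.
pose C := (`|g + 1| + 8 * s ^+ 2).
have s20 : 0 < s ^+ 2 by rewrite exprn_gt0.
have C0 : 0 <= C by rewrite addr_ge0// mulr_ge0// ltW.
have L0 : 0 < laplace_limit g s by rewrite divr_gt0 ?expR_gt0.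
pose D := expR (- (p * ln 2)) * laplace_limit g s * expR C * expR 1.
have h4 : (fun x : R => x / 4) @ +oo --> +oo by apply: gt0_cvgMly.
have hD : D * expR (- (lam / 4)) @[lam --> +oo] --> (0 : R).
  rewrite -(mulr0 D); apply: cvgMr.
  exact: cvg_comp h4 (@cvgr_expR R).
apply: (@squeeze_cvgr _ _ _ _ (cst 0) (fun lam => D * expR (- (lam / 4))));
  [|exact: cvg_cst|exact: hD].
near=> lam.
have lam0 : 0 < lam by near: lam; exact: nbhs_pinfty_gt.
have slam : 4 * s ^+ 2 <= lam by near: lam; apply: nbhs_pinfty_ge; exact: num_real.
have lam20 : 0 < lam / 2 by rewrite divr_gt0.
have slam2 : 2 * s ^+ 2 <= lam / 2 by lra.
have sc := laplace_scale_gt0 s p lam s0 lam0.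
have n0 : 0 < laplace_node s lam by exact: expR_gt0.
have node2 : laplace_node s lam ^+ 2 = laplace_node s (lam / 2).
  rewrite /laplace_node -expRM_natl; congr expR; field; lra.
apply/andP; split; first by rewrite !divr_ge0 ?expR_ge0 ?exprn_ge0// ltW.
have [e he eE] := laguerre_gf_expansion g s (lam / 2) s0 lam20 slam2.
have eC : expR e <= expR C.
  rewrite ler_expR (le_trans (ler_norm _))// (le_trans he)// -/C ler_piMr//.
  by rewrite ler_pdivrMr//; lra.
have cut : (laplace_node s lam ^+ laplace_cut s lam)^-1 <= expR (lam / 4) * expR 1.
  rewrite /laplace_node -expRM_natl -expRN -expRD ler_expR mulrN opprK.
  have : (laplace_cut s lam)%:R <= lam ^+ 2 / (4 * s ^+ 2) + 1 :> R.
    rewrite /laplace_cut -natr1 lerD2r truncn_le.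
    by rewrite divr_ge0 ?sqr_ge0 ?mulr_ge0// ltW.
  rewrite -(ler_pM2r (_ : 0 < s ^+ 2 / lam)) ?divr_gt0// => h; apply: (le_trans h).
  rewrite mulrDl mul1r lerD//.
    by rewrite le_eqVlt; apply/orP; left; apply/eqP; field; rewrite !gt_eqF.
  by rewrite ler_pdivrMr//; lra.
rewrite node2 eE -/p.
have scl : laplace_scale s p (lam / 2) <=
    expR (- (p * ln 2)) * expR (- (lam / 2)) * laplace_scale s p lam.
  rewrite /laplace_scale.
  have -> : p * ln (lam / 2 / s) + lam / 2 =
      - (p * ln 2) + (- (lam / 2) + (p * ln (lam / s) + lam)).
    rewrite !ln_div ?posrE ?divr_gt0//; lra.
  rewrite (expRD (- (p * ln 2))) (expRD (- (lam / 2))) !mulrA ler_pM2r ?invr_gt0//.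
  rewrite ler_pM2l ?mulr_gt0 ?expR_gt0//.
  by rewrite ler_sqrt ?(ltW lam0)//; lra.
rewrite ler_pdivrMr//.
set I := (_ ^+ _)^-1 in cut *.
have I0 : 0 <= I by rewrite invr_ge0 exprn_ge0// ltW.
have sc2 := laplace_scale_gt0 s p (lam / 2) s0 lam20.
apply: (@le_trans _ _ (expR (- (p * ln 2)) * expR (- (lam / 2)) * laplace_scale s p lam *
   laplace_limit g s * expR C * (expR (lam / 4) * expR 1))).
  have P0 : 0 <= laplace_scale s p (lam / 2) * laplace_limit g s.
    by rewrite mulr_ge0// ltW.
  apply: ler_pM => //; first by rewrite mulr_ge0 ?expR_ge0.
  apply: ler_pM; [exact: P0|exact: expR_ge0| |exact: eC].
  by rewrite ler_wpM2r// ltW.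
have e4 : expR (- (lam / 4)) = expR (- (lam / 2)) * expR (lam / 4).
  by rewrite -expRD; congr expR; lra.
by rewrite /D e4 le_eqVlt; apply/orP; left; apply/eqP; ring.
Unshelve. all: by end_near. Qed.

Lemma laplace_cut_ge (s lam : R) : lam ^+ 2 / (4 * s ^+ 2) <= (laplace_cut s lam)%:R.
Proof. by rewrite ltW// truncnS_gt. Qed.

(** At the cut s sqrt x / lam is about 1/2, at most 3/4 after rounding, and p / (2 mu) is at least
    -1/8. The bracket in [laplace_arg] is thus at most -1/8, and sqrt mu >= 8 |Y|. *)
Lemma laplace_cut_arg (s p lam Y : R) : 0 < s -> 2 * s <= lam -> 4 * `|p| <= lam ->
  (8 * Y) ^+ 2 <= lam ->
  laplace_arg s p lam (lam + 2 * `|p|) (laplace_cut s lam)%:R <= - Y.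
Proof.
move=> s0 slam plam Ylam; have lam0 : 0 < lam by lra.
have p0 : 0 <= `|p| by [].
have p1 : - `|p| <= p by rewrite lerNl -normrN ler_norm.
set mu := lam + 2 * `|p|.
have mu0 : 0 < mu by rewrite /mu; lra.
have h1 : s * Num.sqrt (laplace_cut s lam)%:R / lam <= 3 / 4.
  have : Num.sqrt (laplace_cut s lam)%:R <= 3 / 4 * (lam / s).
    have q0 : 0 <= 3 / 4 * (lam / s) by rewrite mulr_ge0 ?divr_ge0 ?ltW.
    rewrite -ler_sqr ?nnegrE ?sqrtr_ge0// sqr_sqrtr//.
    apply: (@le_trans _ _ (lam ^+ 2 / (4 * s ^+ 2) + 1)).
      rewrite /laplace_cut -natr1 lerD2r truncn_le.
      by rewrite divr_ge0 ?sqr_ge0// mulr_ge0// sqr_ge0.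
    have : 2 * s / s <= lam / s by rewrite ler_pM2r ?invr_gt0.
    rewrite mulfK ?gt_eqF// => l2.
    have -> : lam ^+ 2 / (4 * s ^+ 2) = (lam / s) ^+ 2 / 4 by field; rewrite gt_eqF.
    have : 2 ^+ 2 <= (lam / s) ^+ 2 by rewrite ler_sqr ?nnegrE// ltW// divr_gt0.
    rewrite exprMn; lra.
  rewrite -(ler_pM2l s0) => h; rewrite ler_pdivrMr//; apply: (le_trans h).
  by rewrite le_eqVlt; apply/orP; left; apply/eqP; field; rewrite gt_eqF.
have h2 : - 8^-1 <= p / (2 * mu).
  rewrite ler_pdivlMr ?mulr_gt0// /mu; lra.
have h3 : 8 * `|Y| <= Num.sqrt mu.
  rewrite -(@ger0_norm _ (8 * `|Y|)) ?mulr_ge0// -sqrtr_sqr ler_sqrt ?(ltW mu0)//.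
  rewrite exprMn real_normK ?num_real// -exprMn (le_trans Ylam)// /mu; lra.
have m0 : 0 <= Num.sqrt mu by exact: sqrtr_ge0.
apply: (@le_trans _ _ (Num.sqrt mu * - 8^-1)).
  by rewrite /laplace_arg ler_wpM2l//; lra.
have := ler_norm Y; lra.
Qed.

(** Both bounds are divided by [laplace_scale] and lam tends to infinity with [delta] and [eta]
    fixed; these are sent to zero only afterwards. *)
Lemma abelian_constant (a : nat -> R) (g s kap : R) : 0 < s -> 0 < kap ->
  (forall n, 0 <= a n) ->
  a n / stretched_exp ((g + 2^-1 - 1) / 2) s n%:R @[n --> \oo] --> kap ->
  (forall t, 0 < t < 1 ->
    \sum_(0 <= k < n.+1) a k * t ^+ k @[n --> \oo] --> laguerre_gf g s t) ->
  kap * Num.sqrt pi = laplace_limit g s.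
Proof.
move=> s0 kap0 a0 ac cG; set p := g + 2^-1.
have [F [dF cF]] := @gauss_primitive R.
have [Fub Flb] := gauss_primitive_bounds F dF cF.
have sp0 : 0 < Num.sqrt pi :> R by rewrite sqrtr_gt0 pi_gt0.
have Gcvg := laguerre_gf_scale_cvg g s s0.
have up (delta : R) : 0 < delta -> delta <= kap ->
    laplace_limit g s <= (kap + delta) * Num.sqrt pi.
  move=> d0 dk; have kd : 0 <= kap - delta by rewrite subr_ge0.
  have [N hN] := stretched_exp_interpolation a ((p - 1) / 2) s kap s0 a0 ac delta d0.
  have h : laguerre_gf g s (laplace_node s lam ^+ 2) / laplace_node s lam ^+ (laplace_cut s lam)
      / laplace_scale s p lam + (kap + delta) * Num.sqrt pi * (expR (s ^+ 2 / lam) *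
     (laplace_weight s p lam (lam + - (2 * `|p|)) / laplace_scale s p lam))
     @[lam --> +oo] --> 0 + (kap + delta) * Num.sqrt pi * (1 * 1).
    apply: cvgD; first exact: laplace_tail_cvg.
    apply: cvgMr; apply: cvgM; first exact: cvg_expR_div_pinfty.
    exact: laplace_weight_scale_cvg.
  rewrite add0r !mulr1 in h.
  apply: (ler_cvg_to Gcvg h); near=> lam.
  have lam0 : 0 < lam by near: lam; exact: nbhs_pinfty_gt.
  have plam : 2 * `|p| < lam by near: lam; apply: nbhs_pinfty_gt; exact: num_real.
  have nlam : 1 + 4 * s ^+ 2 * N%:R <= lam.
    by near: lam; apply: nbhs_pinfty_ge; exact: num_real.
  have Ncut : (N <= laplace_cut s lam)%N.
    rewrite -(ler_nat R); apply: le_trans (laplace_cut_ge s lam).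
    rewrite ler_pdivlMr ?mulr_gt0 ?exprn_gt0// mulrC.
    have s4 : 0 <= 4 * s ^+ 2 * N%:R by rewrite mulr_ge0// mulr_ge0// sqr_ge0.
    have : lam <= lam ^+ 2 by rewrite expr2 ler_peMr ?(ltW lam0)//; lra.
    lra.
  have := abelian_upper F a p s kap delta N dF s0 a0 kd (ltW d0) hN
    (laguerre_gf g s) cG lam _ Fub plam Ncut (laplace_cut_ge s lam).
  rewrite /= => hu.
  have sc := laplace_scale_gt0 s p lam s0 lam0.
  rewrite -/p ler_pdivrMr//; apply: (le_trans hu).
  rewrite le_eqVlt; apply/orP; left; apply/eqP.
  rewrite [RHS]mulrDl divfK ?gt_eqF//; congr (_ + _).
  by field; rewrite gt_eqF.
have lo (delta eta : R) : 0 < delta -> delta <= kap -> 0 < eta ->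
    (kap - delta) * (Num.sqrt pi - eta) <= laplace_limit g s.
  move=> d0 dk e0; have kd : 0 <= kap - delta by rewrite subr_ge0.
  have [N hN] := stretched_exp_interpolation a ((p - 1) / 2) s kap s0 a0 ac delta d0.
  have [Y hY] := Flb eta e0.
  have h : (kap - delta) * (Num.sqrt pi - eta) *
     (laplace_weight s p lam (lam + 2 * `|p|) / laplace_scale s p lam)
     @[lam --> +oo] --> (kap - delta) * (Num.sqrt pi - eta) * 1.
    by apply: cvgMr; exact: laplace_weight_scale_cvg.
  rewrite mulr1 in h.
  apply: (ler_cvg_to h Gcvg); near=> lam.
  have lam0 : 0 < lam by near: lam; exact: nbhs_pinfty_gt.
  have plam : 4 * `|p| < lam by near: lam; apply: nbhs_pinfty_gt; exact: num_real.
  have p0 : 0 <= `|p| by [].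
  have plam2 : 2 * `|p| < lam by lra.
  have slam : 2 * s <= lam by near: lam; apply: nbhs_pinfty_ge; exact: num_real.
  have Ylam : (8 * Y) ^+ 2 <= lam by near: lam; apply: nbhs_pinfty_ge; exact: num_real.
  have nlam : 1 + 4 * s ^+ 2 * N%:R <= lam.
    by near: lam; apply: nbhs_pinfty_ge; exact: num_real.
  have Ncut : (N <= laplace_cut s lam)%N.
    rewrite -(ler_nat R); apply: le_trans (laplace_cut_ge s lam).
    rewrite ler_pdivlMr ?mulr_gt0 ?exprn_gt0// mulrC.
    have s4 : 0 <= 4 * s ^+ 2 * N%:R by rewrite mulr_ge0// mulr_ge0// sqr_ge0.
    have : lam <= lam ^+ 2 by rewrite expr2 ler_peMr ?(ltW lam0)//; lra.
    lra.
  have hl := abelian_lower F a p s kap delta N dF s0 a0 kd (ltW d0) hN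
    (laguerre_gf g s) cG lam eta Y _ hY plam2 Ncut (laplace_cut_ge s lam)
    (laplace_cut_arg s p lam Y s0 slam (ltW plam) Ylam).
  have sc := laplace_scale_gt0 s p lam s0 lam0.
  rewrite -/p ler_pdivlMr//; apply: le_trans hl.
  rewrite le_eqVlt; apply/orP; left; apply/eqP.
  by field; rewrite gt_eqF.
have X0 : 0 < kap * Num.sqrt pi by rewrite mulr_gt0.
apply/eqP; rewrite eq_le; apply/andP; split; apply/ler_addgt0Pr => e e0.
  (* Both tolerances are taken relative, so the lower bound is (1-r)^2 >= 1 - 2r times kap sqrt pi;
     hence the factor 2. *)
  pose r := Num.min 1 (e / (2 * (kap * Num.sqrt pi))).
  have r0 : 0 < r by rewrite lt_min ltr01 divr_gt0// mulr_gt0.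
  have r1 : r <= 1 by rewrite ge_min lexx.
  have r2 : r * (2 * (kap * Num.sqrt pi)) <= e.
    by rewrite -ler_pdivlMr ?mulr_gt0// ge_min lexx orbT.
  have := lo (kap * r) (Num.sqrt pi * r) (mulr_gt0 kap0 r0) (_ : _ <= _) (mulr_gt0 sp0 r0).
  rewrite ler_piMr ?(ltW kap0)// => /(_ isT).
  have : 0 <= kap * Num.sqrt pi * r ^+ 2 by rewrite mulr_ge0 ?sqr_ge0 ?ltW.
  lra.
pose r := Num.min 1 (e / (kap * Num.sqrt pi)).
have r0 : 0 < r by rewrite lt_min ltr01 divr_gt0.
have r1 : r <= 1 by rewrite ge_min lexx.
have r2 : r * (kap * Num.sqrt pi) <= e.
  by rewrite -ler_pdivlMr// ge_min lexx orbT.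
have rk : kap * r <= kap by rewrite ler_piMr// ltW.
have := up (kap * r) (mulr_gt0 kap0 r0) rk; lra.
Unshelve. all: by end_near. Qed.

End abelian_constant.

(** The algebra of omega_(n+1) with e = (-1)^n, x = a_n, A = a_(n+1), H = h_n^(1/2), Y = sqrt (n+1)
    and G = sqrt (n+1+gamma). Consecutive P_n(0) have opposite signs, which absorbs the minus
    sign. *)
Lemma sign_product_cancel {R : fieldType} (e v A x H G Y : R) : e * e = 1 ->
  A != 0 -> x != 0 -> H != 0 -> G != 0 -> Y != 0 ->
  - (v * (A ^+ 2 / (G ^+ 2 / Y ^+ 2 * H ^+ 2)) /
     (Y * G * (e * (x / H)) * (- e * (A / (G / Y * H))))) = v * (A / (x * G ^+ 2)).
Proof.
move=> ee A0 x0 H0 G0 Y0.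
have -> : Y * G * (e * (x / H)) * (- e * (A / (G / Y * H))) =
  - (e * e) * (Y * G * (x / H) * (A / (G / Y * H))) by ring.
by rewrite ee; field; rewrite G0 x0 Y0 H0 A0 oppr_eq0 oner_neq0.
Qed.

(** * The reproducing kernel at the origin *)

#[local] Opaque Pn laguerre_val laguerre_norm2 Gamma.

Section kernel_asymptotics.
Context {R : realType}.
Variables gamma alpha : R.
Hypothesis gamma_gtN1 : -1 < gamma.
Hypothesis alpha_gt0 : 0 < alpha.

Let s := Num.sqrt alpha.
Let a n := laguerre_val gamma alpha n.
Let b n := laguerre_val (gamma + 1) alpha n.
Let h n := laguerre_norm2 gamma n.
Let T n := b n / a n.
Let p n := a n ^+ 2 / h n.
Let S n := \sum_(0 <= k < n) p k.

Let s_gt0 : 0 < s. Proof. by rewrite sqrtr_gt0. Qed.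
Let s_sqr : s ^+ 2 = alpha. Proof. by rewrite sqr_sqrtr// ltW. Qed.
Let a_gt0 n : 0 < a n. Proof. exact: laguerre_val_gt0. Qed.
Let b_gt0 n : 0 < b n.
Proof. by apply: laguerre_val_gt0 => //; move: gamma_gtN1; lra. Qed.
Let h_gt0 n : 0 < h n. Proof. exact: laguerre_norm2_gt0. Qed.
Let T_gt0 n : 0 < T n. Proof. exact: divr_gt0 (b_gt0 n) (a_gt0 n). Qed.
Let p_gt0 n : 0 < p n.
Proof. exact: divr_gt0 (exprn_gt0 2 (a_gt0 n)) (h_gt0 n). Qed.

Let natg_gt0 n : 0 < n.+1%:R + gamma.
Proof. by rewrite -natr1; have : 0 <= n%:R :> R by []; move: gamma_gtN1; lra. Qed.

Let aS n : a n.+1 = a n * (1 + (gamma + s ^+ 2 * T n) / n.+1%:R).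
Proof.
have n0 : n.+1%:R != 0 :> R by rewrite pnatr_eq0.
have := laguerre_val_step gamma alpha n gamma_gtN1.
rewrite -/(a n) -/(a n.+1) -/(b n) s_sqr /T => e.
apply: (mulfI n0); rewrite e; have := a_gt0 n; move: n0.
by move: (n.+1%:R : R) (a n) (b n) => N x y n0 x0; field; rewrite n0 gt_eqF.
Qed.

Let hS n : h n.+1 = (1 + gamma / n.+1%:R) * h n.
Proof.
rewrite /h laguerre_norm2S//; congr (_ * _).
by rewrite mulrDl divff// pnatr_eq0.
Qed.

Let growth_gt0 n : 0 < 1 + (gamma + s ^+ 2 * T n) / n.+1%:R.
Proof. by have := a_gt0 n.+1; rewrite aS pmulr_rgt0. Qed.

Let norm_growth_gt0 n : 0 < 1 + gamma / n.+1%:R.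
Proof. by have := h_gt0 n.+1; rewrite hS pmulr_lgt0. Qed.

Let TS n : T n.+1 = 1 + n.+1%:R * T n / (n.+1%:R + gamma + s ^+ 2 * T n).
Proof.
have n0 : 0 < n.+1%:R :> R by rewrite ltr0n.
have T0 := T_gt0 n.
have d0 : 0 < n.+1%:R + gamma + s ^+ 2 * T n.
  by rewrite addr_gt0 ?natg_gt0// mulr_gt0// exprn_gt0.
have bT : b n = T n * a n := esym (divfK (lt0r_neq0 (a_gt0 n)) (b n)).
rewrite {1}/T /b laguerre_val_cumul// -/(b n) -/(a n.+1) bT mulrDl divff ?gt_eqF//.
rewrite addrC aS; congr (_ + _).
have a0 := a_gt0 n.
move: (n.+1%:R : R) (a n) (T n) n0 a0 T0 d0 => N x t n0 x0 t0 d0.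
have e : 1 + (gamma + s ^+ 2 * t) / N = (N + gamma + s ^+ 2 * t) / N.
  by field; rewrite gt_eqF.
by rewrite e; field; rewrite !gt_eqF.
Qed.

Let pS n : p n.+1 = p n * ((1 + (gamma + s ^+ 2 * T n) / n.+1%:R) ^+ 2 / (1 + gamma / n.+1%:R)).
Proof.
rewrite /p aS hS.
have := h_gt0 n; have := norm_growth_gt0 n.
set y := 1 + gamma / _; set z := 1 + _ / _; move: y z (h n) (a n) => y z x w y0 x0.
by field; rewrite !gt_eqF.
Qed.

Let log_p_step n : ln (p n.+1) = ln (p n) +
  2 * ln (1 + (gamma + s ^+ 2 * T n) / n.+1%:R) - ln (1 + gamma / n.+1%:R).
Proof.
have g0 := growth_gt0 n; have g1 := norm_growth_gt0 n; have p0 := p_gt0 n.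
rewrite pS lnM ?posrE// ?divr_gt0 ?exprn_gt0//.
rewrite ln_div ?posrE ?exprn_gt0// lnXn// mulr_natl; ring.
Qed.

Let V n := S n / p n.

Let VS n : V n.+1 = (V n + 1) * ((1 + gamma / n.+1%:R) /
     (1 + (gamma + s ^+ 2 * T n) / n.+1%:R) ^+ 2).
Proof.
rewrite /V /S big_nat_recr//= -/(S n) pS.
have := growth_gt0 n; have := norm_growth_gt0 n; have := p_gt0 n.
set y := 1 + gamma / _; set z := 1 + _ / _.
move: y z (p n) (S n) => y z x w x0 y0 z0.
by field; rewrite !gt_eqF.
Qed.

Let log_const : exists D K N, forall n, (N <= n)%N ->
  Num.sqrt n%:R * `|ln (p n) - (4 * s * Num.sqrt n%:R - ln n%:R / 2) - D| <= K.
Proof. exact: (log_asymptotics s gamma T (fun n => ln (p n)) s_gt0 T_gt0 TS log_p_step). Qed.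

Let three_term n : n.+2%:R * a n.+2 = (2 * n%:R + 3 + gamma + s ^+ 2) * a n.+1
     - (n%:R + 1 + gamma) * a n.
Proof.
have e1 := laguerre_val_step gamma alpha n gamma_gtN1.
have e2 := laguerre_val_step gamma alpha n.+1 gamma_gtN1.
rewrite laguerre_val_cumul// -/(a n) -/(a n.+1) -/(a n.+2) -/(b n) mulrDr in e1 e2.
rewrite s_sqr.
rewrite -!natr1 in e1 e2 *.
by move: (a n.+2) (a n.+1) (a n) (b n) e1 e2 => x y z w e1 e2; lra.
Qed.

(** The power of n in a_n, namely gamma/2 from h_n^(1/2) and -1/4 from P_n(0), written as (p-1)/2 to
    match [laplace_exponent]. *)
Let q := (gamma + 2^-1 - 1) / 2.

Let a_cvg (D : R) (K : R) (N : nat) :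
  (forall n, (N <= n)%N ->
  Num.sqrt n%:R * `|ln (p n) - (4 * s * Num.sqrt n%:R - ln n%:R / 2) - D| <= K) ->
  a n / stretched_exp q s n%:R @[n --> \oo] -->
    Num.sqrt (expR D * (Gamma (gamma + 1))^-1).
Proof.
move=> hD.
pose u n := ln (p n) - (4 * s * Num.sqrt n%:R - ln n%:R / 2).
have uD : u n @[n --> \oo] --> D.
  have e0 c : D + c * (Num.sqrt n%:R)^-1 @[n --> \oo] --> (D : R).
    rewrite -[X in _ --> X]addr0; apply: cvgD; first exact: cvg_cst.
    by rewrite -(mulr0 c); apply: cvgMr; exact: cvg_inv_sqrt_nat.
  apply: (@squeeze_cvgr _ _ _ _ (fun n : nat => D + - K * (Num.sqrt n%:R)^-1)
    (fun n : nat => D + K * (Num.sqrt n%:R)^-1)); [|exact: e0|exact: e0].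
  exists N.+1 => // n /= nN.
  have y0 : 0 < Num.sqrt n%:R :> R by rewrite sqrtr_gt0 ltr0n (leq_trans _ nN).
  have := hD n (ltnW nN); rewrite mulrC -ler_pdivlMr// -/(u n) ler_norml => /andP[? ?].
  by apply/andP; split; lra.
have eD := cvg_comp _ _ uD (@continuous_expR R D).
have c2 : expR (u n) * (laguerre_norm2 gamma n / n%:R `^ gamma) @[n --> \oo] -->
    expR D * (Gamma (gamma + 1))^-1.
  by apply: cvgM => //; exact: laguerre_norm2_cvg.
have c3 : Num.sqrt (expR (u n) * (laguerre_norm2 gamma n / n%:R `^ gamma)) @[n --> \oo] -->
    Num.sqrt (expR D * (Gamma (gamma + 1))^-1).
  exact: cvg_comp c2 (@sqrt_continuous R _).
apply: cvg_trans c3; apply: near_eq_cvg; exists 1%N => // n /= n0.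
have N0 : 0 < n%:R :> R by rewrite ltr0n.
have a0 := a_gt0 n; have h0 := h_gt0 n; have p0 := p_gt0 n.
have st0 : 0 < stretched_exp q s n%:R by exact: expR_gt0.
rewrite -[RHS]ger0_norm ?divr_ge0 ?(ltW a0) ?(ltW st0)// -sqrtr_sqr; congr Num.sqrt.
rewrite expr_div_n.
have -> : a n ^+ 2 = p n * h n by rewrite /p divfK// gt_eqF.
rewrite /u expRB lnK ?posrE// -/(h n) /powR gt_eqF//.
have -> : stretched_exp q s n%:R ^+ 2 =
    expR (4 * s * Num.sqrt n%:R - ln n%:R / 2) * expR (gamma * ln n%:R).
  by rewrite /stretched_exp -expRM_natl -expRD /q; congr expR; field.
have w1 := expR_gt0 (4 * s * Num.sqrt n%:R - ln n%:R / 2).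
have w2 := expR_gt0 (gamma * ln n%:R).
by field; rewrite !gt_eqF.
Qed.

(** The crude bound required by [laguerre_generating_function]. The power of n is absorbed by ln n =
    2 ln (sqrt n) <= 2 sqrt n, whence A = 2 |q| + 2 s. *)
Let a_growth (kap : R) :
  a n / stretched_exp q s n%:R @[n --> \oo] --> kap ->
  exists A K, forall n, `|a n| <= K * expR (A * Num.sqrt n%:R).
Proof.
move=> c; have /cvg_seq_bounded [M [_ hM]] := cvgP _ c.
pose K := `|M| + 1.
have K0 : 0 <= K by rewrite addr_ge0.
exists (2 * `|q| + 2 * s), (K + 1); case=> [|n].
  rewrite sqrtr0 mulr0 expR0 mulr1 /a laguerre_val0// normr1.
  by rewrite lerDr.
have := hM K; rewrite /K (le_lt_trans (ler_norm M)) ?ltrDl// => /(_ isT n.+1 I) /=.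
have st0 : 0 < stretched_exp q s n.+1%:R by exact: expR_gt0.
rewrite normrM normfV (gtr0_norm st0) ler_pdivrMr// -/K => h1.
apply: (le_trans h1); apply: (@le_trans _ _ (K * expR ((2 * `|q| + 2 * s) * Num.sqrt n.+1%:R))).
  rewrite ler_wpM2l// ler_expR [leRHS]mulrDl lerD2r.
  have N0 : 0 < n.+1%:R :> R by rewrite ltr0n.
  have y0 : 0 < Num.sqrt n.+1%:R :> R by rewrite sqrtr_gt0.
  have lnE : ln n.+1%:R = 2 * ln (Num.sqrt n.+1%:R) :> R.
    by rewrite -{1}(sqr_sqrtr (ltW N0)) lnXn// mulr_natl.
  have l1 : ln (Num.sqrt n.+1%:R) <= Num.sqrt n.+1%:R :> R by rewrite ltW// ln_sublinear.
  have l0 : 0 <= ln (Num.sqrt n.+1%:R) :> R.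
    by apply: ln_ge0; rewrite -{1}sqrtr1 ler_sqrt ?ler1n.
  apply: (@le_trans _ _ (`|q| * ln n.+1%:R)).
    by rewrite ler_wpM2r ?ler_norm// lnE mulr_ge0.
  by rewrite lnE mulrCA -mulrA ler_pM2l// ler_wpM2l.
by rewrite ler_wpM2r ?expR_ge0// lerDl.
Qed.

(** The Abelian identity for kap = (e^D / Gamma(gamma+1))^(1/2), solved for D by taking logarithms.
    The term -ln (2 s) belongs to the sum quotient, which is about sqrt n / (2 s). *)
Let constant_value (D K : R) (N : nat) :
  (forall n, (N <= n)%N ->
  Num.sqrt n%:R * `|ln (p n) - (4 * s * Num.sqrt n%:R - ln n%:R / 2) - D| <= K) ->
  D - ln (2 * s) =
  ln (Gamma (gamma + 1) / (8 * pi * alpha `^ (gamma + 1) * expR alpha)).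
Proof.
move=> hD; have c := a_cvg D K N hD.
have G0 : 0 < Gamma (gamma + 1) by apply: Gamma_gt0; move: gamma_gtN1; lra.
set kap := Num.sqrt _ in c.
have e0 : 0 < expR D * (Gamma (gamma + 1))^-1 by rewrite mulr_gt0 ?expR_gt0 ?invr_gt0.
have kap0 : 0 < kap by rewrite sqrtr_gt0.
have [A [B hAB]] := a_growth kap c.
have gf t : 0 < t < 1 -> \sum_(0 <= k < n.+1) a k * t ^+ k @[n --> \oo] -->
    laguerre_gf gamma s t.
  have rec := three_term.
  move=> t01; apply: (laguerre_generating_function a gamma (s ^+ 2) A B t) => //.
  - exact: laguerre_val0.
  - have a00 : a 0%N = 1 by exact: laguerre_val0.
    have b00 : b 0%N = 1 by apply: laguerre_val0; move: gamma_gtN1; lra.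
    by rewrite aS /T a00 b00 !divr1 !mul1r mulr1 addrA.
  - exact: sqr_ge0.
have := abelian_constant a gamma s kap s_gt0 kap0 (fun n => ltW (a_gt0 n)) c gf.
have sp : 0 < Num.sqrt pi :> R by rewrite sqrtr_gt0 pi_gt0.
move/(congr1 (@ln R)); rewrite lnM ?posrE// /laplace_limit ln_div ?posrE ?expR_gt0//.
rewrite expRK.
have lns (x : R) : 0 < x -> ln (Num.sqrt x) = ln x / 2.
  by move=> x0; rewrite -{2}(sqr_sqrtr (ltW x0)) lnXn ?sqrtr_gt0// -mulr_natl; field.
rewrite /kap (lns _ e0) (lns _ (pi_gt0 R)) lnM ?posrE ?expR_gt0 ?invr_gt0//.
rewrite expRK lnV ?posrE// s_sqr /s (lns _ alpha_gt0) => e.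
have sa0 : 0 < Num.sqrt alpha by rewrite sqrtr_gt0.
have pia : 0 < 8 * pi * alpha `^ (gamma + 1) * expR alpha.
  by rewrite !mulr_gt0 ?expR_gt0 ?powR_gt0 ?pi_gt0.
have l8 : ln 8 = 3 * ln 2 :> R.
  by rewrite (_ : 8 = 2 ^+ 3) ?lnXn ?mulr_natl//; ring.
rewrite ln_div ?posrE// !lnM ?posrE ?mulr_gt0 ?expR_gt0 ?powR_gt0 ?pi_gt0//.
rewrite expRK ln_powR (lns _ alpha_gt0) l8; lra.
Qed.

Let sumE n : \sum_(0 <= k < n) (Pn gamma alpha k).[0] ^+ 2 = S n.
Proof. by apply: eq_bigr => k _; exact: Pn0_sqr. Qed.

Let V_bound : exists K N, forall n, (N <= n)%N -> `|V n - Num.sqrt n%:R / (2 * s)| <= K.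
Proof. exact: sum_ratio_asymptotics s_gt0 gamma_gtN1 T_gt0 TS VS. Qed.

Let sqrt_gt0 n : 0 < Num.sqrt n.+1%:R :> R. Proof. by rewrite sqrtr_gt0 ltr0n. Qed.

Let S_gt0 n : 0 < S n.+1.
Proof.
rewrite /S big_nat_recr//=; apply: ltr_wpDl; last exact: p_gt0.
by apply: sumr_ge0 => k _; rewrite ltW.
Qed.

Let V_gt0 n : 0 < V n.+1. Proof. exact: divr_gt0 (S_gt0 n) (p_gt0 n.+1). Qed.

Lemma xn_asymptotics : exists K N, forall n, (N <= n)%N ->
  `|xn gamma alpha n - (4 * Num.sqrt (alpha * n%:R)
        + ln (Gamma (gamma + 1) / (8 * pi * alpha `^ (gamma + 1) * expR alpha)))|
    <= K / Num.sqrt n%:R.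
Proof.
have [D [K1 [N1 hD]]] := log_const.
have [K2 [N2 hV]] := V_bound.
have [N3 hN3] := sqrt_nat_ge (4 * s * `|K2|).
exists (K1 + 4 * s * `|K2|), (N1 + N2 + N3).+1; case=> // n nN.
have nN' : (N1 + N2 + N3 <= n)%N := nN.
have nN1 : (N1 <= n.+1)%N by apply/leqW/(leq_trans _ nN'); rewrite -addnA leq_addr.
have nN2 : (N2 <= n.+1)%N by apply/leqW/(leq_trans _ nN'); rewrite addnAC leq_addl.
have nN3 : (N3 <= n.+1)%N by apply/leqW/(leq_trans _ nN'); rewrite leq_addl.
rewrite -(constant_value D K1 N1 hD).
have y0 := sqrt_gt0 n; have p0 := p_gt0 n.+1; have V0 := V_gt0 n.
have n0 : 0 < n.+1%:R :> R by [].
have e1 := hD _ nN1; have e2 := hV _ nN2; have e3 := hN3 _ nN3.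
rewrite /xn sumE (_ : S n.+1 = V n.+1 * p n.+1); last by rewrite /V divfK// gt_eqF.
rewrite lnM ?posrE// sqrtrM ?(ltW alpha_gt0)// -/s.
have lnn : ln n.+1%:R = 2 * ln (Num.sqrt n.+1%:R) :> R.
  by rewrite -{1}(sqr_sqrtr (ltW n0)) lnXn// mulr_natl.
have s20 : 0 < 2 * s by rewrite mulr_gt0.
(* The relative error of V. The part ln (sqrt n) of ln V cancels -(ln n)/2 in ln p, and the
   threshold 4 s |K2| keeps |w| <= 1/2. *)
pose w := V n.+1 * (2 * s) / Num.sqrt n.+1%:R - 1.
have lnw : ln (1 + w) = ln (V n.+1) + ln (2 * s) - ln (Num.sqrt n.+1%:R).
  rewrite /w [1 + _]addrC subrK ln_div ?posrE ?(mulr_gt0 V0 s20)//.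
  by rewrite lnM ?posrE.
move: lnw e1 e2 e3 y0; rewrite lnn.
move: (ln (V n.+1)) (ln (p n.+1)) (ln (2 * s)) (ln (Num.sqrt _)) => lV lp ls ly.
rewrite /w; move: (V n.+1) (Num.sqrt n.+1%:R) => v y lnw e1 e2 e3 y0.
have s0 := s_gt0; have K20 : 0 <= `|K2| by [].
have sK : 0 <= s * `|K2| by rewrite mulr_ge0// ltW.
have wE : `|v * (2 * s) / y - 1| <= 2 * s * `|K2| / y.
  rewrite (_ : _ - 1 = 2 * s / y * (v - y / (2 * s))); last first.
    by field; rewrite !gt_eqF.
  rewrite normrM gtr0_norm ?divr_gt0// [leRHS]mulrAC ler_pM2l ?divr_gt0//.
  exact: le_trans e2 (ler_norm _).
have wy : 2 * s * `|K2| / y <= 2^-1.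
  by rewrite ler_pdivrMr//; lra.
set z := v * (2 * s) / y - 1 in lnw wE.
have z2 : - 2^-1 <= z.
  by move: wE; rewrite ler_norml => /andP[+ _]; lra.
have lz : `|ln (1 + z)| <= 2 * (2 * s * `|K2| / y).
  have h1 := ln1p_order1 _ z2.
  have h2 : 2 * z ^+ 2 <= `|z|.
    rewrite -real_normK ?num_real// expr2 mulrA ler_piMl//; lra.
  have := ler_normD (ln (1 + z) - z) z; rewrite subrK; lra.
have e1' : `|lp - (4 * s * y - 2 * ly / 2) - D| <= K1 / y.
  by rewrite ler_pdivlMr// mulrC.
have -> : lV + lp - (4 * (s * y) + (D - ls)) =
  (lp - (4 * s * y - 2 * ly / 2) - D) + ln (1 + z) by rewrite lnw; field.
apply: (le_trans (ler_normD _ _)); rewrite [leRHS]mulrDl; apply: lerD => //.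
apply: (le_trans lz); rewrite le_eqVlt; apply/orP; left; apply/eqP; ring.
Qed.

Let PnE n : (Pn gamma alpha n).[0] = (-1) ^+ n * (a n / Num.sqrt (h n)).
Proof. exact: Pn0. Qed.

(** Isolates V / (n+1) as main part; since T_n = O(sqrt n), the bracket is 1 + O(n^(-1/2)). *)
Let omegaE n : omegan gamma alpha n.+1 =
  V n.+1 * (1 + s ^+ 2 * T n / (n.+1%:R + gamma)) / n.+1%:R.
Proof.
have -> : omegan gamma alpha n.+1 = - (S n.+1 /
    (bn gamma n * ((-1) ^+ n * (a n / Num.sqrt (h n))) *
      ((-1) ^+ n.+1 * (a n.+1 / Num.sqrt (h n.+1))))).
  rewrite /omegan; congr (- (_ / (_ * _ * _))); [exact: sumE|exact: PnE|exact: PnE].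
rewrite /bn.
have n0 : 0 < n.+1%:R :> R by [].
have ng := natg_gt0 n.
have -> : (n%:R + 1) * (n%:R + gamma + 1) = n.+1%:R * (n.+1%:R + gamma) :> R.
  by rewrite -natr1; ring.
have VE : S n.+1 = V n.+1 * (a n.+1 ^+ 2 / h n.+1).
  by rewrite /V -/(p n.+1) divfK// gt_eqF.
rewrite VE.
have hE : h n.+1 = (n.+1%:R + gamma) / n.+1%:R * h n by exact: laguerre_norm2S.
have hs : Num.sqrt (h n.+1) = Num.sqrt (n.+1%:R + gamma) / Num.sqrt n.+1%:R * Num.sqrt (h n).
  by rewrite hE sqrtrM ?divr_ge0 ?(ltW ng)// sqrtrM ?(ltW ng)// sqrtrV.
rewrite hs hE (sqrtrM _ (ltW n0)).
have sh : h n = Num.sqrt (h n) ^+ 2 by rewrite sqr_sqrtr// ltW.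
have sn : n.+1%:R = Num.sqrt n.+1%:R ^+ 2 :> R by rewrite sqr_sqrtr.
have sg : n.+1%:R + gamma = Num.sqrt (n.+1%:R + gamma) ^+ 2 by rewrite sqr_sqrtr// ltW.
have h0 : 0 < Num.sqrt (h n) by rewrite sqrtr_gt0.
have y0 := sqrt_gt0 n.
have g0 : 0 < Num.sqrt (n.+1%:R + gamma) by rewrite sqrtr_gt0.
have a0 := a_gt0 n; have a1 := a_gt0 n.+1.
have aE : a n.+1 = a n * ((n.+1%:R + gamma) / n.+1%:R) *
    (1 + s ^+ 2 * T n / (n.+1%:R + gamma)).
  rewrite aS; move: (n.+1%:R : R) (T n) (a n) n0 ng => N t x n0 ng.
  by field; rewrite !gt_eqF.
have -> : (-1) ^+ n.+1 = - (-1) ^+ n :> R by rewrite exprS mulN1r.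
have sgn : (-1) ^+ n * (-1) ^+ n = 1 :> R by rewrite -expr2 sqrr_sign.
set A1 := a n.+1 in aE a1 *; set v := V n.+1; set c := 1 + _ / _ in aE *.
have key : A1 / (a n * (n.+1%:R + gamma)) = c / n.+1%:R.
  rewrite aE; clearbody c; move: (n.+1%:R : R) (a n) n0 ng a0 => N x n0 ng x0.
  by field; rewrite !gt_eqF.
rewrite -[RHS]mulrA -key.
have := @sign_product_cancel R _ v A1 (a n) _ _ _ sgn (lt0r_neq0 a1) (lt0r_neq0 a0)
  (lt0r_neq0 h0) (lt0r_neq0 g0) (lt0r_neq0 y0).
by rewrite -sh -sn -sg.
Qed.

Lemma omegan_asymptotics : exists K N, forall n, (N <= n)%N ->
  `|omegan gamma alpha n - (2 * Num.sqrt (alpha * n%:R))^-1| <= K / n%:R.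
Proof.
have [K1 [N1 hT]] := ratio_asymptotics s gamma T s_gt0 T_gt0 TS.
have [K2 [N2 hV]] := V_bound.
set c := ratio_shift s gamma in hT.
pose C1 := s^-1 + `|c| + `|K1|.
pose C2 := (2 * s)^-1 + `|K2|.
exists (`|K2| + 2 * (C2 * s ^+ 2 * C1)), (N1 + N2 + 1).+1; case=> // n nN.
have nN' : (N1 + N2 + 1 <= n)%N := nN.
have nN1 : (N1 <= n)%N by apply/(leq_trans _ nN'); rewrite -addnA leq_addr.
have nN2 : (N2 <= n.+1)%N by apply/leqW/(leq_trans _ nN'); rewrite addnAC leq_addl.
have n0 : (0 < n)%N by apply: leq_trans nN'; rewrite addn1.
have s0 := s_gt0; have g1 := gamma_gtN1; have K20 : 0 <= `|K2| by [].
have c0 : 0 <= `|c| by []. have K10 : 0 <= `|K1| by [].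
have e1 := hT _ nN1; have e2 := le_trans (hV _ nN2) (ler_norm _).
have y0 := sqrt_gt0 n; have V0 := V_gt0 n; have T0 := T_gt0 n.
have m1 : 1 <= Num.sqrt n%:R :> R by rewrite -{1}sqrtr1 ler_sqrt ?ler1n// ler1n.
have my : Num.sqrt n%:R <= Num.sqrt n.+1%:R :> R by rewrite ler_sqrt ?ler_nat.
have N1' : 2 <= n.+1%:R :> R by rewrite ler_nat.
have yN : Num.sqrt n.+1%:R ^+ 2 = n.+1%:R :> R by rewrite sqr_sqrtr.
rewrite omegaE sqrtrM ?(ltW alpha_gt0)// -/s.
move: e1 e2 y0 V0 T0 m1 my N1' yN.
move: (V n.+1) (T n) (Num.sqrt n%:R) (Num.sqrt n.+1%:R) => v t m y.
move: (n.+1%:R : R) => M e1 e2 y0 v0 t0 m1 my M2 yM.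
have si : 0 < s^-1 by rewrite invr_gt0.
have si2 : 0 < (2 * s)^-1 by rewrite invr_gt0 mulr_gt0.
have y1 : 1 <= y by exact: le_trans my.
have tC : t <= C1 * y.
  have h1 : `|t - (m / s + c)| <= `|K1|.
    apply: le_trans (le_trans e1 (ler_norm _)).
    by rewrite ler_peMl.
  have h2 : m / s <= y / s by rewrite ler_pM2r.
  have h3 : `|c| <= `|c| * y by rewrite ler_peMr.
  have h4 : `|K1| <= `|K1| * y by rewrite ler_peMr.
  have h5 := ler_norm c.
  by move: h1; rewrite ler_norml /C1 => /andP[_]; lra.
have vC : v <= C2 * y.
  have h4 : `|K2| <= `|K2| * y by rewrite ler_peMr.
  by move: e2; rewrite ler_norml /C2 => /andP[_]; lra.
have M0 : 0 < M by lra.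
(* From M >= 2 and gamma > -1; this is the source of the factor 2 in the constant. *)
have Mg : M / 2 <= M + gamma by lra.
have Mg0 : 0 < M + gamma by lra.
have -> : v * (1 + s ^+ 2 * t / (M + gamma)) / M - (2 * (s * y))^-1 =
   ((v - y / (2 * s)) + v * s ^+ 2 * t / (M + gamma)) / M.
  have Mg0' : y ^+ 2 + gamma != 0 by rewrite yM gt_eqF.
  rewrite -yM; field.
  by rewrite Mg0' !gt_eqF.
rewrite normrM normfV (gtr0_norm M0) ler_pM2r ?invr_gt0//.
apply: (le_trans (ler_normD _ _)); apply: lerD => //.
have s20 : 0 < s ^+ 2 by rewrite exprn_gt0.
have vst : 0 <= v * s ^+ 2 * t
  by apply: mulr_ge0 (mulr_ge0 _ _) _; apply: ltW.
rewrite ger0_norm ?divr_ge0 ?(ltW Mg0)// ler_pdivrMr//.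
have C20 : 0 <= C2 by rewrite addr_ge0// ltW.
have C10 : 0 <= C1 by rewrite !addr_ge0// ltW.
apply: (@le_trans _ _ (C2 * y * s ^+ 2 * (C1 * y))).
  apply: ler_pM => //; [|exact: ltW|by rewrite ler_pM2r].
  by apply: mulr_ge0; apply: ltW.
rewrite (_ : _ * (C1 * y) = C2 * s ^+ 2 * C1 * M); last by rewrite -yM; ring.
rewrite (_ : 2 * _ * _ = C2 * s ^+ 2 * C1 * (2 * (M + gamma))); last by ring.
apply: ler_wpM2l; last by lra.
by apply: mulr_ge0 (mulr_ge0 C20 (ltW s20)) C10.
Qed.

End kernel_asymptotics.

Lemma eqaddO_nat {R : realType} (f g e : nat -> R) :
  (exists K N, forall n, (N <= n)%N -> `|f n - g n| <= K * `|e n|) ->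
  f = g +O_\oo e.
Proof.
move=> [K [N h]]; apply/eqaddOP; near=> k; exists N => // n /= nN.
apply: (le_trans (h n nN)); rewrite ler_wpM2r//.
Unshelve. all: by end_near. Qed.

Theorem lemma6p1 (R : realType) (gamma alpha : R)
    (gamma_gtN1 : -1 < gamma) (alpha_gt0 : 0 < alpha) :
  (xn gamma alpha =
     (fun n : nat => (4 * Num.sqrt (alpha * n%:R)
        + ln (Gamma (gamma + 1) /
              (8 * pi * alpha `^ (gamma + 1) * expR alpha)))%R)
     +O_\oo (fun n : nat => (n%:R `^ (- 2^-1))%R : R))
  /\
  (omegan gamma alpha =
     (fun n : nat => ((2 * Num.sqrt (alpha * n%:R))^-1)%R)
     +O_\oo (fun n : nat => (n%:R^-1)%R : R)).
Proof.
split; apply: eqaddO_nat.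
  have [K [N h]] := xn_asymptotics gamma alpha gamma_gtN1 alpha_gt0.
  exists K, N.+1 => n nN; apply: (le_trans (h n (ltnW nN))).
  by rewrite ger0_norm ?powR_ge0// powRN powR12_sqrt.
have [K [N h]] := omegan_asymptotics gamma alpha gamma_gtN1 alpha_gt0.
exists K, N => n nN; apply: (le_trans (h n nN)).
by rewrite ger0_norm// invr_ge0.
Qed.
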